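(* Let an $\mathcal A_0$-expected continuous GNS Bernoulli shift $(\mathcal E,\mathbf 1,S,(\mathcal E_I)_{I\in\mathcal I})$ be given. Let $c$ be a centred additive cocycle and let $\alpha,\beta$ be adapted stop-continuous functions from $\mathbb R^+\times\mathcal E$ to $\mathcal E$. Furthermore, assume that for any compact interval $[t_0,t_1]$ with $t_0\ge0$ and any $\xi\in\mathcal H_0$ there exists a constant $C_\xi\ge0$ such that for any $x,y\in\mathcal E$ and $t,s\in[t_0,t_1]$ $$d_\xi(\alpha(t,x)-\alpha(s,x))\le C_\xi\,(\|\xi\|^2+d_\xi(x))\,|f_\xi(t)-f_\xi(s)|,$$ $$d_\xi(\beta(t,x)-\beta(s,x))\le C_\xi\,(\|\xi\|^2+d_\xi(x))\,|g_\xi(t)-g_\xi(s)|,$$ $$d_\xi(\alpha(t,x)-\alpha(t,y))\le C_\xi\,d_\xi(x-y),\qquad d_\xi(\beta(t,x)-\beta(t,y))\le C_\xi\,d_\xi(x-y),$$ where $f_\xi$ and $g_\xi$ are continuous real-valued functions on $\mathbb R^+$. Then there is a unique process $x$ in $\mathcal V$ that solves the It\^o differential equation $$dx_t=\alpha(t,x_t)\,dt+dc_t\,\beta(t,x_t),\qquad x_{t_0}\in\mathcal E_{(-\infty,t_0]}.$$ Moreover, this solution $x$ is $\|\cdot\|_0$-continuous. In addition, if $x_{t_0}\in\mathcal E_{[0,t_0]}$ and if $\alpha,\beta$ are locally adapted functions, then this solution $x$ is locally adapted.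
   Context: Probability spaces. A probability space $(\mathcal A,\psi)$ is a von Neumann algebra $\mathcal A$ with separable predual and a faithful normal state $\psi$. A subalgebra of $(\mathcal A,\psi)$ is a von Neumann subalgebra $\mathcal B\subseteq\mathcal A$ for which the (unique) $\psi$-preserving conditional expectation $E_{\mathcal B}$ onto $\mathcal B$ exists. $\mathrm{Aut}(\mathcal A,\psi)$: $\psi$-preserving $*$-automorphisms. An $\mathcal A_0$-expected probability space has a distinguished subalgebra $\mathcal A_0$; $E_0$ is the $\psi$-preserving conditional expectation onto $\mathcal A_0$. Subalgebras $\mathcal B,\mathcal C\supseteq\mathcal A_0$ are $\mathcal A_0$-independent if $E_0(xy)=E_0(x)E_0(y)$ for $x\in\mathcal B$, $y\in\mathcal C$. Continuous Bernoulli shifts. $\mathcal I$ is the set of all intervals $I\subseteq\mathbb R$ (possibly unbounded or degenerate to a point) and the empty set. A filtration is a family $(\mathcal A_I)_{I\in\mathcal I}$ of subalgebras of $(\mathcal A,\psi)$ with $\mathcal A_I\subseteq\mathcal A_J$ for $I\subseteq J$; it is minimal if the $\mathcal A_I$ with $I$ bounded generate $\mathcal A$. An $\mathcal A_0$-expected continuous Bernoulli shift $(\mathcal A,\psi,S,(\mathcal A_I)_{I\in\mathcal I})$ consists of an $\mathcal A_0$-expected probability space, a pointwise weak*-continuous group $S=(S_t)_{t\in\mathbb R}\subset\mathrm{Aut}(\mathcal A,\psi)$ and a minimal filtration such that (i) $\mathcal A_0$ is the fixed point algebra of $S$; (ii) $S_t\mathcal A_I=\mathcal A_{I+t}$; (iii)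 $\mathcal A_I,\mathcal A_J$ are $\mathcal A_0$-independent whenever $I\cap J=\emptyset$ (this then also holds when only the interiors of $I$ and $J$ are disjoint). GNS version. $\mathcal A$ acts on its GNS Hilbert space $\mathcal H_\psi$ with cyclic separating vector $\Omega$; $e_0$ is the orthogonal projection onto $\mathcal H_0=\overline{\mathcal A_0\Omega}$. $\mathcal E$ is the closure of $\mathcal Ae_0$ in the strong operator topology of $\mathcal B(\mathcal H_\psi)$; it is an $\mathcal A$-$\mathcal A_0$-bimodule (left: $(y,xe_0)\mapsto yxe_0$; right: $(xe_0,a)\mapsto xae_0$) with $\mathcal A_0$-valued inner product $\langle x|y\rangle_0=x^*y$, where $\mathcal A_0e_0$ is identified with $\mathcal A_0$. Put $|x|_0=\langle x|x\rangle_0^{1/2}$, $\|x\|_0=\||x|_0\|$, and $d_\xi(x)=\||x|_0\xi\|$ for $\xi\in\mathcal H_0$; the stop topology on $\mathcal E$ is given by the seminorms $d_\xi$. For a subalgebra $\mathcal B\supseteq\mathcal A_0$ let $\mathcal E_{\mathcal B}$ be the strong closure of $\mathcal Be_0$; $\mathcal E_I:=\mathcal E_{\mathcal A_I}$. $S_t$ and $E_0$ extend to $\mathcal E$ (same symbols): if $\overline T$ is the operator on $\mathcal H_\psi$ with $\overline Tx\Omega=T(x)\Omega$, the extension is $x\mapsto\overline Tx$. If $\mathcal B,\mathcal C$ are $\mathcal A_0$-independent, $x\in\mathcal E_{\mathcal B}$, $y\in\mathcal E_{\mathcal C}$, the product $xy\in\mathcal E$ is the stop limit of $x_ny$ for any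 sequence $x_n\in\mathcal B$ with $x_ne_0\to x$ in the stop topology (well-defined). $(\mathcal E,\mathbf 1,S,(\mathcal E_I)_{I\in\mathcal I})$ constructed this way is called an $\mathcal A_0$-expected continuous GNS Bernoulli shift. Additive cocycles. An additive cocycle is a $\|\cdot\|_0$-continuous family $c=(c_t)_{t\ge0}\subset\mathcal E$ with $c_t\in\mathcal E_{[0,t]}$ and $c_{t+s}=c_t+S_tc_s$ for all $s,t\ge0$; it is centred if $E_0c_t=0$ for all $t$. Processes and integrals. A process is a family $x=(x_t)$ in $\mathcal E$; it is adapted (locally adapted) if $x_t\in\mathcal E_{(-\infty,t]}$ (resp. $x_t\in\mathcal E_{[0,t]}$) for all $t$. $\mathcal V$ is the vector space of piecewise stop-continuous adapted processes. For a simple adapted process $x=\sum_{i\ge0}x_i\chi_{[s_i,s_{i+1})}$ ($x_i\in\mathcal E_{(-\infty,s_i]}$, $(s_i)$ a partition of $\mathbb R^+$, $s_m=t_0$, $s_n=t$), $\int_{t_0}^tdc_s\,x_s:=\sum_{i=m}^{n-1}(c_{s_{i+1}}-c_{s_i})x_i$. For $x\in\mathcal V$, $\int_{t_0}^tdc_s\,x_s$ is the stop limit of $\int_{t_0}^tdc_s\,x^Z_s$, $x^Z=\sum_ix_{s_i}\chi_{[s_i,s_{i+1})}$, as the mesh of the partition $Z=\{s_i\}$ tends to $0$. A function $\alpha\colon\mathbb R^+\times\mathcal E\to\mathcal E$ is adapted if $\alpha(t,y)\in\mathcal E_{(-\infty,t]}$ for all $t\ge0$, $y\in\mathcal E_{(-\infty,t]}$;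 locally adapted if the same holds with $\mathcal E_{[0,t]}$ in place of $\mathcal E_{(-\infty,t]}$; stop-continuous if $t\mapsto\alpha(t,y)$ is stop-continuous for each $y\in\mathcal E$ and $y\mapsto\alpha(t,y)$ is stop-stop-continuous for each $t\ge0$. A process $x\in\mathcal V$ solves $dx_t=\alpha(t,x_t)dt+dc_t\beta(t,x_t)$ with given initial value $x_{t_0}$ if $x_t=x_{t_0}+\int_{t_0}^t\alpha(s,x_s)\,ds+\int_{t_0}^tdc_s\,\beta(s,x_s)$ for $t\ge t_0$. *)

(* Defs.v *)
(* MathComp-Analysis; scalars are the complex numbers R[i] over R : realType. *)
From HB Require Import structures.
From mathcomp Require Import all_boot all_order all_algebra.
From mathcomp Require Import complex.
From mathcomp Require Import all_classical all_reals all_analysis.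

Set Implicit Arguments.
Unset Strict Implicit.
Unset Printing Implicit Defensive.

Import Order.TTheory GRing.Theory Num.Theory.
Import numFieldNormedType.Exports.

Local Open Scope classical_set_scope.
Local Open Scope complex_scope.
Local Open Scope ring_scope.

(* A von Neumann algebra with a faithful normal state is given here in its GNS
   representation: H is a complex Hilbert space with inner product ip (linear
   in the first argument), operators are functions H -> H, an algebra is a set
   of operators and the state is the vector state of a cyclic separating unit
   vector.  Functions on an algebra are total; only their values on the algebra
   are relevant. *)

Section Operators.
Variables (R : realType) (H : completeNormedModType R[i]).
Variable ip : {dot H for (@Num.conj R[i])}.

Definition hnorm (u : H) : R := complex.Re `|u|.

Definition bounded_op (x : H -> H) : Prop := linear x /\ continuous x.

Definition opnorm (x : H -> H) : R :=
  sup [set hnorm (x u) | u in [set u | hnorm u <= 1]].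

Definition adj (x : H -> H) : H -> H :=
  xget 0 [set y | bounded_op y /\ forall u v, ip (x u) v = ip u (y v)].

Definition positive_op (x : H -> H) : Prop :=
  bounded_op x /\ forall u, 0 <= ip (x u) u.

Definition sqrt_op (x : H -> H) : H -> H :=
  xget 0 [set y | positive_op y /\ y \o y = x].

Definition orth_proj (K : set H) : H -> H :=
  xget 0 [set p | forall u, K (p u) /\ forall v, K v -> ip v (u - p u) = 0].

(* The strong operator topology is pointwise convergence in norm. *)
Definition strong_closure (X : set (H -> H)) : set (H -> H) :=
  [set x | bounded_op x /\ closure (X : set {ptws H -> H}) x].

Record vn_algebra (M : set (H -> H)) : Prop := {
  vn_bounded : M `<=` bounded_op;
  vn_one : M idfun;
  vn_linear : forall (k : R[i]) x y, M x -> M y -> M (k *: x + y);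
  vn_mul : forall x y, M x -> M y -> M (x \o y);
  vn_adj : forall x, M x -> M (adj x);
  vn_closed : strong_closure M `<=` M }.

(* The predual of M consists of the sigma-weakly continuous functionals. *)
Definition normal_functional (M : set (H -> H)) (phi : (H -> H) -> R[i]) :=
  exists xi eta : nat -> H,
    [/\ cvgn (series (fun n => hnorm (xi n) ^+ 2)),
        cvgn (series (fun n => hnorm (eta n) ^+ 2)) &
        forall a, M a ->
          series (fun n => ip (a (xi n)) (eta n) : R[i]^o) @ \oo
            --> (phi a : R[i]^o)].

Definition separable_predual (M : set (H -> H)) :=
  exists2 phi : nat -> (H -> H) -> R[i],
    (forall n, normal_functional M (phi n)) &
    forall psi, normal_functional M psi -> forall e : R, 0 < e ->
      exists n, forall a, M a -> opnorm a <= 1 ->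
        complex.Re `|psi a - phi n a| <= e.

Record prob_space (M : set (H -> H)) (Om : H) : Prop := {
  ps_hilbert : forall u, `|u| ^+ 2 = ip u u;
  ps_vn : vn_algebra M;
  ps_predual : separable_predual M;
  ps_unit : ip Om Om = 1;
  ps_cyclic : closure [set a Om | a in M] = setT;
  ps_separating : forall a, M a -> a Om = 0 -> a = 0 }.

Definition vstate (Om : H) (a : H -> H) : R[i] := ip (a Om) Om.

Record cond_exp (M : set (H -> H)) (Om : H) (B : set (H -> H))
    (E : (H -> H) -> (H -> H)) : Prop := {
  ce_range : forall a, M a -> B (E a);
  ce_linear : forall (k : R[i]) a b,
    M a -> M b -> E (k *: a + b) = k *: E a + E b;
  ce_id : forall b, B b -> E b = b;
  ce_pos : forall a, M a -> positive_op a -> positive_op (E a);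
  ce_bimod : forall b a b', B b -> M a -> B b' ->
    E (b \o a \o b') = b \o E a \o b';
  ce_state : forall a, M a -> vstate Om (E a) = vstate Om a }.

Definition subalgebra (M : set (H -> H)) (Om : H) (B : set (H -> H)) : Prop :=
  [/\ vn_algebra B, B `<=` M & exists E, cond_exp M Om B E].

Record state_aut (M : set (H -> H)) (Om : H)
    (T : (H -> H) -> (H -> H)) : Prop := {
  aut_bij : set_bij M M T;
  aut_linear : forall (k : R[i]) a b,
    M a -> M b -> T (k *: a + b) = k *: T a + T b;
  aut_mul : forall a b, M a -> M b -> T (a \o b) = T a \o T b;
  aut_adj : forall a, M a -> T (adj a) = adj (T a);
  aut_state : forall a, M a -> vstate Om (T a) = vstate Om a }.

Definition independent (A0 : set (H -> H)) (E0 : (H -> H) -> (H -> H))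
    (B C : set (H -> H)) : Prop :=
  [/\ A0 `<=` B, A0 `<=` C &
      forall x y, B x -> C y -> E0 (x \o y) = E0 x \o E0 y].

(* Index sets of the filtration: the values of bs_filt are only constrained on
   the sets I with is_interval I, which include the empty set, the singletons
   and the unbounded intervals. *)
Record bernoulli_shift := {
  bs_alg : set (H -> H);
  bs_vec : H;
  bs_alg0 : set (H -> H);
  bs_exp0 : (H -> H) -> (H -> H);
  bs_shift : R -> (H -> H) -> (H -> H);
  bs_filt : set R -> set (H -> H);
  bs_prob : prob_space bs_alg bs_vec;
  bs_sub0 : subalgebra bs_alg bs_vec bs_alg0;
  bs_exp0P : cond_exp bs_alg bs_vec bs_alg0 bs_exp0;
  bs_aut : forall t, state_aut bs_alg bs_vec (bs_shift t);
  bs_shift0 : forall a, bs_alg a -> bs_shift 0 a = a;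
  bs_shiftD : forall s t a,
    bs_alg a -> bs_shift (s + t) a = bs_shift s (bs_shift t a);
  bs_continuous : forall a phi, bs_alg a -> normal_functional bs_alg phi ->
    continuous (fun t : R => phi (bs_shift t a) : R[i]^o);
  bs_filt_sub : forall I, is_interval I ->
    subalgebra bs_alg bs_vec (bs_filt I);
  bs_filt_mono : forall I J, is_interval I -> is_interval J -> I `<=` J ->
    bs_filt I `<=` bs_filt J;
  bs_minimal : forall N, vn_algebra N ->
    (forall I : set R, is_interval I -> has_lbound I -> has_ubound I ->
      bs_filt I `<=` N) ->
    bs_alg `<=` N;
  bs_fixed : bs_alg0 =
    [set a | bs_alg a /\ forall t, bs_shift t a = a];
  bs_covariant : forall t I, is_interval I ->
    bs_shift t @` bs_filt I = bs_filt [set s + t | s in I];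
  bs_indep : forall I J, is_interval I -> is_interval J -> I `&` J = set0 ->
    independent bs_alg0 bs_exp0 (bs_filt I) (bs_filt J) }.

End Operators.

Section GNSModule.
Variables (R : realType) (H : completeNormedModType R[i]).
Variable ip : {dot H for (@Num.conj R[i])}.
Variable B : bernoulli_shift ip.

Definition space0 : set H := closure [set a (bs_vec B) | a in bs_alg0 B].

Definition proj0 : H -> H := orth_proj ip space0.

Definition gns_module (N : set (H -> H)) : set (H -> H) :=
  strong_closure [set a \o proj0 | a in N].

Definition gmod : set (H -> H) := gns_module (bs_alg B).

Definition gmodI (I : set R) : set (H -> H) := gns_module (bs_filt B I).

(* The operator on H with [a Om |-> T(a) Om] and the induced map on gmod. *)
Definition gns_op (T : (H -> H) -> (H -> H)) : H -> H :=
  xget 0 [set V | bounded_op V /\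
    forall a, bs_alg B a -> V (a (bs_vec B)) = T a (bs_vec B)].

Definition gns_ext (T : (H -> H) -> (H -> H)) (x : H -> H) : H -> H :=
  gns_op T \o x.

Definition inner0 (x y : H -> H) : H -> H := adj ip x \o y.

Definition abs0 (x : H -> H) : H -> H := sqrt_op ip (inner0 x x).

Definition norm0 (x : H -> H) : R := opnorm (abs0 x).

Definition dsn (xi : H) (x : H -> H) : R := hnorm (abs0 x xi).

Definition stop_cvg (x : nat -> H -> H) (y : H -> H) : Prop :=
  forall xi, space0 xi -> (fun n => dsn xi (x n - y)) @ \oo --> (0 : R).

Definition stop_continuous_on (D : set R) (x : R -> H -> H) : Prop :=
  forall t, D t -> forall xi, space0 xi ->
    (fun s => dsn xi (x s - x t)) @ within D (nbhs t) --> (0 : R).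

Definition norm0_continuous_on (D : set R) (x : R -> H -> H) : Prop :=
  forall t, D t ->
    (fun s => norm0 (x s - x t)) @ within D (nbhs t) --> (0 : R).

(* Continuity of a map of gmod for the topology generated by the seminorms. *)
Definition stop_stop_continuous (F : (H -> H) -> (H -> H)) : Prop :=
  forall y, gmod y -> forall xi, space0 xi -> forall e : R, 0 < e ->
    exists zs : seq H, exists2 d : R, 0 < d &
      (forall z, z \in zs -> space0 z) /\
      forall y', gmod y' -> (forall z, z \in zs -> dsn z (y' - y) < d) ->
        dsn xi (F y' - F y) < e.

(* The product of x in gns_module N with y in gns_module of an algebra
   independent of N; the value is 0 if the limit does not exist. *)
Definition approx_by (N : set (H -> H)) (x : H -> H) (xs : nat -> H -> H) :=
  (forall n, N (xs n)) /\ stop_cvg (fun n => xs n \o proj0) x.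

Definition gmul (N : set (H -> H)) (x y : H -> H) : H -> H :=
  xget 0 [set z | [/\ gmod z, exists xs, approx_by N x xs &
    forall xs, approx_by N x xs -> stop_cvg (fun n => xs n \o y) z]].

Record additive_cocycle (c : R -> H -> H) : Prop := {
  ac_continuous : norm0_continuous_on `[0, +oo[ c;
  ac_local : forall t, 0 <= t -> gmodI `[0, t] (c t);
  ac_cocycle : forall s t, 0 <= s -> 0 <= t ->
    c (t + s) = c t + gns_ext (bs_shift B t) (c s) }.

Definition centred (c : R -> H -> H) : Prop :=
  forall t, 0 <= t -> gns_ext (bs_exp0 B) (c t) = 0.

Definition adapted (x : R -> H -> H) : Prop :=
  forall t, 0 <= t -> gmodI `]-oo, t] (x t).

(* The partition t0 = p_0 < ... < p_n = t is encoded by t0 and the sequence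
   p = [:: p_1; ...; p_n]; p is empty if t = t0. *)
Definition partition_pts (t0 t : R) (p : seq R) : Prop :=
  path <%R t0 p /\ last t0 p = t.

Definition pt (t0 : R) (p : seq R) (i : nat) : R := nth 0 (t0 :: p) i.

(* On each compact interval there are finitely many discontinuities, and the
   one-sided limits exist in gmod; values at the discontinuities are free. *)
Definition piecewise_stop_continuous (x : R -> H -> H) : Prop :=
  forall T, 0 <= T -> exists2 p, partition_pts 0 T p &
    forall i, (i < size p)%N -> exists y : R -> H -> H,
      let D := `[pt 0 p i, pt 0 p i.+1]%classic in
      [/\ forall s, D s -> gmod (y s),
          stop_continuous_on D y &
          forall s, pt 0 p i < s < pt 0 p i.+1 -> x s = y s].

Definition procV (x : R -> H -> H) : Prop :=
  adapted x /\ piecewise_stop_continuous x.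

Definition mesh_lt (t0 : R) (p : seq R) (d : R) : Prop :=
  forall i, (i < size p)%N -> pt t0 p i.+1 - pt t0 p i < d.

Definition ito_sum (c x : R -> H -> H) (t0 : R) (p : seq R) : H -> H :=
  \sum_(i < size p)
    gmul (bs_filt B `[pt t0 p i, pt t0 p i.+1])
      (c (pt t0 p i.+1) - c (pt t0 p i)) (x (pt t0 p i)).

Definition is_ito_integral (c x : R -> H -> H) (t0 t : R) (z : H -> H) : Prop :=
  gmod z /\ forall xi, space0 xi -> forall e : R, 0 < e ->
    exists2 d : R, 0 < d & forall p, partition_pts t0 t p -> mesh_lt t0 p d ->
      dsn xi (ito_sum c x t0 p - z) < e.

Definition riemann_sum (x : R -> H -> H) (t0 : R) (p : seq R)
    (tag : nat -> R) : H -> H :=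
  \sum_(i < size p) ((pt t0 p i.+1 - pt t0 p i)%:C *: x (tag i)).

Definition is_riemann_integral (x : R -> H -> H) (t0 t : R) (z : H -> H) :=
  gmod z /\ forall xi, space0 xi -> forall e : R, 0 < e ->
    exists2 d : R, 0 < d & forall p tag,
      partition_pts t0 t p -> mesh_lt t0 p d ->
      (forall i, (i < size p)%N -> pt t0 p i <= tag i <= pt t0 p i.+1) ->
      dsn xi (riemann_sum x t0 p tag - z) < e.

Record coefficient (al : R -> (H -> H) -> (H -> H)) : Prop := {
  co_gmod : forall t y, 0 <= t -> gmod y -> gmod (al t y);
  co_adapted : forall t y, 0 <= t ->
    gmodI `]-oo, t] y -> gmodI `]-oo, t] (al t y);
  co_time : forall y, gmod y -> stop_continuous_on `[0, +oo[ (al ^~ y);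
  co_space : forall t, 0 <= t -> stop_stop_continuous (al t) }.

Definition locally_adapted_fun (al : R -> (H -> H) -> (H -> H)) : Prop :=
  forall t y, 0 <= t -> gmodI `[0, t] y -> gmodI `[0, t] (al t y).

Definition solves_ito (al be : R -> (H -> H) -> (H -> H)) (c : R -> H -> H)
    (t0 : R) (x : R -> H -> H) : Prop :=
  forall t, t0 <= t -> exists a b : H -> H,
    [/\ is_riemann_integral (fun s => al s (x s)) t0 t a,
        is_ito_integral c (fun s => be s (x s)) t0 t b &
        x t = x t0 + a + b].

End GNSModule.

(* Main.v *)
Require Import Defs.
From HB Require Import structures.
From mathcomp Require Import all_boot all_order all_algebra.
From mathcomp Require Import complex.
From mathcomp Require Import all_classical all_reals all_analysis.
From mathcomp Require Import ring lra.

(** The equation is solved by Picard iteration, one vector of the space of A0 at a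
    time, and the point is to have the estimates that make this possible.

    A seminorm d_xi is the length of the value at xi (dsnE), so the stop topology
    is pointwise convergence on the closure of A0 Om, and uniform boundedness makes
    the modules complete for sequences that converge pointwise (gns_complete).

    An element w of an algebra which is independent of J acts between vectors
    generated over J as its conditional expectation (free_disjoint, and
    free_touching when the intervals share an end point).  Applied to w^* w this
    bounds w on these vectors by its bound on the vectors of A0 (free_le), and
    since E0 (w^* w) commutes with the commutant of the whole algebra, for which
    Om is cyclic, smallness at Om implies smallness on all vectors generated over
    J for bounded families (free_small).  Kaplansky density for the module
    (bounded_approx), which rests on a bounded transform with coefficients in A0
    and on weak closedness, supplies bounded approximating sequences.  Together
    these facts construct the product of independent elements with the expected
    norm estimate (gmul_spec), and show that multiplication by a centred element
    makes everything orthogonal to the vectors generated over J (centred_orth).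

    The increments of a centred cocycle are therefore orthogonal to the past.  By
    Pythagoras the squared length of c_t u is additive in t, hence linear, and the
    terms of an Ito sum satisfy a mean-square estimate with the length of the
    interval as weight (dc_estimate).  Riemann sums satisfy the same kind of
    estimate by the Cauchy-Schwarz inequality (riem_estimate).  Both integrals are
    limits of sums of an additive increment process with such an estimate, and
    existence, additivity, locality and bounds are proved once for all of these.

    In the norm weighted by exp (k t), with k large depending on xi and on the
    horizon, the right-hand side of the equation is a contraction by the factor
    1 / 2 at xi (contraction).  The iterates converge geometrically to an adapted
    process with continuous trajectories (picard_fixpoint).  A second solution in
    V is bounded on compact intervals and hence equal to it (picard_unique).  The
    mean-square estimates over short intervals show that the solution is Hoelder
    continuous of exponent 1 / 2 at each vector, and uniform boundedness of the
    coefficients along the solution turns this into continuity in norm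
    (picard_norm0_continuous).  Finally all sums of locally adapted integrands are
    located in [0, t], and the local modules are closed (picard_local). *)


Set Implicit Arguments.
Unset Strict Implicit.
Unset Printing Implicit Defensive.

Import Order.TTheory GRing.Theory Num.Theory.
Import numFieldNormedType.Exports.

Local Open Scope classical_set_scope.
Local Open Scope complex_scope.
Local Open Scope ring_scope.


(** * Norm and sequences in the Hilbert space *)

Section Hilbert.
Variables (R : realType) (H : completeNormedModType R[i]).

Lemma ReD (x y : R[i]) : complex.Re (x + y) = complex.Re x + complex.Re y.
Proof. by case: x; case: y. Qed.

Lemma ReN (x : R[i]) : complex.Re (- x) = - complex.Re x.
Proof. by case: x. Qed.

Lemma complexRe_conj (x : R[i]) : complex.Re (Num.conj x) = complex.Re x.
Proof. by case: x. Qed.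

Lemma ReZ (a : R) (x : R[i]) : complex.Re (a%:C * x) = a * complex.Re x.
Proof. by case: x => x y /=; rewrite mul0r subr0. Qed.

Lemma Re_mono (x y : R[i]) : x <= y -> complex.Re x <= complex.Re y.
Proof. by rewrite lecE => /andP[]. Qed.

Lemma normE (u : H) : `|u| = (hnorm u)%:C.
Proof.
have: (0 : R[i]) <= `|u| by [].
rewrite /hnorm; case: `|u| => a b; rewrite lecE /= => /andP[/eqP-> _].
by [].
Qed.

Lemma hnorm_ge0 (u : H) : 0 <= hnorm u.
Proof. by have := Re_mono (normr_ge0 u). Qed.
Hint Resolve hnorm_ge0 : core.

Lemma hnormD (u v : H) : hnorm (u + v) <= hnorm u + hnorm v.
Proof. by have := Re_mono (ler_normD u v); rewrite ReD. Qed.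

Lemma hnorm0 : hnorm (0 : H) = 0.
Proof. by rewrite /hnorm normr0. Qed.

Lemma hnormN (u : H) : hnorm (- u) = hnorm u.
Proof. by rewrite /hnorm normrN. Qed.

Lemma hnormB (u v : H) : hnorm (u - v) = hnorm (v - u).
Proof. by rewrite -hnormN opprB. Qed.

Lemma hnorm_eq0 (u : H) : hnorm u = 0 -> u = 0.
Proof. by move=> h; apply/eqP; rewrite -normr_eq0 normE h. Qed.

Lemma hnormZC (k : R[i]) (u : H) : hnorm (k *: u) = complex.Re `|k| * hnorm u.
Proof.
rewrite /hnorm normrZ normE.
have -> : `|k| = (complex.Re `|k|)%:C.
  by have: (0 : R[i]) <= `|k| by []; case: `|k| => a b;
     rewrite lecE /= => /andP[/eqP-> _].
by rewrite ReZ.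
Qed.

Lemma hnormZ (a : R) (u : H) : hnorm (a%:C *: u) = `|a| * hnorm u.
Proof. by rewrite hnormZC normc_def /= expr0n /= addr0 sqrtr_sqr. Qed.

Lemma hnorm_triB (u v w : H) : hnorm (u - w) <= hnorm (u - v) + hnorm (v - w).
Proof.
have -> : u - w = (u - v) + (v - w) by rewrite addrA subrK.
exact: hnormD.
Qed.

Lemma hnorm_le_diff (u v : H) : hnorm u <= hnorm v + hnorm (u - v).
Proof. by have := hnormD v (u - v); rewrite addrC subrK. Qed.

(** Convergence is expressed by the real-valued norm hnorm: the norm of H takes
   its values in R[i], whose order is only partial. *)
Definition hcvg (u : nat -> H) (l : H) :=
  forall e : R, 0 < e -> exists N, forall n, (N <= n)%N -> hnorm (u n - l) < e.

Definition hcauchy (u : nat -> H) :=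
  forall e : R, 0 < e -> exists N, forall m n, (N <= m)%N -> (N <= n)%N ->
    hnorm (u m - u n) < e.

Lemma hcvg_cst (l : H) : hcvg (fun=> l) l.
Proof. by move=> e e0; exists 0%N => n _; rewrite subrr hnorm0. Qed.

Lemma hcvg_eq (u v : nat -> H) l : (forall n, u n = v n) -> hcvg u l -> hcvg v l.
Proof. by move=> uv h e /h[N hN]; exists N => n /hN; rewrite uv. Qed.

Lemma hcvgD (u v : nat -> H) l m :
  hcvg u l -> hcvg v m -> hcvg (fun n => u n + v n) (l + m).
Proof.
move=> hu hv e e0; have e2 : 0 < e / 2 by lra.
have [N1 h1] := hu _ e2; have [N2 h2] := hv _ e2.
exists (maxn N1 N2) => n; rewrite geq_max => /andP[n1 n2].
rewrite opprD addrACA; apply: le_lt_trans (hnormD _ _) _.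
by have := h1 _ n1; have := h2 _ n2; lra.
Qed.

(** The form in which bounded linear maps preserve convergence. *)
Lemma hcvg_lip (u : nat -> H) l (v : nat -> H) m (K : R) :
  (forall n, hnorm (v n - m) <= K * hnorm (u n - l)) -> hcvg u l -> hcvg v m.
Proof.
move=> hK hu e e0.
have K1 : 0 < `|K| + 1 by have := normr_ge0 K; lra.
have [N hN] := hu (e / (`|K| + 1)) (divr_gt0 e0 K1).
exists N => n /hN; rewrite ltr_pdivlMr // => h.
apply: le_lt_trans (hK n) _; apply: le_lt_trans h.
rewrite mulrC; apply: ler_wpM2l => //; have := ler_norm K; lra.
Qed.

Lemma hcvgZ (k : R[i]) (u : nat -> H) l :
  hcvg u l -> hcvg (fun n => k *: u n) (k *: l).
Proof.
apply: (hcvg_lip (K := complex.Re `|k|)) => n.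
by rewrite -scalerBr hnormZC.
Qed.

Lemma hcvgN (u : nat -> H) l : hcvg u l -> hcvg (fun n => - u n) (- l).
Proof.
by apply: (hcvg_lip (K := 1)) => n; rewrite -opprD hnormN mul1r.
Qed.

Lemma hcvgB (u v : nat -> H) l m :
  hcvg u l -> hcvg v m -> hcvg (fun n => u n - v n) (l - m).
Proof. by move=> hu hv; apply: hcvgD => //; apply: hcvgN. Qed.

Lemma hnorm_le_eps (u : H) : (forall e : R, 0 < e -> hnorm u <= e) -> u = 0.
Proof.
move=> h; apply: hnorm_eq0; apply/eqP; rewrite eq_le hnorm_ge0 andbT.
by apply/ler_addgt0Pr => e e0; rewrite add0r; apply: h.
Qed.

Lemma hcvg_unique (u : nat -> H) l m : hcvg u l -> hcvg u m -> l = m.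
Proof.
move=> hl hm; apply/eqP; rewrite -subr_eq0; apply/eqP; apply: hnorm_le_eps => e e0.
have e2 : 0 < e / 2 by lra.
have [N1 h1] := hl _ e2; have [N2 h2] := hm _ e2.
have := h1 _ (leq_maxl N1 N2); have := h2 _ (leq_maxr N1 N2).
have := hnorm_triB l (u (maxn N1 N2)) m; rewrite (hnormB l (u _)); lra.
Qed.

Lemma hcvg_le (u : nat -> H) l (M : R) :
  hcvg u l -> (forall n, hnorm (u n) <= M) -> hnorm l <= M.
Proof.
move=> h hM; apply/ler_addgt0Pr => e /h[N /(_ N (leqnn _)) hN].
have := hM N; have := hnorm_le_diff l (u N); rewrite hnormB; lra.
Qed.

Lemma hcvg_cauchy (u : nat -> H) l : hcvg u l -> hcauchy u.
Proof.
move=> h e e0; have [N hN] := h _ (divr_gt0 e0 (ltr0n _ 2)).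
exists N => m n /hN h1 /hN h2; apply: le_lt_trans (hnorm_triB _ l _) _.
rewrite (hnormB l); lra.
Qed.

Lemma hcauchy_cvg (u : nat -> H) : hcauchy u -> exists l, hcvg u l.
Proof.
move=> h.
have : cauchy (u @ \oo).
  apply/cauchy_ballP => /= e e0.
  have /andP[/eqP ei er] : (complex.Im e == 0) && (0 < complex.Re e).
    by move: e0; rewrite ltcE /= eq_sym.
  have [N hN] := h _ er.
  exists ([set u n | n in [set n | (N <= n)%N]], [set u n | n in [set n | (N <= n)%N]]).
    by split; exists N => // n /= Nn; exists n.
  move=> [a b] /= [[m Nm <-] [n Nn <-]].
  rewrite /= -ball_normE /= normE ltcE /= ei eqxx /=; exact: hN.
move/cauchy_cvg => /cvg_ex[l hl]; exists l => e e0.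
move/cvgrPdist_lt : hl => /(_ e%:C); rewrite ltcR => /(_ e0)[N _ hN].
exists N => n /= /hN; rewrite /= normE ltcR hnormB; exact.
Qed.

Lemma invS_small (e : R) : 0 < e ->
  exists N, forall n, (N <= n)%N -> n.+1%:R^-1 < e :> R.
Proof.
move=> e0; exists (Num.truncn e^-1) => n Nn.
rewrite invf_plt ?posrE //.
by apply: lt_le_trans (truncnS_gt _) _; rewrite ler_nat ltnS.
Qed.

Lemma hcvg_bounded (u : nat -> H) l : hcvg u l -> exists M : R, forall n, hnorm (u n) <= M.
Proof.
move=> h; have [N hN] := h 1 ltr01.
have s0 : 0 <= \sum_(i < N) hnorm (u i) by apply: sumr_ge0.
exists (\sum_(i < N) hnorm (u i) + (hnorm l + 1)) => n.
have [Nn|nN] := leqP N n.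
  by have := hN n Nn; have := hnorm_le_diff (u n) l; lra.
rewrite (bigD1 (Ordinal nN)) //=.
have s1 : 0 <= \sum_(i < N | i != Ordinal nN) hnorm (u i) by apply: sumr_ge0.
by have := hnorm_ge0 l; lra.
Qed.

Lemma hnorm_sq_le (u : H) (M : R) : hnorm u ^+ 2 <= M -> hnorm u <= Num.sqrt M.
Proof. by move=> h; rewrite -[leLHS]ger0_norm // -sqrtr_sqr ler_wsqrtr. Qed.

Lemma hcvg_sq_le (u : nat -> H) l (M : R) :
  hcvg u l -> (forall n, hnorm (u n) ^+ 2 <= M) -> hnorm l ^+ 2 <= M.
Proof.
move=> h hM; have M0 : 0 <= M by apply: le_trans (hM 0%N); exact: sqr_ge0.
rewrite -[leRHS](sqr_sqrtr M0) ler_pXn2r ?nnegrE ?sqrtr_ge0 //.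
by apply: hcvg_le h _ => n; exact: hnorm_sq_le.
Qed.
End Hilbert.
#[global] Hint Extern 0 (is_true (0 <= hnorm _)) => exact: hnorm_ge0 : core.

(** * Inner product and projection in finite powers *)

Section InnerProduct.
Variables (R : realType) (H : completeNormedModType R[i]).
Variable ip : {dot H for (@Num.conj R[i])}.

(** H as a real Hilbert space; estimates in R only need this form. *)
Definition rip (u v : H) : R := complex.Re (ip u v).

Lemma ipDl u v w : ip (u + v) w = ip u w + ip v w.
Proof. exact: linearDl. Qed.

Lemma ipDr u v w : ip u (v + w) = ip u v + ip u w.
Proof. exact: linearDr. Qed.

Lemma ipZl k u v : ip (k *: u) v = k * ip u v.
Proof. exact: linearZl_LR. Qed.

Lemma ipZr k u v : ip u (k *: v) = Num.conj k * ip u v.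
Proof. by rewrite linearZr_LR. Qed.

Lemma ipNl u v : ip (- u) v = - ip u v.
Proof. by rewrite -scaleN1r ipZl mulN1r. Qed.

Lemma ipNr u v : ip u (- v) = - ip u v.
Proof. by rewrite -scaleN1r ipZr rmorphN rmorph1 mulN1r. Qed.

Lemma ipBl u v w : ip (u - v) w = ip u w - ip v w.
Proof. by rewrite ipDl ipNl. Qed.

Lemma ipBr u v w : ip u (v - w) = ip u v - ip u w.
Proof. by rewrite ipDr ipNr. Qed.

Lemma ip0l u : ip 0 u = 0.
Proof. by rewrite -(scale0r 0) ipZl mul0r. Qed.

Lemma ip0r u : ip u 0 = 0.
Proof. by rewrite -(scale0r 0) ipZr rmorph0 mul0r. Qed.

Lemma ipC u v : ip u v = Num.conj (ip v u).
Proof. by rewrite hermC /= expr0 mul1r. Qed.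

Lemma ripDl u v w : rip (u + v) w = rip u w + rip v w.
Proof. by rewrite /rip ipDl ReD. Qed.

Lemma ripDr u v w : rip u (v + w) = rip u v + rip u w.
Proof. by rewrite /rip ipDr ReD. Qed.

Lemma ripNl u v : rip (- u) v = - rip u v.
Proof. by rewrite /rip ipNl ReN. Qed.

Lemma ripNr u v : rip u (- v) = - rip u v.
Proof. by rewrite /rip ipNr ReN. Qed.

Lemma ripBl u v w : rip (u - v) w = rip u w - rip v w.
Proof. by rewrite ripDl ripNl. Qed.

Lemma ripBr u v w : rip u (v - w) = rip u v - rip u w.
Proof. by rewrite ripDr ripNr. Qed.

Lemma ripC u v : rip u v = rip v u.
Proof. by rewrite /rip ipC; exact: complexRe_conj. Qed.

Lemma ripZl a u v : rip (a%:C *: u) v = a * rip u v.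
Proof. by rewrite /rip ipZl ReZ. Qed.

Lemma ripZr a u v : rip u (a%:C *: v) = a * rip u v.
Proof. by rewrite ripC ripZl ripC. Qed.

Lemma rip0l u : rip 0 u = 0.
Proof. by rewrite /rip ip0l. Qed.

Lemma rip0r u : rip u 0 = 0.
Proof. by rewrite /rip ip0r. Qed.

Definition ripE := (ripDl, ripDr, ripNl, ripNr, ripZl, ripZr, rip0l, rip0r).

(** The imaginary part of ip u v is the real part of ip u ('i *: v). *)
Lemma ip_eq u v u' v' : rip u v = rip u' v' ->
  rip u ('i *: v) = rip u' ('i *: v') -> ip u v = ip u' v'.
Proof.
rewrite /rip !ipZr.
case: (ip u v) => a b; case: (ip u' v') => c d /= h1 h2.
apply/eqP; rewrite eq_complex /= h1 eqxx /=; apply/eqP.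
by move: h2; rewrite !mul0r !mulN1r !opprK !add0r.
Qed.

Lemma ip_eq0 u v : rip u v = 0 -> rip u ('i *: v) = 0 -> ip u v = 0.
Proof. by move=> h1 h2; rewrite -(ip0l v); apply: ip_eq; rewrite rip0l. Qed.

Hypothesis Hip : forall u : H, `|u| ^+ 2 = ip u u.

Lemma hnorm_sq u : hnorm u ^+ 2 = rip u u.
Proof. by rewrite /rip -Hip normE -rmorphXn. Qed.

Lemma ip_self u : ip u u = (hnorm u ^+ 2)%:C.
Proof. by rewrite -Hip normE -rmorphXn. Qed.

Lemma hnorm_sqD u v :
  hnorm (u + v) ^+ 2 = hnorm u ^+ 2 + 2 * rip u v + hnorm v ^+ 2.
Proof. rewrite !hnorm_sq ripDl !ripDr (ripC v u); ring. Qed.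

Lemma hnorm_sqB u v :
  hnorm (u - v) ^+ 2 = hnorm u ^+ 2 - 2 * rip u v + hnorm v ^+ 2.
Proof. rewrite hnorm_sqD hnormN ripNr; ring. Qed.

Lemma rip_eq0 u : rip u u = 0 -> u = 0.
Proof. by rewrite -hnorm_sq => /eqP; rewrite expf_eq0 => /eqP/hnorm_eq0. Qed.

Lemma cauchy_schwarz u v : `|rip u v| <= hnorm u * hnorm v.
Proof.
have [v0|v0] := eqVneq (hnorm v) 0.
  by rewrite (hnorm_eq0 v0) rip0r normr0; apply: mulr_ge0.
have vp : 0 < hnorm v by rewrite lt_def v0 hnorm_ge0.
have wlg w : rip w v <= hnorm w * hnorm v.
  have h := sqr_ge0 (hnorm ((hnorm v)%:C *: w - (hnorm w)%:C *: v)).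
  rewrite hnorm_sqB !hnormZ ripZl ripZr !ger0_norm // in h.
  have [w0|w0] := eqVneq (hnorm w) 0.
    by rewrite (hnorm_eq0 w0) rip0l hnorm0 mul0r.
  have wp : 0 < hnorm w by rewrite lt_def w0 hnorm_ge0.
  have : 0 <= (2 * hnorm v * hnorm w) * (hnorm w * hnorm v - rip w v).
    by apply: le_trans h _; rewrite le_eqVlt; apply/orP; left; apply/eqP; ring.
  rewrite pmulr_rge0 ?subr_ge0 //.
  by rewrite !mulr_gt0.
rewrite ler_norml wlg andbT lerNl -ripNl -(hnormN u); exact: wlg.
Qed.

Lemma rip_le u v : rip u v <= hnorm u * hnorm v.
Proof. exact: le_trans (ler_norm _) (cauchy_schwarz _ _). Qed.

Lemma ip_nondeg u v : (forall w, ip w u = ip w v) -> u = v.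
Proof.
move=> h; apply/eqP; rewrite -subr_eq0; apply/eqP/rip_eq0.
by rewrite /rip ipBr h subrr.
Qed.

Lemma hcvg_rip u l v m : hcvg u l -> hcvg v m ->
  forall e : R, 0 < e -> exists N, forall n, (N <= n)%N ->
    `|rip (u n) (v n) - rip l m| < e.
Proof.
move=> hu hv e e0.
pose K := hnorm l + hnorm m + 1.
have K0 : 0 < K by have := hnorm_ge0 l; have := hnorm_ge0 m; rewrite /K; lra.
pose d := Num.min 1 (e / (2 * K)).
have d0 : 0 < d.
  by rewrite lt_min ltr01 divr_gt0 // mulr_gt0.
have [N1 h1] := hu _ d0; have [N2 h2] := hv _ d0.
exists (maxn N1 N2) => n; rewrite geq_max => /andP[/h1 a /h2 b].
have -> : rip (u n) (v n) - rip l m = rip (u n - l) (v n) + rip l (v n - m).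
  by rewrite ripBl ripBr; ring.
have d1 : d <= 1 by rewrite ge_min lexx.
have d2 : d * (2 * K) <= e by rewrite -ler_pdivlMr ?mulr_gt0 // ge_min lexx orbT.
apply: le_lt_trans (ler_normD _ _) _.
have c1 := cauchy_schwarz (u n - l) (v n).
have c2 := cauchy_schwarz l (v n - m).
have c3 := hnorm_le_diff (v n) m.
have c4 := hnorm_ge0 (u n - l); have c5 := hnorm_ge0 (v n - m).
have c6 := hnorm_ge0 l; have c7 := hnorm_ge0 m.
have : hnorm (u n - l) * hnorm (v n) <= d * (hnorm m + 1).
  by apply: ler_pM => //; lra.
have : hnorm l * hnorm (v n - m) <= hnorm l * d by apply: ler_wpM2l => //; lra.
rewrite /K in d2 *; nra.
Qed.

Lemma hcvg_rip_eq (u v : nat -> H) l m a : hcvg u l -> hcvg v m ->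
  (forall n, rip (u n) (v n) = a) -> rip l m = a.
Proof.
move=> hu hv ha; apply/eqP; rewrite -subr_eq0 -normr_le0.
apply/ler_addgt0Pr => e e0; rewrite add0r.
have [N /(_ N (leqnn _))] := hcvg_rip hu hv e0.
by rewrite ha distrC => /ltW.
Qed.

Lemma hcvg_ip_eq (u v : nat -> H) l m a : hcvg u l -> hcvg v m ->
  (forall n, ip (u n) (v n) = a) -> ip l m = a.
Proof.
move=> hu hv ha; apply/eqP; rewrite eq_complex; apply/andP; split; apply/eqP.
  by apply: (@hcvg_rip_eq u v) => // n; rewrite /rip ha.
have := @hcvg_rip_eq u _ l _ (complex.Im a) hu (hcvgZ 'i hv).
have Im_i (z : R[i]) : complex.Re (Num.conj 'i * z) = complex.Im z.
  by case: z => x y /=; rewrite mul0r mulN1r opprK add0r.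
rewrite /rip ipZr => h.
by rewrite -Im_i h // => n; rewrite ipZr ha.
Qed.

Lemma small_sq (x e : R) : 0 <= x -> 0 < e -> x ^+ 2 < e ^+ 2 -> x < e.
Proof. by move=> x0 e0; rewrite ltr_pXn2r // nnegrE // ltW. Qed.

(** The projection theorem in the finite power of H indexed by T, for the closure
   of K: f - w is the projection of f and w the residual.  Real subspaces are
   allowed, since strong-star closures lead to conjugate-linear components.
   Finite powers are what turns a statement on the strong operator topology,
   which tests finitely many vectors at once, into one on orthogonality. *)
Lemma tuple_projection (T : finType) (K : set (T -> H)) (f : T -> H) :
  K (fun=> 0) ->
  (forall (a : R) g h, K g -> K h -> K (fun i => a%:C *: g i + h i)) ->
  exists (w : T -> H) (k : nat -> T -> H),
    [/\ forall n, K (k n), forall i, hcvg (k^~ i) (f i - w i) &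
        forall g, K g -> \sum_i rip (g i) (w i) = 0].
Proof.
move=> K0 KL.
pose Q (g : T -> H) : R := \sum_i hnorm (f i - g i) ^+ 2.
have Q0 g : 0 <= Q g by apply: sumr_ge0 => i _; exact: sqr_ge0.
pose S := [set Q g | g in K].
have Slb : lbound S 0 by move=> _ [g _ <-].
have Si : has_inf S by split; [exists (Q (fun=> 0)); exists (fun=> 0) | exists 0].
pose d := inf S.
have dle g : K g -> d <= Q g by move=> Kg; apply: ge_inf => //; [exact: Si.2|exists g].
have hk n : exists g, K g /\ Q g < d + n.+1%:R^-1.
  have [_ [g Kg <-] h] := @inf_adherent _ S (n.+1%:R^-1) (ltac:(by rewrite invr_gt0)) Si.
  by exists g.
have [k hk'] := choice hk.
(* Parallelogram law: a minimising sequence is Cauchy. *)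
have para g h : K g -> K h ->
    \sum_i hnorm (g i - h i) ^+ 2 <= 2 * (Q g - d) + 2 * (Q h - d).
  move=> Kg Kh.
  pose m i := (2^-1 : R)%:C *: g i + ((2^-1 : R)%:C *: h i + 0).
  have Km : K m by apply: (KL) => //; apply: (KL).
  have := dle _ Km; rewrite /Q.
  have -> : \sum_i hnorm (g i - h i) ^+ 2 =
     2 * (\sum_i hnorm (f i - g i) ^+ 2) + 2 * (\sum_i hnorm (f i - h i) ^+ 2)
       - 4 * (\sum_i hnorm (f i - m i) ^+ 2).
    rewrite !mulr_sumr -big_split -sumrB /=; apply: eq_bigr => i _.
    rewrite !hnorm_sq /m addr0 !ripE.
    rewrite (ripC (g i) (f i)) (ripC (h i) (f i)) (ripC (h i) (g i)).
    by field.
  lra.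
have cau i : hcauchy (k^~ i).
  move=> e e0.
  have e4 : 0 < e ^+ 2 / 4 by rewrite divr_gt0 ?exprn_gt0.
  have [N hN] := invS_small e4.
  exists N => m n /hN h1 /hN h2; apply: small_sq => //.
  have := para _ _ (hk' m).1 (hk' n).1.
  have := (hk' m).2; have := (hk' n).2; move: h1 h2.
  move: (m.+1%:R^-1) (n.+1%:R^-1) => x1 x2.
  rewrite (bigD1 i) //= => ? ? ? ?.
  have : 0 <= \sum_(j | j != i) hnorm (k m j - k n j) ^+ 2.
    by apply: sumr_ge0 => j _; exact: sqr_ge0.
  lra.
have [p hp] := choice (fun i => hcauchy_cvg (cau i)).
exists (fun i => f i - p i), k; split=> [n|i|g Kg]; first exact: (hk' n).1.
  by rewrite opprB addrC subrK; exact: hp.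
pose s n := \sum_i rip (g i) (f i - k n i).
pose G := \sum_i hnorm (g i) ^+ 2.
have G0 : 0 <= G by apply: sumr_ge0 => i _; exact: sqr_ge0.
set s0 := \sum_i _.
(* Moving the near-minimiser k n by t times g cannot reduce Q below d. *)
have key n t : 0 <= n.+1%:R^-1 - 2 * t * s n + t ^+ 2 * G.
  have Kt : K (fun i => t%:C *: g i + k n i) by apply: (KL) => //; exact: (hk' n).1.
  have := dle _ Kt; have := (hk' n).2; move: (n.+1%:R^-1) => x1.
  have -> : Q (fun i => t%:C *: g i + k n i) = Q (k n) - 2 * t * s n + t ^+ 2 * G.
    rewrite /Q /s /G !mulr_sumr -sumrB -big_split /=; apply: eq_bigr => i _.
    rewrite !hnorm_sq !ripE.
    rewrite (ripC (f i) (g i)) (ripC (k n i) (g i)) (ripC (k n i) (f i)). ring.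
  lra.
have scv : forall e : R, 0 < e -> exists N, forall n, (N <= n)%N -> `|s n - s0| < e.
  have cvT : forall r : seq T, forall e : R, 0 < e ->
     exists N, forall n, (N <= n)%N ->
      `|\sum_(i <- r) rip (g i) (f i - k n i) - \sum_(i <- r) rip (g i) (f i - p i)| < e.
    elim=> [|i r IH] e e0.
      by exists 0%N => n _; rewrite !big_nil subrr normr0.
    have e2 : 0 < e / 2 by lra.
    have [N1 h1] := IH _ e2.
    have [N2 h2] := hcvg_rip (hcvg_cst (g i)) (hcvgB (hcvg_cst (f i)) (hp i)) e2.
    exists (maxn N1 N2) => n; rewrite geq_max => /andP[/h1 a /h2 b].
    rewrite !big_cons opprD addrACA; apply: le_lt_trans (ler_normD _ _) _; lra.
  exact: cvT.
have key0 t : 0 <= t ^+ 2 * G - 2 * t * s0.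
  apply/ler_addgt0Pr => e e0.
  have e1 : 0 < e / 2 by lra.
  have e2 : 0 < e / (2 * (2 * `|t| + 1)).
    by rewrite divr_gt0 // mulr_gt0 // ltr_wpDl // mulr_ge0.
  have [N1 h1] := invS_small e1; have [N2 h2] := scv _ e2.
  have a := h1 _ (leq_maxl N1 N2); have b := h2 _ (leq_maxr N1 N2).
  have := key (maxn N1 N2) t; move: a; move: (_.+1%:R^-1) => x1 a.
  have : `|2 * t * (s (maxn N1 N2) - s0)| <= e / 2.
    rewrite !normrM (ger0_norm (ler0n _ 2)).
    move: b; rewrite ltr_pdivlMr; last by have := normr_ge0 t; lra.
    have := normr_ge0 t; have := normr_ge0 (s (maxn N1 N2) - s0); nra.
  rewrite ler_norml => /andP[? ?]; lra.
(* Near the minimiser of the quadratic in t; G + 1 in place of G avoids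
   a division by zero. *)
have := key0 (s0 / (G + 1)).
have G1 : 0 < G + 1 by lra.
have -> : (s0 / (G + 1)) ^+ 2 * G - 2 * (s0 / (G + 1)) * s0
   = - (s0 ^+ 2 * (G + 2) / (G + 1) ^+ 2) by field; lra.
rewrite oppr_ge0 => h; apply/eqP; rewrite -sqrf_eq0 eq_le sqr_ge0 andbT.
move: h; rewrite pmulr_lle0 ?invr_gt0 ?exprn_gt0 // pmulr_lle0 //; lra.
Qed.
End InnerProduct.

(** * Bounded operators, uniform boundedness, strong closures *)

Section Operators.
Variables (R : realType) (H : completeNormedModType R[i]).
Variable ip : {dot H for (@Num.conj R[i])}.

(** Continuity at 0 bounds x on a small ball, and scaling does the rest. *)
Lemma bopP (x : H -> H) : bounded_op x -> exists2 K : R, 0 <= K &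
  forall u, hnorm (x u) <= K * hnorm u.
Proof.
move=> [lx cx].
have x0 : x 0 = 0.
  have := lx (-1) 0 0; rewrite scaleN1r oppr0 addr0 scaleN1r addrC => ->.
  by rewrite subrr.
have xZ k u : x (k *: u) = k *: x u by have := lx k u 0; rewrite !addr0 x0 addr0.
have /cvgrPdist_lt/(_ 1 ltr01) := cx 0.
rewrite x0 => /nbhs_ballP[e /= e0 he].
have /andP[/eqP ei er] : (complex.Im e == 0) && (0 < complex.Re e).
  by move: e0; rewrite ltcE /= eq_sym.
pose r := complex.Re e.
have hr v : hnorm v < r -> hnorm (x v) < 1.
  move=> hv; have := he v; rewrite -ball_normE /= !sub0r !normrN !normE => h.
  rewrite -ltcR; apply: h; rewrite ltcE /= ei eqxx /=; exact: hv.
exists (2 / r) => [|u]; first by rewrite divr_ge0 // ltW.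
have [u0|u0] := eqVneq (hnorm u) 0.
  by rewrite (hnorm_eq0 u0) x0 hnorm0 mulr0.
have up : 0 < hnorm u by rewrite lt_def u0 hnorm_ge0.
have c0 : 0 < r / (2 * hnorm u) by rewrite divr_gt0 // mulr_gt0.
have := hr ((r / (2 * hnorm u))%:C *: u).
rewrite xZ !hnormZ gtr0_norm //.
have -> : r / (2 * hnorm u) * hnorm u = r / 2 by field.
have rr : r / 2 < r by rewrite /r in er *; lra.
move=> /(_ rr) h; rewrite -(ler_pM2l c0).
have -> : r / (2 * hnorm u) * (2 / r * hnorm u) = 1.
  by field; rewrite ?u0 ?gt_eqF.
exact: ltW.
Qed.

(** Boundedness gives continuity; the converse is bopP. *)
Lemma bop_intro (x : H -> H) (K : R) : linear x ->
  (forall u, hnorm (x u) <= K * hnorm u) -> bounded_op x.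
Proof.
move=> lx hK; split=> // u; apply/cvgrPdist_lt => e e0.
have /andP[/eqP ei er] : (complex.Im e == 0) && (0 < complex.Re e).
  by move: e0; rewrite ltcE /= eq_sym.
have K1 : 0 < `|K| + 1 by have := normr_ge0 K; lra.
apply/nbhs_ballP; exists (complex.Re e / (`|K| + 1))%:C => /=.
  by rewrite ltcR divr_gt0.
move=> v; rewrite -ball_normE /= !normE ltcR ltr_pdivlMr // => h.
rewrite ltcE /= ei eqxx /=.
have -> : x u - x v = x (u - v).
  have -> : u - v = -1 *: v + u by rewrite scaleN1r addrC.
  by rewrite lx scaleN1r addrC.
apply: le_lt_trans (hK _) _; apply: le_lt_trans h.
rewrite mulrC; apply: ler_wpM2l => //; have := ler_norm K; lra.
Qed.

Section Linear.
Variables (x : H -> H).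
Hypothesis bx : bounded_op x.

Lemma bopL k u v : x (k *: u + v) = k *: x u + x v.
Proof. exact: bx.1. Qed.

Lemma bopD u v : x (u + v) = x u + x v.
Proof. by have := bopL 1 u v; rewrite !scale1r. Qed.

Lemma bop0 : x 0 = 0.
Proof. by apply: (addrI (x 0)); rewrite -bopD !addr0. Qed.

Lemma bopZ k u : x (k *: u) = k *: x u.
Proof. by rewrite -[k *: u]addr0 bopL bop0 addr0. Qed.

Lemma bopN u : x (- u) = - x u.
Proof. by rewrite -scaleN1r bopZ scaleN1r. Qed.

Lemma bopB u v : x (u - v) = x u - x v.
Proof. by rewrite bopD bopN. Qed.

Lemma bop_cvg (u : nat -> H) l : hcvg u l -> hcvg (fun n => x (u n)) (x l).
Proof.
have [K K0 hK] := bopP bx.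
by apply: (hcvg_lip (K := K)) => n; rewrite -bopB.
Qed.
End Linear.

Lemma bop_id : bounded_op (idfun : H -> H).
Proof. by apply: (@bop_intro _ 1) => // u; rewrite mul1r. Qed.

Lemma bop_zero : bounded_op (fun=> 0 : H).
Proof.
apply: (@bop_intro _ 0) => [k u v|u]; first by rewrite scaler0 addr0.
by rewrite hnorm0 mul0r.
Qed.

Lemma bop_comp (x y : H -> H) :
  bounded_op x -> bounded_op y -> bounded_op (x \o y).
Proof.
move=> bx bY; have [K K0 hK] := bopP bx; have [L L0 hL] := bopP bY.
apply: (@bop_intro _ (K * L)) => [k u v|u] /=; first by rewrite !bopL.
by apply: le_trans (hK _) _; rewrite -mulrA; apply: ler_wpM2l.
Qed.

Lemma fct_linE k (x y : H -> H) u : (k *: x + y) u = k *: x u + y u.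
Proof. by []. Qed.

Lemma fct_addE (x y : H -> H) u : (x + y) u = x u + y u.
Proof. by []. Qed.

Lemma fct_subE (x y : H -> H) u : (x - y) u = x u - y u.
Proof. by []. Qed.

Lemma fct_scaleE k (x : H -> H) u : (k *: x) u = k *: x u.
Proof. by []. Qed.

Lemma bop_lin k (x y : H -> H) :
  bounded_op x -> bounded_op y -> bounded_op (k *: x + y).
Proof.
move=> bx bY; have [K K0 hK] := bopP bx; have [L L0 hL] := bopP bY.
apply: (@bop_intro _ (complex.Re `|k| * K + L)) => [a u v|u].
  by rewrite !fct_linE (bopL bx) (bopL bY) !scalerDr !scalerA (mulrC k a) addrACA.
apply: le_trans (hnormD _ _) _; rewrite mulrDl; apply: lerD => //.
rewrite hnormZC -mulrA; apply: ler_wpM2l => //.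
exact: (Re_mono (normr_ge0 k)).
Qed.

Lemma bop_scale k (x : H -> H) : bounded_op x -> bounded_op (k *: x).
Proof. by move=> bx; have := bop_lin k bx bop_zero; rewrite addr0. Qed.

Lemma bop_sub (x y : H -> H) :
  bounded_op x -> bounded_op y -> bounded_op (x - y).
Proof.
by move=> bx bY; have := bop_lin (-1) bY bx; rewrite scaleN1r addrC.
Qed.

(** The uniform bound carries the continuity of the operators to the limit. *)
Lemma bop_lim (xs : nat -> H -> H) (x : H -> H) (K : R) :
  (forall n, bounded_op (xs n)) -> (forall n u, hnorm (xs n u) <= K * hnorm u) ->
  (forall u, hcvg (xs^~ u) (x u)) ->
  bounded_op x /\ forall u, hnorm (x u) <= K * hnorm u.
Proof.
move=> bxs hK hx.
have hb u : hnorm (x u) <= K * hnorm u by apply: (hcvg_le (hx u)).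
split=> //; apply: (@bop_intro _ K) => // k u v.
apply: (hcvg_unique (hx _)).
apply: (hcvg_eq (u := fun n => k *: xs n u + xs n v)) => [n|].
  by rewrite bopL.
by apply: hcvgD => //; apply: hcvgZ.
Qed.

Lemma opnorm_has_sup (x : H -> H) : bounded_op x ->
  has_sup [set hnorm (x u) | u in [set u | hnorm u <= 1]].
Proof.
move=> bx; have [K K0 hK] := bopP bx; split.
  by exists (hnorm (x 0)), 0; rewrite /= ?hnorm0.
exists K => _ [u /= u1 <-]; apply: le_trans (hK _) _.
by rewrite ler_piMr.
Qed.

Lemma opnorm_ge0 (x : H -> H) : bounded_op x -> 0 <= opnorm x.
Proof.
move=> bx; apply: ub_le_sup; first exact: (opnorm_has_sup bx).2.
by exists 0; rewrite /= ?hnorm0 // (bop0 bx) hnorm0.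
Qed.

Lemma opnormP (x : H -> H) u : bounded_op x -> hnorm (x u) <= opnorm x * hnorm u.
Proof.
move=> bx; have [u0|u0] := eqVneq (hnorm u) 0.
  by rewrite (hnorm_eq0 u0) (bop0 bx) hnorm0 mulr0.
have up : 0 < hnorm u by rewrite lt_def u0 hnorm_ge0.
rewrite -ler_pdivrMr //.
have -> : hnorm (x u) / hnorm u = hnorm (x (((hnorm u)^-1)%:C *: u)).
  by rewrite (bopZ bx) hnormZ gtr0_norm ?invr_gt0 // mulrC.
apply: ub_le_sup; first exact: (opnorm_has_sup bx).2.
exists (((hnorm u)^-1)%:C *: u) => //=.
by rewrite hnormZ gtr0_norm ?invr_gt0 // mulVf.
Qed.

Lemma opnorm_le (x : H -> H) (K : R) : bounded_op x -> 0 <= K ->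
  (forall u, hnorm (x u) <= K * hnorm u) -> opnorm x <= K.
Proof.
move=> bx K0 hK; apply: ge_sup; first exact: (opnorm_has_sup bx).1.
move=> _ [u /= u1 <-]; apply: le_trans (hK _) _.
by rewrite ler_piMr.
Qed.

(** A gliding hump argument due to Sokal: if the norms were unbounded, a series of
   vectors of length 3^-n, each with a sign that does not decrease the image,
   would converge to a vector at which the family is unbounded. *)
Theorem uniform_boundedness (I : Type) (F : I -> H -> H) :
  (forall i, bounded_op (F i)) ->
  (forall u, exists M : R, forall i, hnorm (F i u) <= M) ->
  exists2 K : R, 0 <= K & forall i u, hnorm (F i u) <= K * hnorm u.
Proof.
move=> bF pF; apply: contrapT => noK.
have big n : exists i, (4 ^+ n : R) < opnorm (F i).
  apply: contrapT => h; apply: noK; exists (4 ^+ n : R); first by rewrite exprn_ge0.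
  move=> i u; apply: le_trans (opnormP _ (bF i)) _; apply: ler_wpM2r => //.
  by rewrite leNgt; apply/negP => hi; apply: h; exists i.
have [j hj] := choice big.
pose T n := F (j n); have bT n : bounded_op (T n) by exact: bF.
pose N n := opnorm (T n).
have N0 n : 0 < N n by apply: lt_trans (hj n); rewrite exprn_gt0.
(* Vectors of length 3^-n at which T n attains two thirds of its norm. *)
have near n : exists v, hnorm v = 3^-1 ^+ n /\ (2 / 3) * N n * 3^-1 ^+ n <= hnorm (T n v).
  have [u [u1 hu]] : exists u, hnorm u <> 0 /\ (2 / 3) * N n * hnorm u < hnorm (T n u).
    apply: contrapT => h.
    have : N n <= (2 / 3) * N n.
      apply: opnorm_le => [||u]; [exact: bF | by have := N0 n; lra |].
      rewrite leNgt; apply/negP => hu; apply: h; exists u; split => // u0.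
      by move: hu; rewrite (hnorm_eq0 u0) (bop0 (bT _)) hnorm0 mulr0 ltxx.
    by have := N0 n; lra.
  have up : 0 < hnorm u by rewrite lt_def hnorm_ge0 andbT; apply/eqP.
  have p3 : 0 < (3^-1 : R) ^+ n by rewrite exprn_gt0 // invr_gt0.
  exists ((3^-1 ^+ n / hnorm u)%:C *: u).
  rewrite (bopZ (bT _)) !hnormZ gtr0_norm ?divr_gt0 //; split.
    by rewrite divfK // gt_eqF.
  rewrite -[leRHS]mulrA (mulrC (2 / 3 * N n)) ler_pM2l // [leRHS]mulrC.
  by rewrite ler_pdivlMr //; exact: ltW.
have [v hv] := choice near.
(* The images of y + v n and y - v n differ by twice that of v n, so that one
   of them is at least as long as the image of v n. *)
pose step n (y : H) := if hnorm (T n (v n)) <= hnorm (T n (y + v n)) then y + v n else y - v n.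
pose x := fix x n := if n is m.+1 then step m (x m) else 0.
have xS n : x n.+1 = step n (x n) by [].
have big_x n : hnorm (T n (v n)) <= hnorm (T n (x n.+1)).
  rewrite xS /step; case: ifPn => // h.
  rewrite (bopB (bT _)) (bopD (bT _)) in h *.
  have := hnorm_triB (T n (x n) + T n (v n)) 0 (T n (x n) - T n (v n)).
  have -> : T n (x n) + T n (v n) - (T n (x n) - T n (v n)) = (2:R)%:C *: T n (v n).
    rewrite opprB addrCA (addrC (T n (x n))) addrK -[X in X + X]scale1r -scalerDl.
    by congr (_ *: _); apply/eqP; rewrite eq_complex /= addr0 !eqxx.
  rewrite hnormZ subr0 sub0r hnormN ger0_norm //; move: h; rewrite -ltNge.
  lra.
have dist1 n : hnorm (x n.+1 - x n) = 3^-1 ^+ n.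
  rewrite xS /step; case: ifP => _; rewrite addrC addKr ?hnormN; exact: (hv n).1.
have dist n k : hnorm (x (n + k)%N - x n) <= 3 / 2 * 3^-1 ^+ n * (1 - 3^-1 ^+ k).
  elim: k => [|k IH]; first by rewrite addn0 subrr hnorm0 expr0 subrr mulr0.
  rewrite addnS; apply: le_trans (hnorm_triB _ (x (n + k)%N) _) _.
  rewrite dist1 exprD exprS; apply: le_trans (lerD (lexx _) IH) _.
  by rewrite le_eqVlt; apply/orP; left; apply/eqP; field.
have dist' n k : hnorm (x (n + k)%N - x n) <= 3 / 2 * 3^-1 ^+ n.
  apply: le_trans (dist n k) _; apply: ler_piMr.
    by apply: mulr_ge0; [lra | rewrite exprn_ge0 // invr_ge0].
  by rewrite gerBl exprn_ge0 // invr_ge0.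
have small (e : R) : 0 < e -> exists n, 3 / 2 * 3^-1 ^+ n < e.
  move=> e0; exists (Num.truncn (2 / e)).
  set n := Num.truncn _.
  have h1 : 2 / e < n.+1%:R by exact: truncnS_gt.
  have h2 : n.+1%:R <= (3 : R) ^+ n.
    elim: (n) => [|m IH]; first by rewrite expr0.
    rewrite exprS -[m.+2]addn1 natrD; have : 1 <= (3 : R) ^+ m by rewrite exprn_ege1 // ler1n.
    lra.
  have p3 : 0 < (3 : R) ^+ n by rewrite exprn_gt0.
  have h3 : 2 < e * 3 ^+ n.
    by rewrite -ltr_pdivrMl // mulrC; exact: lt_le_trans h1 h2.
  rewrite exprVn ltr_pdivrMr //; lra.
have cau : hcauchy x.
  move=> e e0; have [n hn] := small _ (divr_gt0 e0 (ltr0n _ 2)).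
  exists n => a b na nb; apply: le_lt_trans (hnorm_triB _ (x n) _) _.
  have := dist' n (a - n)%N; have := dist' n (b - n)%N.
  rewrite !subnKC // (hnormB (x b)); lra.
have [l hl] := hcauchy_cvg cau.
have [M hM] := pF l.
(* The tail after step n has length at most 3^-n / 2, which costs half of
   3^-n times the norm of T n, against two thirds gained; 2 / 3 - 1 / 2 = 1 / 6. *)
have key n : (4 / 3) ^+ n / 6 <= M.
  have c : hnorm (x n.+1 - l) <= 2^-1 * 3^-1 ^+ n.
    apply/ler_addgt0Pr => e /hl[m hm].
    have := hm (n.+1 + m)%N (leq_addl _ _); have := dist' n.+1 m.
    have := hnorm_triB (x n.+1) (x (n.+1 + m)%N) l.
    rewrite exprS (hnormB (x n.+1) (x (n.+1 + m)%N)); lra.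
  have d : hnorm (T n (x n.+1 - l)) <= N n * (2^-1 * 3^-1 ^+ n).
    apply: le_trans (opnormP _ (bT _)) _.
    by apply: ler_wpM2l; [exact: ltW (N0 n) | exact: c].
  rewrite (bopB (bT _)) in d.
  have e1 := hnorm_le_diff (T n (x n.+1)) (T n l).
  have := big_x n; have := (hv n).2; have := hM (j n); rewrite -/(T n).
  have p3 : 0 < (3^-1 : R) ^+ n by rewrite exprn_gt0 // invr_gt0.
  have : 4 ^+ n * 3^-1 ^+ n <= N n * 3^-1 ^+ n.
    by rewrite ler_pM2r //; apply: ltW; exact: hj.
  rewrite -exprMn; move: d e1.
  have -> : N n * (2^-1 * 3^-1 ^+ n) = 2^-1 * (N n * 3^-1 ^+ n) by ring.
  have -> : 2 / 3 * N n * 3^-1 ^+ n = 2 / 3 * (N n * 3^-1 ^+ n) by ring.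
  move: (N n * _) ((4 / 3) ^+ n) => NN z; lra.
have bern n : 1 + n%:R / 3 <= (4 / 3 : R) ^+ n.
  elim: n => [|n IH]; first by rewrite expr0 mul0r addr0.
  rewrite exprS -addn1 natrD; have : 0 <= n%:R :> R by [].
  move: (n%:R) IH => z; nra.
have := key (Num.truncn (18 * M)).+1; have := bern (Num.truncn (18 * M)).+1.
have := truncnS_gt (18 * M); move: (Num.truncn _).+1 => m.
move: (m%:R) ((4 / 3) ^+ m) => a b; lra.
Qed.

Lemma closureHP (X : set H) u :
  closure X u <-> forall e : R, 0 < e -> exists2 v, X v & hnorm (u - v) < e.
Proof.
split=> [h e e0|h B /nbhs_ballP[e /= e0 he]].
  have [|v [Xv]] := h (ball u e%:C).
    by apply/nbhs_ballP; exists e%:C => //=; rewrite ltcR.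
  by rewrite -ball_normE /= normE ltcR => hv; exists v.
have /andP[/eqP ei er] : (complex.Im e == 0) && (0 < complex.Re e).
  by move: e0; rewrite ltcE /= eq_sym.
have [v Xv hv] := h _ er; exists v; split => //; apply: he.
by rewrite -ball_normE /= normE ltcE /= ei eqxx /=.
Qed.

(** H is metric, so sequences suffice for closures. *)
Lemma closure_seq (X : set H) u : closure X u ->
  exists2 v : nat -> H, forall n, X (v n) & hcvg v u.
Proof.
move=> /closureHP h.
have h' n : exists v, X v /\ hnorm (u - v) < n.+1%:R^-1.
  have [|v Xv hv] := h n.+1%:R^-1; first by rewrite invr_gt0.
  by exists v.
have [v hv] := choice h'; exists v => [n|e e0]; first exact: (hv n).1.
have [N hN] := invS_small e0; exists N => n /hN; rewrite hnormB.
by apply: lt_trans; exact: (hv n).2.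
Qed.

Lemma seq_closure (X : set H) u (v : nat -> H) :
  (forall n, X (v n)) -> hcvg v u -> closure X u.
Proof.
move=> Xv hv; apply/closureHP => e /hv[N /(_ N (leqnn _))]; rewrite hnormB.
by exists (v N).
Qed.

Lemma sub_closureH (X : set H) u : X u -> closure X u.
Proof. exact: subset_closure. Qed.

Lemma closureH_closed (X : set H) u (v : nat -> H) :
  (forall n, closure X (v n)) -> hcvg v u -> closure X u.
Proof.
move=> Xv hv; apply/closureHP => e e0.
have [N /(_ N (leqnn _)) hN] := hv _ (divr_gt0 e0 (ltr0n _ 2)).
have /closureHP/(_ _ (divr_gt0 e0 (ltr0n _ 2)))[w Xw hw] := Xv N.
exists w => //; apply: le_lt_trans (hnorm_triB _ (v N) _) _.
rewrite hnormB; lra.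
Qed.

(** A neighbourhood for pointwise convergence constrains finitely many vectors;
   this form is the one used throughout. *)
Lemma strong_closureP (X : set (H -> H)) (x : H -> H) :
  strong_closure X x <-> bounded_op x /\
   forall (us : seq H) (e : R), 0 < e ->
     exists2 y, X y & forall u, u \in us -> hnorm (y u - x u) < e.
Proof.
split=> -[bx hx]; split=> //.
  move=> us e e0.
  have Fx : Filter (nbhs (x : {ptws H -> H})) by exact: nbhs_filter.
  have hu (ws : seq H) : nbhs (x : {ptws H -> H})
      [set y | forall u, u \in ws -> hnorm (y u - x u) < e].
    elim: ws => [|a ws IH].
      by apply: (@filterS _ _ Fx setT) => [y _ u|]; [rewrite in_nil | exact: filterT].
    have h1 : nbhs (x : {ptws H -> H}) [set y : H -> H | hnorm (y a - x a) < e].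
      have e0' : (0 : R[i]) < e%:C by rewrite ltcR.
      have h := @proj_continuous _ (fun _ : H => H) a x _ (nbhsx_ballx (x a) e%:C e0').
      apply: (@filterS _ _ Fx _ _ _ h) => y /=.
      by rewrite -ball_normE /= normE ltcR hnormB.
    apply: (@filterS _ _ Fx _ _ _ (@filterI _ _ Fx _ _ h1 IH)) => y [ya yus] u.
    by rewrite inE => /orP[/eqP->|]; [exact: ya | exact: yus].
  by have [y [Xy hy]] := hx _ (hu us); exists y.
pose F : set_system (H -> H) := filter_from [set p : seq H * R | 0 < p.2]
  (fun p => [set y | X y /\ forall u, u \in p.1 -> hnorm (y u - x u) < p.2]).
have FF : ProperFilter F.
  apply: filter_from_proper; last first.
    by move=> [us e] /= e0; have [y Xy hy] := hx us e e0; exists y.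
  apply: filter_from_filter; first by exists ([::], 1) => /=.
  move=> [us e] [vs d] /= e0 d0; exists (us ++ vs, Num.min e d) => /=.
    by rewrite lt_min e0.
  move=> y [Xy hy]; split; split=> // u hu.
    by have := hy u; rewrite mem_cat hu lt_min => /(_ isT)/andP[].
  by have := hy u; rewrite mem_cat hu orbT lt_min => /(_ isT)/andP[].
have Fx : {ptws, F --> x}.
  apply/pointwise_cvgP => u; apply/cvgrPdist_lt => e e0.
  have /andP[/eqP ei er] : (complex.Im e == 0) && (0 < complex.Re e).
    by move: e0; rewrite ltcE /= eq_sym.
  exists ([:: u], complex.Re e) => //= y [_ /(_ u)]; rewrite inE eqxx => /(_ isT) h.
  by rewrite /= normE hnormB ltcE /= ei eqxx.
move=> B /Fx[[us e] /= e0 h].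
have [y Xy hy] := hx us e e0; exists y; split=> //; exact: h.
Qed.
End Operators.

(** * Orthogonal projections, functionals and adjoints *)

Section Orthogonality.
Variables (R : realType) (H : completeNormedModType R[i]).
Variable ip : {dot H for (@Num.conj R[i])}.
Hypothesis Hip : forall u : H, `|u| ^+ 2 = ip u u.

Definition subspace (K : set H) :=
  K 0 /\ forall k u v, K u -> K v -> K (k *: u + v).

Lemma subspaceB (K : set H) u v : subspace K -> K u -> K v -> K (u - v).
Proof. by move=> [_ hK] Ku Kv; rewrite addrC -scaleN1r; apply: hK. Qed.

Lemma subspaceZ (K : set H) k u : subspace K -> K u -> K (k *: u).
Proof. by move=> [K0 hK] Ku; rewrite -[_ *: _]addr0; apply: hK. Qed.

Lemma closure_subspace (K : set H) : subspace K -> subspace (closure K).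
Proof.
move=> [K0 hK]; split; first exact: sub_closureH.
move=> k u v /closure_seq[us Ku hu] /closure_seq[vs Kv hv].
apply: (@seq_closure _ _ _ _ (fun n => k *: us n + vs n)) => [n|]; first exact: hK.
by apply: hcvgD => //; apply: hcvgZ.
Qed.

(** The case of a single component in tuple_projection; multiplication by 'i in
   the complex subspace K recovers the complex orthogonality. *)
Lemma projection (K : set H) u : subspace K ->
  exists p, closure K p /\ forall v, closure K v -> ip v (u - p) = 0.
Proof.
move=> sK; have [K0 hK] := sK.
pose K' (f : unit -> H) := K (f tt).
have [||w [k [Kk hk hw]]] := @tuple_projection _ _ ip Hip unit K' (fun=> u).
- exact: K0.
- by move=> a g h Kg Kh; apply: hK.
exists (u - w tt); split.
  by apply: (seq_closure (v := k^~ tt)); [exact: Kk | exact: hk].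
move=> v /closure_seq[vs Kv hv]; rewrite opprB addrC subrK.
have rip0 v' : K v' -> rip ip v' (w tt) = 0.
  by move=> Kv'; have := hw (fun=> v') Kv'; rewrite (bigD1 tt) //= big1 ?addr0 // => -[].
apply: (@hcvg_ip_eq _ _ _ Hip vs (fun=> w tt)) => //; first exact: hcvg_cst.
move=> n; rewrite ipC; apply/eqP; rewrite conjC_eq0; apply/eqP.
apply: ip_eq0; first by rewrite ripC rip0.
by rewrite ripC rip0 //; apply: subspaceZ.
Qed.

Section OrthProj.
Variable K : set H.
Hypotheses (sK : subspace K) (cK : closure K `<=` K).
Let p := orth_proj ip K.

Lemma orth_projP u : K (p u) /\ forall v, K v -> ip v (u - p u) = 0.
Proof.
have ex w : exists q, K q /\ forall v, K v -> ip v (w - q) = 0.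
  have [q [Kq hq]] := projection w sK.
  by exists q; split; [exact: cK | move=> v Kv; apply: hq; exact: sub_closureH].
have [q hq] := choice ex.
have := @xgetPex _ 0 [set p0 : H -> H | forall u, K (p0 u) /\
  forall v, K v -> ip v (u - p0 u) = 0].
by move=> /(_ (ex_intro _ q hq)) /(_ u).
Qed.

Lemma orth_proj_in u : K (p u).
Proof. exact: (orth_projP u).1. Qed.

(** The difference of two candidates lies in K and is orthogonal to K. *)
Lemma orth_proj_unique u q : K q -> (forall v, K v -> ip v (u - q) = 0) -> p u = q.
Proof.
move=> Kq hq; apply/eqP; rewrite -subr_eq0; apply/eqP; apply: (rip_eq0 Hip (ip:=ip)).
have Kpq : K (p u - q) by apply: subspaceB => //; exact: orth_proj_in.
have -> : p u - q = (u - q) - (u - p u) by rewrite opprB [RHS]addrC addrA subrK.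
rewrite /rip {1}(_ : u - q - (u - p u) = p u - q); last first.
  by rewrite opprB [LHS]addrC addrA subrK.
by rewrite ipBr hq // (orth_projP u).2 // subrr.
Qed.

Lemma orth_proj_id u : K u -> p u = u.
Proof. by move=> Ku; apply: orth_proj_unique => // v _; rewrite subrr ip0r. Qed.

Lemma orth_proj_ipr v u : K v -> ip v (p u) = ip v u.
Proof.
move=> Kv; apply/eqP; rewrite eq_sym -subr_eq0 -ipBr.
by rewrite (orth_projP u).2.
Qed.

Lemma orth_proj_ipl v u : K v -> ip (p u) v = ip u v.
Proof. by move=> Kv; rewrite ipC orth_proj_ipr // -ipC. Qed.

Lemma orth_proj_sym u v : ip (p u) v = ip u (p v).
Proof.
by rewrite -(orth_proj_ipr _ (orth_proj_in u)) (orth_proj_ipl _ (orth_proj_in v)).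
Qed.

Lemma orth_proj_le u : hnorm (p u) <= hnorm u.
Proof.
have h : hnorm (p u) ^+ 2 <= hnorm (p u) * hnorm u.
  rewrite (hnorm_sq Hip) /rip orth_proj_ipr; last exact: orth_proj_in.
  exact: rip_le.
have [h0|h0] := eqVneq (hnorm (p u)) 0; first by rewrite h0.
by move: h; rewrite expr2 ler_pM2l // lt_def h0 hnorm_ge0.
Qed.

Lemma orth_proj_bop : bounded_op p.
Proof.
apply: (@bop_intro _ _ _ 1) => [k u v|u]; last by rewrite mul1r orth_proj_le.
apply: orth_proj_unique.
  by apply: sK.2; exact: orth_proj_in.
move=> w Kw; rewrite opprD addrACA -scalerBr ipDr ipZr.
by rewrite !(orth_projP _).2 // mulr0 addr0.
Qed.
End OrthProj.

(** The residual of the projection onto the closure is orthogonal to K. *)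
Lemma dense_of_orth (K : set H) : subspace K ->
  (forall u, (forall v, K v -> ip v u = 0) -> u = 0) -> forall u, closure K u.
Proof.
move=> sK h u; have [p [Kp hp]] := projection u sK.
have /eqP : u - p = 0 by apply: h => v Kv; apply: hp; exact: sub_closureH.
by rewrite subr_eq0 => /eqP->.
Qed.

(** The representing vector is a multiple of the residual of any vector outside
   the kernel of phi. *)
Lemma riesz (phi : H -> R[i]) (K : R) :
  (forall k u v, phi (k *: u + v) = k * phi u + phi v) ->
  (forall u, complex.Re `|phi u| <= K * hnorm u) ->
  exists w, forall u, phi u = ip u w.
Proof.
move=> lp bp.
have p0 : phi 0 = 0.
  by have := lp (-1) 0 0; rewrite scaleN1r oppr0 addr0 mulN1r addrC subrr.
have pZ k u : phi (k *: u) = k * phi u by have := lp k u 0; rewrite !addr0 p0 addr0.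
have pB u v : phi (u - v) = phi u - phi v.
  by rewrite addrC -scaleN1r lp mulN1r addrC.
pose N := [set u | phi u = 0].
have sN : subspace N.
  by split=> // k u v; rewrite /N /= lp => -> ->; rewrite mulr0 addr0.
have [[u0 hu0]|all0] := pselect (exists u, phi u <> 0); last first.
  exists 0 => u; rewrite ip0r; apply: contrapT => h; apply: all0; by exists u.
have [p [Np hp]] := projection u0 sN.
have php : phi p = 0.
  have [us Nu hu] := closure_seq Np.
  have normc (z : R[i]) : complex.Re `|z| = 0 -> z = 0.
    move=> hz; apply/eqP; rewrite -normr_eq0; apply/eqP.
    have : 0 <= `|z| by [].
    by case: `|z| hz => a b /= ->; rewrite lecE /= => /andP[/eqP-> _].
  apply: normc; apply/eqP; rewrite eq_le (Re_mono (normr_ge0 _)) andbT.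
  have K1 : 0 < `|K| + 1 by have := normr_ge0 K; lra.
  apply/ler_addgt0Pr => e e0; rewrite add0r.
  have [n /(_ n (leqnn _)) hn] := hu _ (divr_gt0 e0 K1).
  have -> : phi p = phi (p - us n) by rewrite pB (Nu n) subr0.
  apply: le_trans (bp _) _; rewrite ltr_pdivlMr // hnormB in hn.
  apply: le_trans (ltW hn); rewrite mulrC ler_wpM2l //.
  by have := ler_norm K; lra.
pose w := u0 - p.
have phw : phi w <> 0 by rewrite pB php subr0.
have ww : ip w w != 0.
  apply/eqP => h; apply: phw; suff -> : w = 0 by [].
  by apply: (rip_eq0 Hip (ip := ip)); rewrite /rip h.
exists (Num.conj (phi w / ip w w) *: w) => u.
rewrite ipZr conjCK.
have /eqP : ip (u - (phi u / phi w) *: w) w = 0.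
  apply: hp; apply: sub_closureH; rewrite /N /= pB pZ divfK ?subrr //; exact/eqP.
rewrite ipBl ipZl subr_eq0 => /eqP ->.
have phw' : phi w != 0 by apply/eqP.
by field; rewrite phw' ww.
Qed.

Lemma Re_norm_ip u v : complex.Re `|ip u v| <= hnorm u * hnorm v.
Proof.
have [->|nz] := eqVneq (ip u v) 0; first by rewrite normr0 mulr_ge0.
pose k := Num.conj (ip u v) / `|ip u v|.
have n0 : `|ip u v| != 0 by rewrite normr_eq0.
have nk : `|k| = 1 by rewrite normrM norm_conjC normfV normr_id mulfV.
have -> : complex.Re `|ip u v| = rip ip (k *: u) v.
  rewrite /rip ipZl /k mulrAC [Num.conj _ * _]mulrC -normCK expr2 mulfK //.
apply: le_trans (rip_le Hip _ _) _.
by rewrite hnormZC nk mul1r.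
Qed.

(** Apply the representation of functionals to u |-> ip (x u) v, for each v. *)
Lemma adj_ex (x : H -> H) : bounded_op x ->
  exists y, bounded_op y /\ forall u v, ip (x u) v = ip u (y v).
Proof.
move=> bx; have [K K0 hK] := bopP bx.
have [v|y hy] := choice (fun v => _ : exists w, forall u, ip (x u) v = ip u w).
  apply: (riesz (K := K * hnorm v)) => [k u w|u].
    by rewrite (bopL bx) ipDl ipZl.
  apply: le_trans (Re_norm_ip _ _) _.
  by rewrite mulrAC; apply: ler_wpM2r.
exists y; split=> //; apply: (@bop_intro _ _ _ K) => [k u v|u].
  apply: (ip_nondeg Hip) => w; rewrite -hy ipDr ipZr !hy ipDr ipZr //.
have h : hnorm (y u) ^+ 2 <= hnorm (y u) * (K * hnorm u).
  rewrite (hnorm_sq Hip) {1}/rip -hy; apply: le_trans (rip_le Hip _ _) _.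
  by rewrite mulrCA mulrA; apply: ler_wpM2r.
have [h0|h0] := eqVneq (hnorm (y u)) 0; first by rewrite h0 mulr_ge0.
by move: h; rewrite expr2 ler_pM2l // lt_def h0 hnorm_ge0.
Qed.

Section Adj.
Variable x : H -> H.
Hypothesis bx : bounded_op x.

Lemma adj_spec : bounded_op (adj ip x) /\ forall u v, ip (x u) v = ip u (adj ip x v).
Proof. exact: (xgetPex 0 (adj_ex bx)). Qed.

Lemma adj_bop : bounded_op (adj ip x).
Proof. exact: adj_spec.1. Qed.

Lemma adjP u v : ip (x u) v = ip u (adj ip x v).
Proof. exact: adj_spec.2. Qed.

Lemma adjPl u v : ip u (x v) = ip (adj ip x u) v.
Proof. by rewrite ipC adjP -ipC. Qed.

Lemma adj_unique y : (forall u v, ip (x u) v = ip u (y v)) -> adj ip x = y.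
Proof. by move=> hy; apply/funext => v; apply: (ip_nondeg Hip) => u; rewrite -adjP hy. Qed.

Lemma adj_le K : (forall u, hnorm (x u) <= K * hnorm u) ->
  forall u, hnorm (adj ip x u) <= K * hnorm u.
Proof.
move=> hK u; set y := adj ip x.
have h : hnorm (y u) ^+ 2 <= hnorm (y u) * (K * hnorm u).
  rewrite (hnorm_sq Hip) {1}/rip -adjP; apply: le_trans (rip_le Hip _ _) _.
  by rewrite mulrCA mulrA; apply: ler_wpM2r.
have [h0|h0] := eqVneq (hnorm (y u)) 0.
  by rewrite h0; have := hK u; have := hnorm_ge0 (x u); lra.
by move: h; rewrite expr2 ler_pM2l // lt_def h0 hnorm_ge0.
Qed.
End Adj.

Lemma adj_comp x y : bounded_op x -> bounded_op y ->
  adj ip (x \o y) = adj ip y \o adj ip x.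
Proof.
move=> bx bY; apply: adj_unique => [|u v /=]; first exact: bop_comp.
by rewrite !adjP.
Qed.

Lemma adj_fix x : bounded_op x -> (forall u v, ip (x u) v = ip u (x v)) ->
  adj ip x = x.
Proof. by move=> bx; apply: adj_unique. Qed.

(** Polarisation: the form s, which measures the lack of symmetry, vanishes on
   the diagonal, hence is alternating, and it is sesquilinear, so that inserting
   'i changes the sign of only one of the two terms. *)
Lemma positive_sym x : positive_op ip x -> forall u v, ip (x u) v = ip u (x v).
Proof.
move=> [bx px].
pose s u v := ip (x u) v - ip u (x v).
have suu u : s u u = 0.
  rewrite /s (ipC ip u); have /ger0_real/CrealP-> := px u.
  by rewrite subrr.
have sD u v : s u v + s v u = 0.
  have := suu (u + v); rewrite /s (bopD bx) !ipDl !ipDr.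
  have := suu u; have := suu v; rewrite /s => h1 h2 h.
  rewrite -[RHS]h -[LHS]addr0 -[X in _ + X]addr0 -{1}h1 -h2; ring.
move=> u v; apply/eqP; rewrite -subr_eq0 -/(s u v).
have h := sD u ('i *: v).
have : s u ('i *: v) + s ('i *: v) u = - 'i * (s u v - s v u).
  rewrite /s (bopZ bx) !ipZl !ipZr (conjCi _); ring.
rewrite h => /esym/eqP; rewrite mulf_eq0 oppr_eq0.
rewrite (_ : ('i == 0 :> R[i]) = false) /=; last by rewrite eq_complex /= oner_eq0 andbF.
move=> /eqP h2.
have : s u v *+ 2 = 0.
  by rewrite mulr2n -[RHS](sD u v) -[s v u]add0r -h2; ring.
by move/eqP; rewrite mulrn_eq0.
Qed.
End Orthogonality.

(** * An iteration for square roots *)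

Section SquareRoot.
Variables (R : realType) (H : completeNormedModType R[i]).
Variable ip : {dot H for (@Num.conj R[i])}.

Lemma monotone_cauchy (s : nat -> R) (S : R) :
  (forall n, s n <= s n.+1) -> (forall n, s n <= S) ->
  forall e : R, 0 < e -> exists N, forall m n, (N <= n)%N -> (n <= m)%N ->
    s m - s n < e.
Proof.
move=> incr bd e e0.
have mono n m : (n <= m)%N -> s n <= s m.
  by elim: m => [|m IH]; [rewrite leqn0 => /eqP->|rewrite leq_eqVlt =>
     /predU1P[->//|/IH h]; exact: le_trans h (incr m)].
have hs : has_sup (range s).
  by split; [exists (s 0%N), 0%N | exists S => _ [n _ <-]].
have [_ [N _ <-] hN] := sup_adherent e0 hs.
exists N => m n Nn nm.
have := mono _ _ Nn; have : s m <= sup (range s) by apply: sup_upper_bound => //; exists m.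
lra.
Qed.

(** Operators whose increments are majorised by those of a bounded increasing
   scalar sequence converge pointwise; this serves the square root iteration
   and a Neumann series. *)
Lemma dominated_limit (T : nat -> H -> H) (s : nat -> R) (S : R) :
  (forall n, bounded_op (T n)) -> (forall n, s n <= s n.+1) ->
  (forall n, s n <= S) -> (forall u, hnorm (T 0%N u) <= s 0%N * hnorm u) ->
  (forall n u, hnorm (T n.+1 u - T n u) <= (s n.+1 - s n) * hnorm u) ->
  exists t, [/\ bounded_op t, forall u, hnorm (t u) <= S * hnorm u,
     forall n u, hnorm (T n u) <= S * hnorm u & forall u, hcvg (T^~ u) (t u)].
Proof.
move=> bT incr bd T0 dT.
have bT' n u : hnorm (T n u) <= s n * hnorm u.
  elim: n => [//|n IH].
  by have := hnorm_le_diff (T n.+1 u) (T n u); have := dT n u; lra.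
have bTS n u : hnorm (T n u) <= S * hnorm u.
  by apply: le_trans (bT' n u) _; apply: ler_wpM2r.
have dist n m u : (n <= m)%N -> hnorm (T m u - T n u) <= (s m - s n) * hnorm u.
  elim: m => [|m IH]; first by rewrite leqn0 => /eqP->; rewrite !subrr hnorm0 mul0r.
  rewrite leq_eqVlt => /predU1P[->|]; first by rewrite !subrr hnorm0 mul0r.
  move=> /IH h; have := hnorm_triB (T m.+1 u) (T m u) (T n u); have := dT m u; lra.
have cau u : hcauchy (T^~ u).
  move=> e e0; have u1 : 0 < hnorm u + 1 by have := hnorm_ge0 u; lra.
  have [N hN] := monotone_cauchy incr bd (divr_gt0 e0 u1).
  have wl m n : (N <= n)%N -> (n <= m)%N -> hnorm (T m u - T n u) < e.
    move=> Nn nm; apply: le_lt_trans (dist _ _ u nm) _.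
    have := hN m n Nn nm; rewrite ltr_pdivlMr //.
    have : 0 <= s m - s n.
      have h := dist _ _ u nm; rewrite subr_ge0.
      elim: m nm {h} => [|m IH]; first by rewrite leqn0 => /eqP->.
      by rewrite leq_eqVlt => /predU1P[->//|/IH h]; exact: le_trans h (incr m).
    have := hnorm_ge0 u; nra.
  exists N => m n Nm Nn; have [nm|/ltnW nm] := leqP n m; first exact: wl.
  by rewrite hnormB; exact: wl.
have [t ht] := choice (fun u => hcauchy_cvg (cau u)).
have [bt lt] := bop_lim bT bTS ht.
by exists t.
Qed.

(** Closedness under bounded pointwise limits: the closure property that all
   algebras and modules here have, and that an iteration can exploit. *)
Definition seq_closed (P : set (H -> H)) :=
  forall ws w (C : R), (forall n, P (ws n)) -> (forall n, bounded_op (ws n)) ->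
    (forall n u, hnorm (ws n u) <= C * hnorm u) ->
    (forall u, hcvg (ws^~ u) (w u)) -> P w.

Definition half : R[i] := (2^-1 : R)%:C.

Lemma halfE : half + half = 1.
Proof. by apply/eqP; rewrite eq_complex /= addr0; apply/andP; split; apply/eqP; lra. Qed.

Lemma half2 (u : H) : half *: u + half *: u = u.
Proof. by rewrite -scalerDl halfE scale1r. Qed.

Lemma hnorm_half (u : H) : hnorm (half *: u) = 2^-1 * hnorm u.
Proof. by rewrite hnormZ ger0_norm // invr_ge0. Qed.

(** The iteration of w |-> (1 + b w^2) / 2 from 0 leads to (1 + sqrt (1 - b))^-1. *)
Definition sqrt_step (b w : H -> H) : H -> H :=
  fun u => half *: (u + b (w (w u))).

(** The iteration for a contraction b is majorised by the scalar iteration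
   s |-> (1 + s^2) / 2, which increases to 1.  The last clause says that k
   inherits every property that is stable under the steps and under bounded
   limits; it replaces a functional calculus. *)
Lemma sqrt_iter (b : H -> H) : bounded_op b -> (forall u, hnorm (b u) <= hnorm u) ->
  exists k, [/\ bounded_op k, forall u, hnorm (k u) <= hnorm u,
    forall u, k u = half *: (u + b (k (k u))) &
    forall P, P (fun=> 0) -> (forall w, bounded_op w -> P w -> P (sqrt_step b w)) ->
      seq_closed P -> P k].
Proof.
move=> bb cb.
pose K := fix K n : H -> H := if n is m.+1 then sqrt_step b (K m) else fun=> 0.
(* The scalar majorant. *)
pose s := fix s n : R := if n is m.+1 then 2^-1 * (1 + s m ^+ 2) else 0.
have s01 n : 0 <= s n <= 1.
  elim: n => [|n /andP[a c]] /=; first by rewrite lexx ler01.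
  by apply/andP; split; nra.
have sinc n : s n <= s n.+1.
  by rewrite /=; have := sqr_ge0 (s n - 1); nra.
have bK n : bounded_op (K n).
  elim: n => [|n IH] /=; first exact: bop_zero.
  have -> : sqrt_step b (K n) = half *: ((1 : R[i]) *: idfun + (b \o (K n \o K n))).
    by apply/funext => u; rewrite !fctE /= scale1r.
  apply: bop_scale; apply: bop_lin; first exact: bop_id.
  by do 2 apply: bop_comp => //.
have nK n u : hnorm (K n u) <= s n * hnorm u.
  elim: n u => [|n IH] u /=; first by rewrite hnorm0 mul0r.
  rewrite hnorm_half -mulrA ler_pM2l // mulrDl mul1r.
  apply: le_trans (hnormD _ _) _; rewrite lerD2l; apply: le_trans (cb _) _.
  apply: le_trans (IH _) _; rewrite expr2 -mulrA; apply: ler_wpM2l => //.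
  by have /andP[] := s01 n.
have [|||k [bk lk lK hk]] := @dominated_limit K s 1 bK sinc.
- by move=> n; have /andP[] := s01 n.
- by move=> u; rewrite hnorm0 mul0r.
- elim=> [|n IH] u.
    rewrite /= /sqrt_step (bop0 bb) addr0 subr0 hnorm_half expr0n /=; lra.
  have -> : K n.+2 u - K n.+1 u = half *: b (K n.+1 (K n.+1 u) - K n (K n u)).
    rewrite (bopB bb) -[LHS]/(half *: _ - half *: _) -scalerBr; congr (_ *: _).
    by rewrite opprD addrACA subrr add0r.
  rewrite hnorm_half.
  have e1 := cb (K n.+1 (K n.+1 u) - K n (K n u)).
  have e2 := hnorm_triB (K n.+1 (K n.+1 u)) (K n.+1 (K n u)) (K n (K n u)).
  have e3 := IH (K n u).
  have e4 := nK n.+1 (K n.+1 u - K n u); rewrite (bopB (bK _)) in e4.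
  have e5 := IH u; have e6 := nK n u.
  have /andP[p1 p2] := s01 n; have /andP[p3 p4] := s01 n.+1.
  have p5 := sinc n.
  have e7 : hnorm (K n.+1 (K n.+1 u) - K n.+1 (K n u)) <= s n.+1 * ((s n.+1 - s n) * hnorm u).
    by apply: le_trans e4 _; apply: ler_wpM2l.
  have e8 : hnorm (K n.+1 (K n u) - K n (K n u)) <= (s n.+1 - s n) * (s n * hnorm u).
    by apply: le_trans e3 _; apply: ler_wpM2l => //; rewrite subr_ge0.
  have -> : s n.+2 - s n.+1 = 2^-1 * (s n.+1 ^+ 2 - s n ^+ 2).
    by rewrite -[s n.+2]/(2^-1 * (1 + s n.+1 ^+ 2)) -[in X in _ - X]/(s n.+1) /=; ring.
  move: e1 e2 e7 e8; move: (s n.+1) (hnorm (_ - K n.+1 (K n u))) => z1 z2.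
  move: (hnorm (K n.+1 (K n u) - _)) => z3; nra.
exists k; split=> //.
- by move=> u; have := lk u; rewrite mul1r.
- move=> u; apply: (hcvg_unique (u := fun n => K n.+1 u)).
    by move=> e /(hk u)[N hN]; exists N => n Nn; apply: hN; exact: leqW.
  apply: hcvgZ; apply: hcvgD; first exact: hcvg_cst.
  apply: (bop_cvg bb) => e e0; have e2 : 0 < e / 2 by lra.
  have [N1 h1] := hk u _ e2; have [N2 h2] := hk (k u) _ e2.
  exists (maxn N1 N2) => n; rewrite geq_max => /andP[/h1 a1 /h2 a2].
  have := lK n (K n u - k u); rewrite (bopB (bK n)) mul1r.
  have := hnorm_triB (K n (K n u)) (K n (k u)) (k (k u)); lra.
- move=> P P0 Pstep Pcl; apply: (Pcl K k 1) => //.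
  by elim=> [//|n IH] /=; exact: Pstep.
Qed.

Hypothesis Hip : forall u : H, `|u| ^+ 2 = ip u u.

Lemma hcvg_rip_le2 (u v u' v' : nat -> H) l m l' m' :
  hcvg u l -> hcvg v m -> hcvg u' l' -> hcvg v' m' ->
  (forall n, rip ip (u n) (v n) <= rip ip (u' n) (v' n)) ->
  rip ip l m <= rip ip l' m'.
Proof.
move=> hu hv hu' hv' h; apply/ler_addgt0Pr => e e0.
have e2 : 0 < e / 2 by lra.
have [N1 h1] := hcvg_rip Hip hu hv e2; have [N2 h2] := hcvg_rip Hip hu' hv' e2.
have := h1 _ (leq_maxl N1 N2); have := h2 _ (leq_maxr N1 N2).
have := h (maxn N1 N2); rewrite !ltr_norml => ? /andP[? ?] /andP[? ?]; lra.
Qed.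

Lemma hcvg_ip_eq2 (u v u' v' : nat -> H) l m l' m' :
  hcvg u l -> hcvg v m -> hcvg u' l' -> hcvg v' m' ->
  (forall n, ip (u n) (v n) = ip (u' n) (v' n)) -> ip l m = ip l' m'.
Proof.
move=> hu hv hu' hv' h.
apply: ip_eq; apply/eqP; rewrite eq_le; apply/andP; split.
- by apply: (hcvg_rip_le2 hu hv hu' hv') => n; rewrite /rip h.
- by apply: (hcvg_rip_le2 hu' hv' hu hv) => n; rewrite /rip h.
- apply: (hcvg_rip_le2 hu (hcvgZ _ hv) hu' (hcvgZ _ hv')) => n.
  by rewrite /rip !ipZr h.
- apply: (hcvg_rip_le2 hu' (hcvgZ _ hv') hu (hcvgZ _ hv)) => n.
  by rewrite /rip !ipZr h.
Qed.

Definition sym_op (x : H -> H) := forall u v, ip (x u) v = ip u (x v).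

Lemma sym_rip x u v : sym_op x -> rip ip (x u) v = rip ip u (x v).
Proof. by move=> h; rewrite /rip h. Qed.

Lemma sym_pos x u : sym_op x -> 0 <= rip ip (x u) u -> 0 <= ip (x u) u.
Proof.
move=> sx; rewrite /rip; have := ipC ip (x u) u; rewrite -sx.
case: (ip (x u) u) => a c /eqP; rewrite eq_complex /= lecE /= => /andP[_ /eqP h] ->.
by rewrite andbT; apply/eqP; lra.
Qed.

(** Nonnegativity at u - x u together with the upper bounds at u and x u. *)
Lemma pos_contraction x : bounded_op x -> sym_op x ->
  (forall u, 0 <= rip ip (x u) u <= hnorm u ^+ 2) ->
  forall u, hnorm (x u) <= hnorm u.
Proof.
move=> bx sx h u; have /andP[_ h1] := h u; have /andP[_ h2] := h (x u).
have /andP[+ _] := h (u - x u).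
rewrite (bopB bx) !ripE (sym_rip (x u) u sx) -!(hnorm_sq Hip).
move=> h3; rewrite -(@ler_pXn2r _ 2) ?nnegrE //; move: h1 h2 h3.
lra.
Qed.

Section SqrtFacts.
Variables (b k : H -> H).
Hypotheses (bb : bounded_op b) (bk : bounded_op k).
Hypothesis ke : forall u, k u = half *: (u + b (k (k u))).

Lemma sqrt_iter2 u : b (k (k u)) = k u + k u - u.
Proof.
have -> : k u + k u = u + b (k (k u)) by rewrite {1 2}ke half2.
by rewrite addrAC subrr add0r.
Qed.

(** 1 - b k is a square root of 1 - b. *)
Lemma sqrt_iter_sq u : (forall v, k (b v) = b (k v)) ->
  let y v := v - b (k v) in y (y u) = u - b u.
Proof.
move=> kb /=; rewrite (bopB bk) (bopB bb) kb sqrt_iter2 (bopB bb) (bopD bb) opprB.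
set t := b (k u).
by rewrite -!addrA addKr [t + _]addrCA subrr addr0.
Qed.
End SqrtFacts.

(** Symmetry and commutation pass through the iteration. *)
Lemma sqrt_iter_props (b k : H -> H) : bounded_op b -> sym_op b ->
  (forall P, P (fun=> 0) -> (forall w, bounded_op w -> P w -> P (sqrt_step b w)) ->
      seq_closed P -> P k) ->
  sym_op k /\ forall y, bounded_op y -> (forall u, y (b u) = b (y u)) ->
    forall u, k (y u) = y (k u).
Proof.
move=> bb sb hP.
have comm : forall y, bounded_op y -> (forall u, y (b u) = b (y u)) ->
    forall u, k (y u) = y (k u).
  move=> y bY yb; apply: (hP (fun w => forall u, w (y u) = y (w u))).
  - by move=> u; rewrite (bop0 bY).
  - by move=> w bw wy u; rewrite /sqrt_step (bopZ bY) (bopD bY) yb !wy.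
  - move=> ws w C hws bws hC hc u; apply: (hcvg_unique (hc (y u))).
    apply: (hcvg_eq (u := fun n => y (ws n u))) => [n|]; first by rewrite hws.
    exact: (bop_cvg bY).
split=> //.
suff [] : sym_op k /\ (forall u, k (b u) = b (k u)) by [].
apply: (hP (fun w => sym_op w /\ (forall u, w (b u) = b (w u)))).
- by split=> [u v|u]; rewrite ?ip0l ?ip0r // (bop0 bb).
- move=> w bw [sw wb]; split=> [u v|u]; rewrite /sqrt_step.
    rewrite ipZl ipZr ipDl ipDr sb !sw !wb; congr (_ * _).
    by apply/eqP; rewrite eq_complex /= oppr0 !eqxx.
  by rewrite (bopZ bb) (bopD bb) !wb.
- move=> ws w C hws bws hC hc; split=> [u v|u].
    apply: (hcvg_ip_eq2 (hc u) (hcvg_cst v) (hcvg_cst u) (hc v)) => n.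
    exact: (hws n).1.
  apply: (hcvg_unique (hc (b u))).
  apply: (hcvg_eq (u := fun n => b (ws n u))) => [n|]; first by rewrite (hws n).2.
  exact: (bop_cvg bb).
Qed.
End SquareRoot.

(** * The absolute value and the double commutant theorem *)

Section VonNeumann.
Variables (R : realType) (H : completeNormedModType R[i]).
Variable ip : {dot H for (@Num.conj R[i])}.
Hypothesis Hip : forall u : H, `|u| ^+ 2 = ip u u.

(** Scale x to c with 0 <= c <= 1 and apply the iteration to b = 1 - c. *)
Lemma sqrt_op_ex x : positive_op ip x ->
  exists y, positive_op ip y /\ y \o y = x.
Proof.
move=> px; have bx := px.1; have sx := positive_sym px.
have [K0 K0p hK0] := bopP bx.
pose K := K0 + 1; have Kp : 0 < K by rewrite /K; lra.
have hK u : hnorm (x u) <= K * hnorm u.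
  by apply: le_trans (hK0 u) _; apply: ler_wpM2r => //; rewrite /K; lra.
have Ki : K%:C != 0 by rewrite eq_complex /= gt_eqF.
pose c : H -> H := K^-1%:C *: x.
have bc : bounded_op c by apply: bop_scale.
have sc : sym_op ip c.
  by move=> u v; rewrite /c !fct_scaleE ipZl ipZr sx; congr (_ * _);
     apply/eqP; rewrite eq_complex /= oppr0 !eqxx.
have c01 u : 0 <= rip ip (c u) u <= hnorm u ^+ 2.
  rewrite /c fct_scaleE ripZl; apply/andP; split.
    by apply: mulr_ge0; [rewrite invr_ge0 ltW | have := Re_mono (px.2 u)].
  rewrite -ler_pdivlMl ?invr_gt0 // invrK expr2 mulrA.
  apply: le_trans (rip_le Hip _ _) _; exact: ler_wpM2r.
pose b : H -> H := idfun - c.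
have bb : bounded_op b by apply: bop_sub => //; exact: bop_id.
have bE u : b u = u - c u by [].
have sb : sym_op ip b by move=> u v; rewrite !bE ipBl ipBr sc.
have cb : forall u, hnorm (b u) <= hnorm u.
  apply: (pos_contraction Hip bb sb) => u.
  by rewrite bE ripBl -(hnorm_sq Hip); have /andP[] := c01 u; lra.
have [k [bk nk ke hP]] := sqrt_iter bb cb.
have [sk kc] := sqrt_iter_props Hip bb sb hP.
have kb v : k (b v) = b (k v) by apply: kc.
have sq := sqrt_iter_sq bb bk ke _ kb.
pose y : H -> H := (Num.sqrt K)%:C *: (idfun - (b \o k)).
have yE u : y u = (Num.sqrt K)%:C *: (u - b (k u)) by [].
have bY : bounded_op y.
  apply: bop_scale; apply: bop_sub; first exact: bop_id.
  exact: bop_comp.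
exists y; split; last first.
  apply/funext => u /=; rewrite [y u]yE (bopZ bY) yE scalerA (sq u) bE.
  rewrite -rmorphM -expr2 sqr_sqrtr; last exact: ltW.
  by rewrite opprB addrC subrK /c fct_scaleE scalerA -rmorphM mulfV ?scale1r // gt_eqF.
split=> // u; apply: sym_pos.
  move=> v w; rewrite !yE ipZl ipZr ipBl ipBr sb sk kb.
  by congr (_ * _); apply/eqP; rewrite eq_complex /= oppr0 !eqxx.
rewrite yE ripZl; apply: mulr_ge0; first exact: sqrtr_ge0.
rewrite ripBl -(hnorm_sq Hip) subr_ge0; apply: le_trans (rip_le Hip _ _) _.
by rewrite expr2; apply: ler_wpM2r => //; apply: le_trans (cb _) (nk _).
Qed.

Lemma abs0_spec x : bounded_op x ->
  positive_op ip (abs0 ip x) /\ abs0 ip x \o abs0 ip x = adj ip x \o x.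
Proof.
move=> bx; apply: (xgetPex 0 (sqrt_op_ex _)).
split=> [|u]; first by apply: bop_comp => //; exact: adj_bop.
by rewrite /inner0 /= -(adjPl Hip bx) -Hip exprn_ge0.
Qed.

Lemma hnorm_abs0 x u : bounded_op x -> hnorm (abs0 ip x u) = hnorm (x u).
Proof.
move=> bx; have [pa ha] := abs0_spec bx.
apply/eqP; rewrite -(@eqrXn2 _ 2) //; apply/eqP.
rewrite !(hnorm_sq Hip) /rip (positive_sym pa).
have -> : abs0 ip x (abs0 ip x u) = adj ip x (x u) by have := congr1 (@^~ u) ha.
by rewrite -(adjP Hip bx).
Qed.

(** The square of the absolute value is x^* x, so that taking the absolute value
   does not change the length of images. *)
Lemma dsnE x xi : bounded_op x -> dsn ip xi x = hnorm (x xi).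
Proof. exact: hnorm_abs0. Qed.

Lemma norm0E x : bounded_op x -> norm0 ip x = opnorm x.
Proof.
move=> bx; rewrite /norm0 /opnorm; congr sup; apply/seteqP; split=> r /= [u u1 <-].
  by exists u => //; rewrite hnorm_abs0.
by exists u => //; rewrite hnorm_abs0.
Qed.

Lemma uniform_N (n : nat) (Q : 'I_n -> nat -> Prop) :
  (forall i, exists N, forall m, (N <= m)%N -> Q i m) ->
  exists N, forall i m, (N <= m)%N -> Q i m.
Proof.
move=> /choice[N hN]; exists (\max_i N i) => i m hm; apply: hN.
by apply: leq_trans hm; exact: leq_bigmax.
Qed.

Lemma sum_rip_lim (T : finType) (k l : nat -> T -> H) (d w : T -> H) :
  (forall i, hcvg (k^~ i) (d i)) -> (forall i, hcvg (l^~ i) (w i)) ->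
  (forall n, \sum_i rip ip (k n i) (l n i) = 0) -> \sum_i rip ip (d i) (w i) = 0.
Proof.
move=> hk hl hw.
have hs (r : seq T) : forall e : R, 0 < e -> exists N, forall m, (N <= m)%N ->
    `|\sum_(i <- r) rip ip (k m i) (l m i) - \sum_(i <- r) rip ip (d i) (w i)| < e.
  elim: r => [|i r IH] e e0.
    by exists 0%N => m _; rewrite !big_nil subrr normr0.
  have e2 : 0 < e / 2 by lra.
  have [N1 h1] := IH _ e2; have [N2 h2] := hcvg_rip Hip (hk i) (hl i) e2.
  exists (maxn N1 N2) => m; rewrite geq_max => /andP[/h1 a1 /h2 a2].
  rewrite !big_cons opprD addrACA; apply: le_lt_trans (ler_normD _ _) _; lra.
apply/eqP; rewrite -normr_le0; apply/ler_addgt0Pr => e e0; rewrite add0r.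
have [N /(_ N (leqnn _))] := hs (index_enum T) e e0.
by rewrite hw sub0r normrN => /ltW.
Qed.

Section Algebra.
Variable M : set (H -> H).
Hypothesis vM : vn_algebra ip M.

Lemma vn_zero : M 0.
Proof.
have := vn_linear vM (-1) (vn_one vM) (vn_one vM).
by rewrite scaleN1r addNr.
Qed.

Lemma vnZ k x : M x -> M (k *: x).
Proof. by move=> Mx; have := vn_linear vM k Mx vn_zero; rewrite addr0. Qed.

Lemma vnD x y : M x -> M y -> M (x + y).
Proof. by move=> Mx My; have := vn_linear vM 1 Mx My; rewrite scale1r. Qed.

Lemma vnB x y : M x -> M y -> M (x - y).
Proof. by move=> Mx My; have := vn_linear vM (-1) My Mx; rewrite scaleN1r addrC. Qed.

(** A sequence converging pointwise approximates on any finite set of vectors. *)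
Lemma vn_seq_closed : seq_closed M.
Proof.
move=> ws w C Mw bw hC hc; apply: (vn_closed vM); apply/strong_closureP; split.
  exact: (bop_lim bw hC hc).1.
move=> us e e0.
have [N hN] := @uniform_N (size us)
  (fun i m => hnorm (ws m (nth 0 us i) - w (nth 0 us i)) < e) (fun i => hc _ _ e0).
exists (ws N) => // u /(nthP 0)[i hi <-]; exact: (hN (Ordinal hi)).
Qed.

Definition commutant : set (H -> H) :=
  [set x | bounded_op x /\ forall a, M a -> forall u, x (a u) = a (x u)].

Lemma commutant_lin k x y : commutant x -> commutant y -> commutant (k *: x + y).
Proof.
move=> [bx hx] [bY hy]; split; first exact: bop_lin.
by move=> a Ma u; rewrite !fct_linE hx // hy // (bopL (vn_bounded vM Ma)).
Qed.

Lemma commutant_adj x : commutant x -> commutant (adj ip x).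
Proof.
move=> [bx hx]; split; first exact: adj_bop.
move=> a Ma u; apply: (ip_nondeg Hip) => v; have ba := vn_bounded vM Ma.
rewrite -(adjP Hip bx) (adjPl Hip ba) (adjPl Hip ba) -(adjP Hip bx).
by rewrite -hx //; exact: (vn_adj vM).
Qed.

(** Needed because the projections in finite powers are built for the real form,
   while commutation with the algebra requires complex linearity. *)
Lemma conj_ip k u v : rip ip u (k *: v) = rip ip (Num.conj k *: u) v.
Proof. by rewrite /rip ipZr ipZl. Qed.

(** Project the finite power of H onto the closure of the tuples (a u_i) with a
   in M.  The entries of the projection commute with M, hence x commutes with
   them and preserves this closure; since the tuple u belongs to it, so does
   the tuple x u, and this is strong approximation of x on the vectors u_i. *)
Lemma double_commutant x : bounded_op x ->
  (forall y, commutant y -> forall u, x (y u) = y (x u)) -> M x.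
Proof.
move=> bx xc; apply: (vn_closed vM); apply/strong_closureP; split=> // us e e0.
pose n := size us; pose u (i : 'I_n) := nth 0 us i.
pose K (f : 'I_n -> H) := exists2 a, M a & forall i, f i = a (u i).
have K0 : K (fun=> 0) by exists 0 => //; exact: vn_zero.
have KL (k : R[i]) g h : K g -> K h -> K (fun i => k *: g i + h i).
  move=> [a Ma ga] [c Mc hc]; exists (k *: a + c); first exact: (vn_linear vM).
  by move=> i; rewrite ga hc.
(* rel f g: the tuple g is the projection of f onto the closure of K. *)
pose rel (f g : 'I_n -> H) := (exists k : nat -> 'I_n -> H, (forall m, K (k m)) /\
   forall i, hcvg (k^~ i) (g i)) /\ forall h, K h -> \sum_i rip ip (h i) (f i - g i) = 0.
have ex f : exists g, rel f g.
  have [w [k [Kk hk hw]]] := tuple_projection Hip f K0 (fun a => @KL a%:C).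
  exists (fun i => f i - w i); split; first by exists k.
  by move=> h Kh; rewrite -[RHS](hw h Kh); apply: eq_bigr => i _; rewrite opprB addrC subrK.
have [Pr hPr] := choice ex.
have lim0 (d w : 'I_n -> H) (k : nat -> 'I_n -> H) : (forall m, K (k m)) ->
    (forall i, hcvg (k^~ i) (d i)) ->
    (forall h, K h -> \sum_i rip ip (h i) (w i) = 0) -> \sum_i rip ip (d i) (w i) = 0.
  move=> Kk hk hw; apply: (sum_rip_lim hk (fun i => hcvg_cst (w i))) => m.
  exact: (hw _ (Kk m)).
have uniq f g g' : rel f g -> rel f g' -> forall i, g i = g' i.
  move=> [[k [Kk hk]] hg] [[k' [Kk' hk']] hg'].
  pose d i := g i - g' i.
  have dd : \sum_i rip ip (d i) (d i) = 0.
    apply: (lim0 d d (fun m i => k m i - k' m i)).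
    - move=> m; have := KL (-1) _ _ (Kk' m) (Kk m).
      by congr K; apply/funext => i; rewrite scaleN1r addrC.
    - by move=> i; apply: hcvgB.
    - move=> h Kh; have := hg h Kh; have := hg' h Kh => e1 e2.
      transitivity (\sum_i rip ip (h i) (f i - g' i) - \sum_i rip ip (h i) (f i - g i));
        last by rewrite e1 e2 subr0.
      rewrite -sumrB; apply: eq_bigr => i _.
      rewrite -ripBr; congr (rip ip _ _); rewrite /d opprB.
      by rewrite [RHS]addrC addrA subrK.
  move=> i; apply/eqP; rewrite -subr_eq0; apply/eqP/(rip_eq0 Hip (ip := ip)).
  move/eqP: dd; rewrite psumr_eq0 => [/allP/(_ i)|j _].
    by rewrite mem_index_enum => /(_ isT)/eqP.
  by rewrite -(hnorm_sq Hip) sqr_ge0.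
have relL k f f' g g' : rel f g -> rel f' g' ->
    rel (fun i => k *: f i + f' i) (fun i => k *: g i + g' i).
  move=> [[l [Kl hl]] hg] [[l' [Kl' hl']] hg']; split.
    exists (fun m i => k *: l m i + l' m i); split=> [m|i]; first exact: KL.
    by apply: hcvgD => //; apply: hcvgZ.
  move=> h Kh.
  have Kh' : K (fun i => Num.conj k *: h i).
    have := KL (Num.conj k) _ _ Kh K0; congr K; apply/funext => i; by rewrite addr0.
  have e1 := hg _ Kh'; have e2 := hg' _ Kh.
  transitivity (\sum_i rip ip (Num.conj k *: h i) (f i - g i) +
    \sum_i rip ip (h i) (f' i - g' i)); last by rewrite e1 e2 addr0.
  rewrite -big_split; apply: eq_bigr => i _.
  by rewrite /= -conj_ip -ripDr opprD addrACA -scalerBr.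
have relA a f g : M a -> rel f g -> rel (fun i => a (f i)) (fun i => a (g i)).
  move=> Ma [[l [Kl hl]] hg]; have ba := vn_bounded vM Ma; split.
    exists (fun m i => a (l m i)); split=> [m|i]; last exact: (bop_cvg ba).
    by have [c Mc hc] := Kl m; exists (a \o c) => [|i]; [exact: (vn_mul vM)|rewrite hc].
  move=> h [c Mc hc].
  have Kh' : K (fun i => adj ip a (h i)).
    exists (adj ip a \o c) => [|i]; first by apply: (vn_mul vM) => //; exact: (vn_adj vM).
    by rewrite hc.
  rewrite -[RHS](hg _ Kh'); apply: eq_bigr => i _.
  by rewrite -(bopB ba) /rip (adjPl Hip ba).
(* The tuple with v at j; P i j are the matrix entries of the projection. *)
pose dl j (v : H) : 'I_n -> H := fun l => if l == j then v else 0.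
pose P i j v := Pr (dl j v) i.
have Pcom i j : commutant (P i j).
  split; last first.
    move=> a Ma v; have ba := vn_bounded vM Ma.
    apply: (uniq (dl j (a v)) _ (fun i => a (Pr (dl j v) i))) => //.
    have := relA _ _ _ Ma (hPr (dl j v)); congr rel; apply/funext => l.
    by rewrite /dl; case: eqP => // _; rewrite (bop0 ba).
  apply: (@bop_intro _ _ _ 1) => [k v w|v].
    apply: (uniq (dl j (k *: v + w)) _ (fun i => k *: Pr (dl j v) i + Pr (dl j w) i)) => //.
    have := relL k _ _ _ _ (hPr (dl j v)) (hPr (dl j w)); congr rel; apply/funext => l.
    by rewrite /dl; case: eqP => // _; rewrite scaler0 addr0.
  have [[k [Kk hk]] hg] := hPr (dl j v).
  have := lim0 _ _ _ Kk hk hg; rewrite mul1r.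
  under eq_bigr => l _ do rewrite ripBr.
  have hj : \sum_l rip ip (Pr (dl j v) l) (dl j v l) = rip ip (Pr (dl j v) j) v.
    rewrite (bigD1 j) //= [dl j v j]/dl eqxx big1 ?addr0 // => l /negPf lj.
    by rewrite [dl j v l]/dl lj rip0r.
  rewrite sumrB hj => /eqP; rewrite subr_eq0 => /eqP h.
  have h1 l : hnorm (Pr (dl j v) l) ^+ 2 <= rip ip (Pr (dl j v) j) v.
    rewrite h (bigD1 l) //= (hnorm_sq Hip) lerDl.
    by apply: sumr_ge0 => m _; rewrite -(hnorm_sq Hip) sqr_ge0.
  have h2 := rip_le Hip (Pr (dl j v) j) v.
  have h3 : hnorm (Pr (dl j v) j) <= hnorm v.
    have [z|z] := eqVneq (hnorm (Pr (dl j v) j)) 0; first by rewrite z.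
    by have := le_trans (h1 j) h2; rewrite expr2 ler_pM2l // lt_def z hnorm_ge0.
  rewrite -(@ler_pXn2r _ 2) ?nnegrE //; apply: le_trans (h1 i) _.
  by apply: le_trans h2 _; rewrite expr2; apply: ler_wpM2r.
have Psum (r : seq 'I_n) f : rel (fun i => \sum_(j <- r) dl j (f j) i)
    (fun i => \sum_(j <- r) P i j (f j)).
  elim: r => [|j r IH].
    split; first by exists (fun=> fun=> 0); split=> // i; rewrite big_nil; exact: hcvg_cst.
    by move=> h _; rewrite big1 // => i _; rewrite !big_nil subrr rip0r.
  have := relL 1 _ _ _ _ (hPr (dl j (f j))) IH; congr rel; apply/funext => i.
    by rewrite big_cons scale1r.
  by rewrite big_cons scale1r.
have PE f i : Pr f i = \sum_j P i j (f j).
  apply: (uniq f _ (fun i => \sum_j P i j (f j))) => //.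
  have := Psum (index_enum _) f; congr rel; apply/funext => l.
  rewrite (bigD1 l) //= /dl eqxx big1 ?addr0 // => j /negPf; rewrite eq_sym => ->.
  by [].
(* u lies in K because M contains the identity. *)
have ru : rel u u.
  split; last by move=> h _; rewrite big1 // => i _; rewrite subrr rip0r.
  exists (fun=> u); split=> [_|i]; last exact: hcvg_cst.
  by exists idfun => //; exact: (vn_one vM).
have Pu i : \sum_j P i j (u j) = u i by rewrite -PE; exact: (uniq u).
have Px i : \sum_j P i j (x (u j)) = x (u i).
  rewrite -[in RHS]Pu.
  have xs (r : seq 'I_n) : x (\sum_(j <- r) P i j (u j)) = \sum_(j <- r) P i j (x (u j)).
    elim: r => [|j r IH]; first by rewrite !big_nil (bop0 bx).
    by rewrite !big_cons (bopD bx) IH xc.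
  by rewrite xs.
have [[k [Kk hk]] _] := hPr (fun i => x (u i)).
have [N hN] := uniform_N (fun i => hk i _ e0).
have [a Ma ha] := Kk N; exists a => // v /(nthP 0)[i hi <-].
by have := hN (Ordinal hi) N (leqnn _); rewrite ha PE Px.
Qed.

Variable Om : H.
Hypothesis sep : forall a, M a -> a Om = 0 -> a = 0.

(** The projection p onto the closure of M' Om commutes with M', so it lies in M
   by the double commutant theorem, and 1 - p kills the separating vector Om. *)
Lemma commutant_cyclic u : closure [set x Om | x in commutant] u.
Proof.
set K := [set x Om | x in commutant].
have sK : subspace K.
  split; first by exists 0 => //; split=> [|a Ma v]; [exact: bop_zero|rewrite /= (bop0 (vn_bounded vM Ma))].
  move=> k _ _ [x cx <-] [y cy <-]; exists (k *: x + y) => //.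
  exact: commutant_lin.
have sK' := closure_subspace sK.
have cK' : closure (closure K) `<=` closure K.
  by move=> v /closure_seq[vs hvs hv]; exact: closureH_closed hvs hv.
pose p := orth_proj ip (closure K).
have bp : bounded_op p := orth_proj_bop Hip sK' cK'.
have pcom y : commutant y -> forall v, p (y v) = y (p v).
  move=> cy v; have [bY hy] := cy; apply: (orth_proj_unique Hip sK' cK').
    have /closure_seq[vs Kvs hvs] := orth_proj_in Hip sK' cK' v.
    apply: (seq_closure (v := fun n => y (vs n))); last exact: bop_cvg.
    move=> n; have [x [bx hx] <-] := Kvs n; exists (y \o x) => //.
    split; first exact: bop_comp.
    by move=> a Ma w /=; rewrite hx // hy.
  move=> w /closure_seq[ws Kws hws]; rewrite -(bopB bY) (adjPl Hip bY).
  apply: (orth_projP Hip sK' cK' v).2.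
  apply: (seq_closure (v := fun n => adj ip y (ws n))); last first.
    by apply: bop_cvg hws; exact: adj_bop.
  move=> n; have [x [bx hx] <-] := Kws n; exists (adj ip y \o x) => //.
  have [ba ha] := commutant_adj cy; split; first exact: bop_comp.
  by move=> a Ma z /=; rewrite hx // ha.
have KOm : closure K Om.
  by apply: sub_closureH; exists idfun => //; split=> //; exact: bop_id.
have Mp : M (idfun - p).
  apply: double_commutant; first by apply: bop_sub => //; exact: bop_id.
  by move=> y cy v; rewrite !fct_subE /= pcom // (bopB cy.1).
have : (idfun - p) = 0.
  apply: sep => //; rewrite fct_subE; apply/eqP; rewrite subr_eq0.
  by apply/eqP/esym; exact: (orth_proj_id Hip sK' cK' KOm).
move=> /(congr1 (@^~ u)); rewrite fct_subE => /eqP; rewrite subr_eq0 => /eqP/= ->.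
exact: orth_proj_in.
Qed.
End Algebra.
End VonNeumann.

(** * Conditional expectation and independence on vectors *)

Section Shift.
Variables (R : realType) (H : completeNormedModType R[i]).
Variable ip : {dot H for (@Num.conj R[i])}.
Variable B : bernoulli_shift ip.

Local Notation A := (bs_alg B).
Local Notation Om := (bs_vec B).
Local Notation A0 := (bs_alg0 B).
Local Notation E0 := (bs_exp0 B).
Local Notation e0 := (proj0 B).
Local Notation F := (bs_filt B).
Local Notation S := (bs_shift B).

Lemma shift_hilbert : forall u : H, `|u| ^+ 2 = ip u u.
Proof. exact: ps_hilbert (bs_prob B). Qed.
Local Notation Hip := shift_hilbert.

Lemma shift_vn : vn_algebra ip A.
Proof. exact: ps_vn (bs_prob B). Qed.
Local Notation vA := shift_vn.

Lemma alg_bop a : A a -> bounded_op a.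
Proof. exact: (vn_bounded vA). Qed.

Lemma alg_sep a b : A a -> A b -> a Om = b Om -> a = b.
Proof.
move=> Aa Ab ab; apply/eqP; rewrite -subr_eq0; apply/eqP.
apply: (ps_separating (bs_prob B)); first exact: (vnB vA).
by rewrite fct_subE ab subrr.
Qed.

Lemma alg0_vn : vn_algebra ip A0.
Proof. by have [] := bs_sub0 B. Qed.
Local Notation vA0 := alg0_vn.

Lemma alg0_sub : A0 `<=` A.
Proof. by have [] := bs_sub0 B. Qed.

Lemma filt_vn I : is_interval I -> vn_algebra ip (F I).
Proof. by move=> iI; have [] := bs_filt_sub B iI. Qed.

Lemma filt_sub I : is_interval I -> F I `<=` A.
Proof. by move=> iI; have [] := bs_filt_sub B iI. Qed.

Lemma alg0_filt I : is_interval I -> A0 `<=` F I.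
Proof.
move=> iI; have i0 : is_interval (set0 : set R) by move=> x y [].
by have [] := bs_indep B iI i0 (setI0 I).
Qed.

(** The bimodule property moves b^* under the state, which E preserves; thus E acts
   on vectors as the orthogonal projection onto the closure of C Om. *)
Lemma cond_exp_ip C E a b : vn_algebra ip C -> C `<=` A -> cond_exp ip A Om C E ->
  A a -> C b -> ip (E a Om) (b Om) = ip (a Om) (b Om).
Proof.
move=> vC CA hE Aa Cb; have bb := alg_bop (CA _ Cb).
have Cb' := vn_adj vC Cb.
rewrite !(adjPl Hip bb).
have := ce_bimod hE Cb' Aa (vn_one vC) => h.
have Aba : A (adj ip b \o a \o idfun).
  by apply: (vn_mul vA) (vn_one vA); apply: (vn_mul vA) => //; exact: CA.
by have := ce_state hE Aba; rewrite h.
Qed.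

Lemma exp0_alg a : A a -> A0 (E0 a).
Proof. exact: (ce_range (bs_exp0P B)). Qed.

Lemma space0_orbit : subspace [set a Om | a in A0].
Proof.
split; first by exists 0 => //; exact: (vn_zero vA0).
move=> k _ _ [x Ax <-] [y Ay <-]; exists (k *: x + y) => //.
exact: (vn_linear vA0).
Qed.

Lemma space0_subspace : subspace (space0 B).
Proof. exact: closure_subspace space0_orbit. Qed.

Lemma space0_closed : closure (space0 B) `<=` space0 B.
Proof. by move=> v /closure_seq[vs hvs hv]; exact: closureH_closed hvs hv. Qed.
Local Notation sp := space0_subspace.
Local Notation cp := space0_closed.

Lemma proj0_in u : space0 B (e0 u).
Proof. exact: (orth_proj_in Hip sp cp). Qed.

Lemma proj0_id u : space0 B u -> e0 u = u.
Proof. exact: (orth_proj_id Hip sp cp). Qed.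

Lemma proj0_sym u v : ip (e0 u) v = ip u (e0 v).
Proof. exact: (orth_proj_sym Hip sp cp). Qed.

Lemma proj0_bop : bounded_op e0.
Proof. exact: (orth_proj_bop Hip sp cp). Qed.

Lemma proj0_le u : hnorm (e0 u) <= hnorm u.
Proof. exact: (orth_proj_le Hip sp cp). Qed.

Lemma proj0_proj u : e0 (e0 u) = e0 u.
Proof. by rewrite proj0_id //; exact: proj0_in. Qed.

Lemma proj0_unique u q : space0 B q ->
  (forall a, A0 a -> ip (a Om) (u - q) = 0) -> e0 u = q.
Proof.
move=> hq h; apply: (orth_proj_unique Hip sp cp) => // v /closure_seq[vs Xv hv].
apply: (hcvg_ip_eq Hip hv (hcvg_cst _)) => n.
by have [a Aa <-] := Xv n; exact: h.
Qed.

Lemma space0_vec a : A0 a -> space0 B (a Om).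
Proof. by move=> Aa; apply: sub_closureH; exists a. Qed.

Lemma space0_Om : space0 B Om.
Proof. exact: (space0_vec (vn_one vA0)). Qed.

Lemma space0_alg0 a u : A0 a -> space0 B u -> space0 B (a u).
Proof.
move=> Aa /closure_seq[vs Xv hv].
apply: (seq_closure (v := fun n => a (vs n))).
  by move=> n; have [b Ab <-] := Xv n; exists (a \o b) => //; exact: (vn_mul vA0).
by apply: bop_cvg hv; exact: (vn_bounded vA0).
Qed.

Lemma exp0_vec a : A a -> E0 a Om = e0 (a Om).
Proof.
move=> Aa; apply/esym; apply: proj0_unique.
  by apply: space0_vec; exact: exp0_alg.
move=> b Ab; rewrite ipC ipBl.
rewrite (cond_exp_ip vA0 alg0_sub (bs_exp0P B) Aa Ab).
by rewrite subrr rmorph0.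
Qed.

(** The bimodule property moves the elements of A0 that generate u and v into the
   expectation, which preserves the state. *)
Lemma exp0_ip0 a u v : A a -> space0 B u -> space0 B v ->
  ip (E0 a u) v = ip (a u) v.
Proof.
move=> Aa /closure_seq[us Xu hu] /closure_seq[vs Xv hv].
have ba := alg_bop Aa; have bE := vn_bounded vA0 (exp0_alg Aa).
apply: (hcvg_ip_eq2 Hip (bop_cvg bE hu) hv (bop_cvg ba hu) hv) => n.
have [x Ax <-] := Xu n; have [y Ay <-] := Xv n.
have Aax : A (a \o x) by apply: (vn_mul vA) => //; exact: alg0_sub.
rewrite -[LHS]/(ip ((E0 a \o x) Om) _) -[RHS]/(ip ((a \o x) Om) _).
rewrite -(cond_exp_ip vA0 alg0_sub (bs_exp0P B) Aax Ay).
by have -> : E0 (a \o x) = E0 a \o x := ce_bimod (bs_exp0P B) (vn_one vA0) Aa Ax.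
Qed.

(** Independence expressed on vectors, the form used for estimates. *)
Definition free (I J : set R) := forall b y1 y2, F I b -> F J y1 -> F J y2 ->
  ip (b (y1 Om)) (y2 Om) = ip (E0 b (y1 Om)) (y2 Om).

(** The conditional expectation EC onto the algebra of J takes the same values as
   E0 on the algebra of I; then the bimodule property of EC moves y1 and y2
   out of the expectation. *)
Lemma free_disjoint I J : is_interval I -> is_interval J -> I `&` J = set0 ->
  free I J.
Proof.
move=> iI iJ IJ b y1 y2 Ib Jy1 Jy2.
have [_ _ [EC hEC]] := bs_filt_sub B iJ.
have vJ := filt_vn iJ; have JA := filt_sub iJ; have IA := filt_sub iI.
have Ab := IA _ Ib; have bb := alg_bop Ab.
have A0J := alg0_filt iJ.
have JE0 : F J (E0 b) by apply: A0J; exact: exp0_alg.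
have JEC : F J (EC b) by exact: (ce_range hEC).
have AEC := JA _ JEC; have AE0 := JA _ JE0.
(* d is orthogonal to itself: by independence and by the bimodule property,
   E0 maps d^* b and d^* (E0 b) to the same product, that of E0 b with the
   expectation of d^*. *)
have EE : EC b = E0 b.
  apply: alg_sep => //; apply/eqP; rewrite -subr_eq0; apply/eqP.
  pose d := EC b - E0 b.
  have Jd : F J d by exact: (vnB vJ).
  have bd := alg_bop (JA _ Jd).
  apply: (rip_eq0 Hip (ip := ip)); rewrite /rip -[EC b Om - _]/(d Om).
  rewrite -[0]/(complex.Re (0 : R[i])); congr complex.Re.
  rewrite {1}[d Om]fct_subE ipBl (cond_exp_ip vJ JA hEC Ab Jd).
  have Jd' := vn_adj vJ Jd; have Ad' := JA _ Jd'.
  have JI : J `&` I = set0 by rewrite setIC.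
  have [_ _ ind] := bs_indep B iJ iI JI.
  have e1 := ce_state (bs_exp0P B) (vn_mul vA Ad' Ab).
  have e2 := ce_state (bs_exp0P B) (vn_mul vA Ad' AE0).
  have e3 : E0 (adj ip d \o E0 b) = E0 (adj ip d) \o E0 b :=
    ce_bimod (bs_exp0P B) (vn_one vA0) Ad' (exp0_alg Ab).
  rewrite e3 in e2; rewrite (ind _ _ Jd' Ib) in e1.
  apply/eqP; rewrite subr_eq0 !(adjPl Hip bd); apply/eqP.
  exact: (etrans (esym e1) e2).
have J2' := vn_adj vJ Jy2; have A2' := JA _ J2'; have A1 := JA _ Jy1.
have := ce_bimod hEC J2' Ab Jy1.
have Aall : A (adj ip y2 \o b \o y1) by apply: (vn_mul vA) => //; apply: (vn_mul vA).
have := ce_state hEC Aall => /[swap] ->; rewrite EE /vstate /= => h.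
by rewrite !(adjPl Hip (alg_bop (JA _ Jy2))) h.
Qed.
End Shift.

Arguments proj0_in {R H ip} B u.
Arguments space0_Om {R H ip} B.

(** * The A0-valued square and estimates under independence *)

Section Freeness.
Variables (R : realType) (H : completeNormedModType R[i]).
Variable ip : {dot H for (@Num.conj R[i])}.
Variable B : bernoulli_shift ip.

Local Notation A := (bs_alg B).
Local Notation Om := (bs_vec B).
Local Notation A0 := (bs_alg0 B).
Local Notation E0 := (bs_exp0 B).
Local Notation e0 := (proj0 B).
Local Notation F := (bs_filt B).
Local Notation S := (bs_shift B).
Local Notation Hip := (shift_hilbert B).
Local Notation vA := (shift_vn B).
Local Notation vA0 := (alg0_vn B).

Lemma complex_norm0 (z : R[i]) : (forall e : R[i], 0 < e -> `|z| < e) -> z = 0.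
Proof.
move=> h; apply/eqP/negP => /negP nz.
by have := h `|z|; rewrite normr_gt0 nz ltxx => /(_ isT).
Qed.

(** Vector functionals are normal: take the sequences that vanish after their
   first terms. *)
Lemma normal_vec (N : set (H -> H)) (u v : H) : normal_functional ip N (fun a => ip (a u) v).
Proof.
have zero (T : zmodType) (f : nat -> T) : (forall n, f n.+1 = 0) ->
    (fun n => series f n.+1) = (fun=> f 0%N).
  by move=> h; apply/funext => n; rewrite /series /= big_nat_recl // big1 ?addr0.
pose xi n := if n is 0%N then u else 0; pose eta n := if n is 0%N then v else 0.
exists xi, eta; split=> [||a Na].
- apply/cvg_ex; exists (hnorm (xi 0%N) ^+ 2); rewrite -cvg_shiftS.
  have -> := @zero R (fun n => hnorm (xi n) ^+ 2); last by move=> n; rewrite hnorm0 expr0n.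
  exact: cvg_cst.
- apply/cvg_ex; exists (hnorm (eta 0%N) ^+ 2); rewrite -cvg_shiftS.
  have -> := @zero R (fun n => hnorm (eta n) ^+ 2); last by move=> n; rewrite hnorm0 expr0n.
  exact: cvg_cst.
- rewrite -cvg_shiftS.
  have -> := @zero R[i]^o (fun n => ip (a (xi n)) (eta n)); last by move=> n; rewrite ip0r.
  exact: cvg_cst.
Qed.

Lemma shift_alg t a : A a -> A (S t a).
Proof.
by move=> Aa; have [h _ _] := aut_bij (bs_aut B t); apply: h.
Qed.

Lemma shift_fix t a : A0 a -> S t a = a.
Proof. by rewrite (bs_fixed B) => -[_]. Qed.

Lemma shift_ip0 t a b : A a -> A0 b -> ip (S t a Om) (b Om) = ip (a Om) (b Om).
Proof.
move=> Aa A0b; have Ab := alg0_sub A0b; have bb := alg_bop Ab.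
have Ab' := vn_adj vA Ab; have A0b' := vn_adj vA0 A0b.
rewrite !(adjPl Hip bb); have := aut_state (bs_aut B t) (vn_mul vA Ab' Aa).
by rewrite (aut_mul (bs_aut B t)) // (shift_fix t A0b').
Qed.

(** A0 is fixed by the shift, which preserves the state; hence a and S t a have
   the same inner products with the vectors of A0. *)
Lemma shift_exp0 t a : A a -> E0 (S t a) = E0 a.
Proof.
move=> Aa; have ASa := shift_alg t Aa.
apply: (alg_sep (B := B)); try by apply: alg0_sub; exact: exp0_alg.
rewrite !exp0_vec //; apply: proj0_unique; first exact: proj0_in.
move=> b Ab; have := shift_ip0 t Aa Ab => h.
rewrite ipC ipBl h proj0_sym proj0_id; last exact: space0_vec.
by rewrite subrr rmorph0.
Qed.

(** Intervals with a common end point become disjoint after a small shift of I,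
   and the shift is continuous on vector functionals. *)
Lemma free_touching I J : is_interval I -> is_interval J ->
  (forall t, 0 < t -> [set s + t | s in I] `&` J = set0) -> free B I J.
Proof.
move=> iI iJ IJ b y1 y2 Ib Jy1 Jy2.
have Ab : A b := filt_sub iI Ib.
have /(_ 0) ct : continuous (fun t : R => ip (S t b (y1 Om)) (y2 Om) : R[i]^o).
  exact: (bs_continuous Ab (normal_vec A (y1 Om) (y2 Om))).
have h t : 0 < t -> ip (S t b (y1 Om)) (y2 Om) = ip (E0 b (y1 Om)) (y2 Om).
  move=> t0; have iIt : is_interval [set s + t | s in I].
    move=> _ _ [x Ix <-] [y Iy <-] z /andP[xz zy]; exists (z - t); last by rewrite subrK.
    apply: (iI x y) => //; apply/andP; split; lra.
  have Ibt : F [set s + t | s in I] (S t b).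
    by rewrite -(bs_covariant B t iI); exists b.
  by rewrite (free_disjoint iIt iJ (IJ _ t0) Ibt Jy1 Jy2) shift_exp0.
rewrite -{1}(bs_shift0 Ab); apply/eqP; rewrite -subr_eq0; apply/eqP.
apply: complex_norm0 => e e0.
move/cvgrPdist_lt : ct => /(_ e e0)/nbhs_ballP[d /= d0 hd].
have := hd (d / 2); rewrite -(h (d / 2)) ?divr_gt0 //; apply.
rewrite -ball_normE /= sub0r normrN gtr0_norm ?divr_gt0 //; lra.
Qed.

(** The vectors in the closure of A0 Om need not exhaust H, but the separation property
   makes them test positivity in A0: a = |g| - g, for g a scaled h, lives on
   the negative part of g.  Positivity on a Om forces |g| a Om = 0, hence
   |g| a = 0, and then a = 0. *)
Lemma alg0_positive h : A0 h -> sym_op ip h ->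
  (forall a, A0 a -> 0 <= rip ip (h (a Om)) (a Om)) ->
  forall u, 0 <= rip ip (h u) u.
Proof.
move=> A0h sh hpos; have bh := vn_bounded vA0 A0h.
have [K0 K0p hK0] := bopP bh.
pose K := K0 + 1; have Kp : 0 < K by rewrite /K; lra.
pose g : H -> H := K^-1%:C *: h.
have gE u : g u = K^-1%:C *: h u by [].
have A0g : A0 g by exact: (vnZ vA0).
have bg := vn_bounded vA0 A0g.
have sg : sym_op ip g.
  by move=> u v; rewrite !gE ipZl ipZr sh; congr (_ * _);
     apply/eqP; rewrite eq_complex /= oppr0 !eqxx.
have ng u : hnorm (g u) <= hnorm u.
  rewrite gE hnormZ gtr0_norm ?invr_gt0 // ler_pdivrMl //.
  by apply: le_trans (hK0 u) _; apply: ler_wpM2r => //; rewrite /K; lra.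
(* The iteration for b = 1 - g^2 yields m = |g|, the square root of g^2. *)
pose b : H -> H := idfun - (g \o g).
have bE u : b u = u - g (g u) by [].
have A0b : A0 b by apply: (vnB vA0); [exact: (vn_one vA0) | exact: (vn_mul vA0)].
have bb := vn_bounded vA0 A0b.
have sb : sym_op ip b by move=> u v; rewrite !bE ipBl ipBr !sg.
have cb : forall u, hnorm (b u) <= hnorm u.
  apply: (pos_contraction Hip bb sb) => u; rewrite bE ripBl (sym_rip _ _ sg).
  rewrite -!(hnorm_sq Hip).
  have : hnorm (g u) ^+ 2 <= hnorm u ^+ 2 by rewrite ler_pXn2r ?nnegrE.
  have := sqr_ge0 (hnorm (g u)); lra.
have [k [bk nk ke hP]] := sqrt_iter bb cb.
have [sk kc] := sqrt_iter_props Hip bb sb hP.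
have kb v : k (b v) = b (k v) by apply: kc.
have gb v : g (b v) = b (g v) by rewrite !bE (bopB bg).
have kg v : k (g v) = g (k v) by apply: kc.
have A0k : A0 k.
  apply: hP; first exact: (vn_zero vA0); last exact: (vn_seq_closed vA0).
  move=> w bw A0w.
  have -> : sqrt_step b w = half R *: (idfun + (b \o (w \o w))) by [].
  apply: (vnZ vA0); apply: (vnD vA0); first exact: (vn_one vA0).
  by do 2 apply: (vn_mul vA0) => //.
have sq u := sqrt_iter_sq bb bk ke u kb.
pose m : H -> H := idfun - (b \o k).
have mE u : m u = u - b (k u) by [].
have mm u : m (m u) = g (g u) by rewrite !mE (sq u) bE opprB addrC subrK.
have A0m : A0 m by apply: (vnB vA0); [exact: (vn_one vA0) | exact: (vn_mul vA0)].
have bm := vn_bounded vA0 A0m.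
have sm : sym_op ip m by move=> u v; rewrite !mE ipBl ipBr sb sk kb.
have mg u : m (g u) = g (m u) by rewrite !mE (bopB bg) kg gb.
have nbk u : hnorm (b (k u)) <= hnorm u by apply: le_trans (cb _) (nk _).
have mpos u : 0 <= rip ip (m u) u.
  rewrite mE ripBl -(hnorm_sq Hip) subr_ge0; apply: le_trans (rip_le Hip _ _) _.
  by rewrite expr2; apply: ler_wpM2r.
pose a : H -> H := m - g.
have aE u : a u = m u - g u by [].
have A0a : A0 a by exact: (vnB vA0).
have ba := vn_bounded vA0 A0a.
have sa : sym_op ip a by move=> u v; rewrite !aE ipBl ipBr sm sg.
have ga u : g (a u) = - m (a u).
  by rewrite !aE (bopB bg) (bopB bm) mm mg opprB.
(* On v = a Om both m and g = - m are nonnegative, so that m v = 0. *)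
have maOm : m (a Om) = 0.
  set v := a Om; have h1 : 0 <= rip ip (g v) v.
    rewrite gE ripZl; apply: mulr_ge0; last exact: hpos.
    by rewrite invr_ge0 ltW.
  move: h1; rewrite [g v]ga ripNl oppr_ge0 => h1.
  have h2 : rip ip (b (k v)) v = hnorm v ^+ 2.
    have := mpos v; rewrite mE ripBl -(hnorm_sq Hip) in h1 *; lra.
  apply/eqP; rewrite mE -oppr_eq0 opprB; apply/eqP/hnorm_eq0/eqP.
  rewrite -sqrf_eq0 eq_le sqr_ge0 andbT (hnorm_sqB Hip) h2.
  have : hnorm (b (k v)) ^+ 2 <= hnorm v ^+ 2 by rewrite ler_pXn2r ?nnegrE.
  lra.
have ma0 : m \o a = 0.
  apply: (ps_separating (bs_prob B)) => //.
  by apply: alg0_sub; exact: (vn_mul vA0).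
have ma u : m (a u) = 0 by have := congr1 (@^~ u) ma0.
have a0 u : a u = 0.
  apply: (rip_eq0 Hip (ip := ip)); rewrite (sym_rip _ _ sa) aE ma ga ma oppr0.
  by rewrite subrr rip0r.
move=> u; have : 0 <= rip ip (g u) u.
  by have /eqP := a0 u; rewrite aE subr_eq0 => /eqP <-.
rewrite gE ripZl pmulr_rge0 // invr_gt0 //.
Qed.

(** Its extension to the module is the A0-valued inner product of w with itself. *)
Definition exp_sq (w : H -> H) : H -> H := E0 (adj ip w \o w).

Section ExpSq.
Variable w : H -> H.
Hypothesis Aw : A w.
Let bw := alg_bop Aw.

Lemma sq_alg : A (adj ip w \o w).
Proof. by apply: (vn_mul vA) => //; exact: (vn_adj vA). Qed.

Lemma exp_sq_alg0 : A0 (exp_sq w).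
Proof. exact: exp0_alg sq_alg. Qed.

Lemma exp_sq_bop : bounded_op (exp_sq w).
Proof. exact: (vn_bounded vA0 exp_sq_alg0). Qed.

Lemma exp_sq_pos : positive_op ip (exp_sq w).
Proof.
apply: (ce_pos (bs_exp0P B) sq_alg); split; first exact: alg_bop sq_alg.
by move=> u; rewrite /= -(adjPl Hip bw) -Hip exprn_ge0.
Qed.

Lemma exp_sq_sym : sym_op ip (exp_sq w).
Proof. exact: (positive_sym exp_sq_pos). Qed.

Lemma exp_sq_ip u v : space0 B u -> space0 B v -> ip (exp_sq w u) v = ip (w u) (w v).
Proof.
move=> hu hv; rewrite /exp_sq (exp0_ip0 sq_alg hu hv) /=.
by rewrite (adjPl Hip bw).
Qed.

Variable K : R.
Hypothesis K0 : 0 <= K.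
Hypothesis wK : forall u, space0 B u -> hnorm (w u) <= K * hnorm u.

(** A bound of w on the vectors of A0 bounds the A0-valued square there, hence
   everywhere, since positivity in A0 is tested on these vectors. *)
Lemma exp_sq_bound u : 0 <= rip ip (exp_sq w u) u <= K ^+ 2 * hnorm u ^+ 2.
Proof.
apply/andP; split; first exact: (Re_mono (exp_sq_pos.2 u)).
pose h : H -> H := (K ^+ 2)%:C *: idfun - exp_sq w.
have hE v : h v = (K ^+ 2)%:C *: v - exp_sq w v by [].
suff : 0 <= rip ip (h u) u by rewrite hE ripBl ripZl -(hnorm_sq Hip) subr_ge0.
apply: alg0_positive.
- apply: (vnB vA0); last exact: exp_sq_alg0.
  by apply: (vnZ vA0); exact: (vn_one vA0).
- move=> x y; rewrite !hE ipBl ipBr ipZl ipZr exp_sq_sym; congr (_ * _ - _).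
  by apply/eqP; rewrite eq_complex /= oppr0 !eqxx.
move=> a A0a; have sa := space0_vec A0a.
rewrite hE ripBl ripZl {2}/rip exp_sq_ip // -/(rip ip _ _) -!(hnorm_sq Hip) subr_ge0.
by rewrite -exprMn ler_pXn2r ?nnegrE //; [exact: wK | exact: mulr_ge0].
Qed.

Lemma exp_sq_le u : hnorm (exp_sq w u) <= K ^+ 2 * hnorm u.
Proof.
have [k0|k0] := eqVneq K 0.
  have z v : rip ip (exp_sq w v) v = 0.
    have := exp_sq_bound v; rewrite k0 expr0n /= mul0r => /andP[? ?].
    by apply/eqP; rewrite eq_le; apply/andP.
  have b0 : exp_sq w u = 0.
    apply: (rip_eq0 Hip (ip := ip)).
    have := z (u + exp_sq w u); rewrite (bopD exp_sq_bop) !ripE !z add0r addr0.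
    rewrite (sym_rip (exp_sq w u) u exp_sq_sym); lra.
  by rewrite b0 hnorm0 mulr_ge0 // exprn_ge0.
have Kp : 0 < K ^+ 2 by rewrite exprn_gt0 // lt_def k0.
pose x : H -> H := (K ^+ 2)^-1%:C *: exp_sq w.
have xE v : x v = (K ^+ 2)^-1%:C *: exp_sq w v by [].
have : hnorm (x u) <= hnorm u.
  apply: (pos_contraction Hip).
  - by apply: bop_scale; exact: exp_sq_bop.
  - move=> y v; rewrite !xE ipZl ipZr exp_sq_sym; congr (_ * _).
    by apply/eqP; rewrite eq_complex /= oppr0 !eqxx.
  move=> v; rewrite xE ripZl; have /andP[h1 h2] := exp_sq_bound v.
  by rewrite ler_pdivrMl // h2 andbT mulr_ge0 // invr_ge0 ltW.
by rewrite xE hnormZ gtr0_norm ?invr_gt0 // ler_pdivrMl.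
Qed.

(** Unlike the operator bound K^2, this bound is small when w Om is small. *)
Lemma exp_sq_vec : hnorm (exp_sq w Om) <= K * hnorm (w Om).
Proof.
have h : hnorm (exp_sq w Om) ^+ 2 <= hnorm (exp_sq w Om) * (K * hnorm (w Om)).
  have s1 := space0_vec exp_sq_alg0.
  rewrite (hnorm_sq Hip) {1}/rip exp_sq_ip //; last exact: space0_Om.
  rewrite -/(rip ip _ _); apply: le_trans (rip_le Hip _ _) _.
  rewrite [leRHS]mulrA mulrC ; apply: ler_wpM2r => //.
  by rewrite mulrC; exact: wK.
have [z|z] := eqVneq (hnorm (exp_sq w Om)) 0; first by rewrite z mulr_ge0.
by move: h; rewrite expr2 ler_pM2l // lt_def z hnorm_ge0.
Qed.
End ExpSq.

(** All modules over J have their ranges in this space. *)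
Definition filt_space (J : set R) : set H := closure [set y Om | y in F J].

Section Free.
Variables (I J : set R).
Hypotheses (iI : is_interval I) (iJ : is_interval J) (fIJ : free B I J).

Lemma free_ip b u v : F I b -> filt_space J u -> filt_space J v ->
  ip (b u) v = ip (E0 b u) v.
Proof.
move=> Ib /closure_seq[us Xu hu] /closure_seq[vs Xv hv].
have Ab := filt_sub iI Ib; have bb := alg_bop Ab.
have bE := vn_bounded vA0 (exp0_alg Ab).
apply: (hcvg_ip_eq2 Hip (bop_cvg bb hu) hv (bop_cvg bE hu) hv) => n.
have [x Ax <-] := Xu n; have [y Ay <-] := Xv n; exact: fIJ.
Qed.

(** Apply freeness to w^* w. *)
Lemma free_sq w u : F I w -> filt_space J u -> hnorm (w u) ^+ 2 = rip ip (exp_sq w u) u.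
Proof.
move=> Iw hu; have Aw := filt_sub iI Iw; have bw := alg_bop Aw.
have vI := filt_vn B iI.
rewrite (hnorm_sq Hip) /rip (adjPl Hip bw).
have Iww : F I (adj ip w \o w) by apply: (vn_mul vI) => //; exact: (vn_adj vI).
by have /= -> := free_ip Iww hu hu.
Qed.

(** A bound on the vectors of A0 bounds exp_sq w, which computes the length of w u.
   This makes products of independent elements bounded although w is only
   controlled on a small subspace. *)
Lemma free_le w u (K : R) : F I w -> filt_space J u -> 0 <= K ->
  (forall v, space0 B v -> hnorm (w v) <= K * hnorm v) -> hnorm (w u) <= K * hnorm u.
Proof.
move=> Iw hu K0 hK; have Aw := filt_sub iI Iw.
rewrite -(@ler_pXn2r _ 2) ?nnegrE //; last exact: mulr_ge0.
by rewrite free_sq // exprMn; have /andP[] := exp_sq_bound Aw K0 hK u.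
Qed.

(** The square of w acts on u; it belongs to A0 and so commutes with the
   commutant of A.  Approximate u by x Om with x in this commutant: the error
   is controlled by K, and on x Om the square is x applied to its value at Om. *)
Lemma free_small (K : R) u (e : R) : 0 <= K -> filt_space J u -> 0 < e ->
  exists2 d : R, 0 < d & forall w, F I w ->
    (forall v, space0 B v -> hnorm (w v) <= K * hnorm v) ->
    hnorm (w Om) < d -> hnorm (w u) < e.
Proof.
move=> K0 hu e0.
have u1 : 0 < hnorm u + 1 by have := hnorm_ge0 u; lra.
have k1 : 0 < K ^+ 2 + 1 by have := sqr_ge0 K; lra.
pose d1 := e ^+ 2 / (2 * (hnorm u + 1) * (K ^+ 2 + 1)).
have d10 : 0 < d1 by rewrite divr_gt0 ?exprn_gt0 // !mulr_gt0.
have /closureHP/(_ d1 d10)[_ [x [bx cx] <-] hx] :=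
  @commutant_cyclic _ _ _ Hip _ vA Om (ps_separating (bs_prob B)) u.
have [L L0 hL] := bopP bx.
pose d := e ^+ 2 / (2 * (hnorm u + 1) * (L * K + 1)).
have lk : 0 < L * K + 1 by have := mulr_ge0 L0 K0; lra.
exists d => [|w Iw hK hw]; first by rewrite divr_gt0 ?exprn_gt0 // !mulr_gt0.
have Aw := filt_sub iI Iw; apply: small_sq => //; rewrite free_sq //.
have b1 := exp_sq_le Aw K0 hK (u - x Om).
have b2 := exp_sq_vec Aw K0 hK.
have bq := exp_sq_bop Aw.
have b3 : exp_sq w (x Om) = x (exp_sq w Om).
  by rewrite cx //; apply: alg0_sub; exact: exp_sq_alg0.
have b4 := hL (exp_sq w Om); rewrite -b3 in b4.
have b5 := hnorm_le_diff (exp_sq w u) (exp_sq w (x Om)).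
rewrite -(bopB bq) in b5.
apply: le_lt_trans (rip_le Hip _ _) _.
have d1E : d1 * (K ^+ 2 + 1) * (hnorm u + 1) = e ^+ 2 / 2.
  by rewrite /d1; field; rewrite !gt_eqF.
have dE : d * (L * K + 1) * (hnorm u + 1) = e ^+ 2 / 2.
  by rewrite /d; field; rewrite !gt_eqF.
have d0 : 0 < d by rewrite divr_gt0 ?exprn_gt0 // !mulr_gt0.
have c1 : hnorm (exp_sq w (u - x Om)) <= d1 * (K ^+ 2 + 1).
  apply: le_trans b1 _; rewrite mulrC; apply: ler_pM => //; rewrite ?sqr_ge0 //; lra.
have c2 : hnorm (exp_sq w (x Om)) <= d * (L * K + 1).
  apply: le_trans b4 _; apply: le_trans (ler_wpM2l L0 b2) _; rewrite mulrA mulrC.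
  by apply: ler_pM => //; [exact: mulr_ge0 | exact: ltW | lra].
have e2 : 0 < e ^+ 2 by rewrite exprn_gt0.
have c3 : hnorm (exp_sq w u) <= d1 * (K ^+ 2 + 1) + d * (L * K + 1) by lra.
have c4 : 0 < d1 * (K ^+ 2 + 1) + d * (L * K + 1) by rewrite addr_gt0 // mulr_gt0.
apply: (@le_lt_trans _ _ ((d1 * (K ^+ 2 + 1) + d * (L * K + 1)) * hnorm u)).
  exact: ler_wpM2r.
have : (d1 * (K ^+ 2 + 1) + d * (L * K + 1)) * (hnorm u + 1) = e ^+ 2.
  by rewrite mulrDl d1E dE; lra.
rewrite mulrDr mulr1; lra.
Qed.
End Free.

(** The Hilbert space is separable: for each functional of a dense sequence in
   the predual, each precision and each radius, choose a vector whose vector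
   functional is that close, if there is one.  A vector orthogonal to all
   chosen ones is close to one of them in the weak sense, hence zero. *)
Lemma total_sequence : exists v : nat -> H,
  forall u, (forall k, ip (v k) u = 0) -> u = 0.
Proof.
have [phi nphi dphi] := ps_predual (bs_prob B).
pose Q (n k m : nat) : set H := [set u | hnorm u <= m%:R /\ forall a, A a ->
  opnorm a <= 1 -> complex.Re `|ip (a Om) u - phi n a| <= k.+1%:R^-1].
pose v j := if unpickle j is Some (n, k, m) then xget 0 (Q n k m) else 0.
exists v => u hv; apply: contrapT => /eqP u0.
have r0 : 0 < hnorm u.
  by rewrite lt_def hnorm_ge0 andbT; apply: contra u0 => /eqP/hnorm_eq0->.
set r := hnorm u in r0.
pose m := (Num.truncn r).+1; have mr : r < m%:R by exact: truncnS_gt.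
pose d := r ^+ 2 / (4 * m%:R).
have m0 : 0 < m%:R :> R by exact: lt_trans r0 mr.
have d0 : 0 < d by rewrite divr_gt0 ?exprn_gt0 // mulr_gt0.
(* u is approximated by a Om; L rescales a to the unit ball of A. *)
have : closure [set a Om | a in A] u by rewrite (ps_cyclic (bs_prob B)).
move=> /closureHP/(_ d d0)[_ [a Aa <-] ha].
have ba := alg_bop Aa.
pose L := opnorm a + 1; have L0 : 0 < L by have := opnorm_ge0 ba; rewrite /L; lra.
have [k hk] := @invS_small R (r ^+ 2 / (8 * L)) (ltac:(by rewrite divr_gt0 ?exprn_gt0 // mulr_gt0)).
have {}hk := hk k (leqnn _).
have [|n hn] := dphi _ (normal_vec A Om u) k.+1%:R^-1; first by rewrite invr_gt0.
have Qu : Q n k m u by split; first exact: ltW.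
pose w := xget 0 (Q n k m).
have [wm hw] : Q n k m w by exact: xgetPex (ex_intro _ u Qu).
have wu : ip w u = 0.
  by have := hv (pickle (n, k, m)); rewrite /v pickleK.
pose a' : H -> H := L^-1%:C *: a.
have Aa' : A a' by exact: (vnZ vA).
have na' : opnorm a' <= 1.
  apply: opnorm_le => //; first exact: (alg_bop Aa').
  move=> x; rewrite mul1r [a' x]fct_scaleE hnormZ gtr0_norm ?invr_gt0 // ler_pdivrMl //.
  apply: le_trans (opnormP _ ba) _; apply: ler_wpM2r => //; rewrite /L; lra.
have t1 := hn a' Aa' na'; have t2 := hw a' Aa' na'.
have t3 : complex.Re `|ip (a' Om) u - ip (a' Om) w| <= 2 * k.+1%:R^-1.
  have -> : ip (a' Om) u - ip (a' Om) w = (ip (a' Om) u - phi n a') + (phi n a' - ip (a' Om) w).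
    by rewrite addrA subrK.
  apply: le_trans (Re_mono (ler_normD _ _)) _; rewrite ReD [X in _ + complex.Re X]distrC.
  by rewrite mulr_natl mulr2n; exact: lerD.
have Re_le (z : R[i]) : complex.Re z <= complex.Re `|z|.
  by case: z => x y; rewrite normc_def /=; apply: le_trans (ler_norm _) _;
     rewrite -sqrtr_sqr ler_wsqrtr // lerDl sqr_ge0.
have t4 : rip ip (a Om) u - rip ip (a Om) w <= 2 * L * k.+1%:R^-1.
  have := le_trans (Re_le _) t3; rewrite ReD ReN [a' Om]fct_scaleE -!/(rip ip _ _).
  rewrite !ripZl -mulrBr ler_pdivrMl // => h; apply: le_trans h _.
  by rewrite le_eqVlt; apply/orP; left; apply/eqP; ring.
have t5 : rip ip (a Om) u = r ^+ 2 - rip ip (u - a Om) u.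
  by rewrite ripBl -(hnorm_sq Hip) opprB addrC subrK.
have t6 : rip ip (a Om) w = - rip ip (u - a Om) w.
  rewrite ripBl (_ : rip ip u w = 0) ?sub0r ?opprK //.
  by rewrite ripC /rip wu.
have t7 := rip_le Hip (u - a Om) u; have t8 := rip_le Hip (u - a Om) (- w).
rewrite hnormN ripNr in t8.
have t9 : hnorm (u - a Om) * hnorm u <= d * m%:R.
  by apply: ler_pM => //; apply: ltW.
have t10 : hnorm (u - a Om) * hnorm w <= d * m%:R.
  by apply: ler_pM => //; apply: ltW.
have dE : d * m%:R = r ^+ 2 / 4 by rewrite /d; field; rewrite gt_eqF.
rewrite dE in t9 t10.
have t11 : 2 * L * k.+1%:R^-1 < r ^+ 2 / 4.
  have -> : r ^+ 2 / 4 = 2 * L * (r ^+ 2 / (8 * L)) by field; rewrite gt_eqF.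
  by rewrite ltr_pM2l // mulr_gt0.
have : 0 < r ^+ 2 by rewrite exprn_gt0.
move: t4 t11; rewrite t5 t6; move: (2 * L * _) => z; lra.
Qed.
End Freeness.

(** * The module of an algebra and its weak closedness *)

Section Module.
Variables (R : realType) (H : completeNormedModType R[i]).
Variable ip : {dot H for (@Num.conj R[i])}.
Variable B : bernoulli_shift ip.

Local Notation A := (bs_alg B).
Local Notation Om := (bs_vec B).
Local Notation A0 := (bs_alg0 B).
Local Notation E0 := (bs_exp0 B).
Local Notation e0 := (proj0 B).
Local Notation F := (bs_filt B).
Local Notation S := (bs_shift B).
Local Notation Hip := (shift_hilbert B).
Local Notation vA := (shift_vn B).
Local Notation vA0 := (alg0_vn B).
Local Notation gmN := (gns_module B).

Section Basic.
Variable N : set (H -> H).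
Hypotheses (vN : vn_algebra ip N) (NA : N `<=` A) (A0N : A0 `<=` N).

Lemma gns_moduleP x : gmN N x <-> bounded_op x /\
  forall (us : seq H) (e : R), 0 < e ->
    exists2 a, N a & forall u, u \in us -> hnorm (a (e0 u) - x u) < e.
Proof.
split=> [/strong_closureP|] [bx hx].
  split=> // us e e0p; have [y [a Na <-] hy] := hx us e e0p.
  by exists a.
apply/strong_closureP; split=> // us e e0p; have [a Na ha] := hx us e e0p.
by exists (a \o e0) => //; exists a.
Qed.

Lemma gns_bop x : gmN N x -> bounded_op x.
Proof. by move=> /gns_moduleP[]. Qed.

(** On finitely many vectors the strong closure is reached by a sequence; this is
   where finite types as index sets of tuples are useful. *)
Lemma gns_seq_fin (T : finType) (p : T -> H) x : gmN N x ->
  exists2 a : nat -> H -> H, forall n, N (a n) &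
    forall i, hcvg (fun n => a n (e0 (p i))) (x (p i)).
Proof.
move=> /gns_moduleP[bx hx].
have h n : exists a, N a /\ forall u, u \in [seq p i | i <- enum T] ->
    hnorm (a (e0 u) - x u) < n.+1%:R^-1.
  have [|a Na ha] := hx [seq p i | i <- enum T] n.+1%:R^-1; first by rewrite invr_gt0.
  by exists a.
have [a ha] := choice h; exists a => [n|i e e0p]; first exact: (ha n).1.
have [M hM] := invS_small e0p; exists M => n /hM; apply: lt_trans.
by apply: (ha n).2; rewrite map_f // mem_enum.
Qed.

Lemma gns_proj0 x u : gmN N x -> x (e0 u) = x u.
Proof.
move=> hx.
pose p (b : bool) := if b then u else e0 u.
have [a Na ha] := gns_seq_fin p hx.
have h1 := ha true; have h2 := ha false; rewrite /= in h1 h2.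
apply: (hcvg_unique h2); apply: (hcvg_eq _ h1) => n.
by rewrite proj0_proj.
Qed.

(** Elements of the module vanish on the complement of the space of A0. *)
Lemma gns_eq_on x y : gmN N x -> gmN N y -> (forall u, space0 B u -> x u = y u) -> x = y.
Proof.
move=> hx hy h; apply/funext => u.
by rewrite -(gns_proj0 u hx) -(gns_proj0 u hy) h //; exact: proj0_in.
Qed.

Lemma gns_lin k x y : gmN N x -> gmN N y -> gmN N (k *: x + y).
Proof.
move=> hx hy; apply/gns_moduleP; split.
  by apply: bop_lin; exact: gns_bop.
move=> us e e0p.
have [a Na ha] := gns_seq_fin (fun i : 'I_(size us) => nth 0 us i) hx.
have [b Nb hb] := gns_seq_fin (fun i : 'I_(size us) => nth 0 us i) hy.
have hab i := hcvgD (hcvgZ k (ha i)) (hb i).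
have [M hM] := uniform_N (fun i => hab i _ e0p).
exists (k *: a M + b M); first exact: (vn_linear vN).
move=> u /(nthP 0)[i hi <-]; exact: (hM (Ordinal hi) M (leqnn _)).
Qed.

Lemma gns_zero : gmN N 0.
Proof.
apply/gns_moduleP; split; first exact: bop_zero.
move=> us e e0p; exists 0; first exact: (vn_zero vN).
by move=> u _; rewrite subrr hnorm0.
Qed.

Lemma gns_scale k x : gmN N x -> gmN N (k *: x).
Proof. by move=> hx; have := gns_lin k hx gns_zero; rewrite addr0. Qed.

Lemma gns_add x y : gmN N x -> gmN N y -> gmN N (x + y).
Proof. by move=> hx hy; have := gns_lin 1 hx hy; rewrite scale1r. Qed.

Lemma gns_sub x y : gmN N x -> gmN N y -> gmN N (x - y).
Proof. by move=> hx hy; have := gns_lin (-1) hy hx; rewrite scaleN1r addrC. Qed.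

Lemma gns_sum (T : Type) (r : seq T) (P : pred T) (f : T -> H -> H) :
  (forall i, P i -> gmN N (f i)) -> gmN N (\sum_(i <- r | P i) f i).
Proof.
move=> h; elim/big_ind: _ => //; [exact: gns_zero | exact: gns_add].
Qed.

(** Approximation on finite sets of vectors by elements of the module suffices. *)
Lemma gns_closed x : bounded_op x ->
  (forall (us : seq H) (e : R), 0 < e ->
    exists2 y, gmN N y & forall u, u \in us -> hnorm (y u - x u) < e) -> gmN N x.
Proof.
move=> bx h; apply/gns_moduleP; split=> // us e e0p.
have e2 : 0 < e / 2 by lra.
have [y /gns_moduleP[_ hy] hyx] := h us _ e2.
have [a Na ha] := hy us _ e2; exists a => // u uus.
apply: le_lt_trans (hnorm_triB _ (y u) _) _.
by have := ha u uus; have := hyx u uus; lra.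
Qed.

(** The uniform bound makes the limit bounded; the rest is gns_closed. *)
Lemma gns_seq_closed : seq_closed (gmN N).
Proof.
move=> ws w C hws bws hC hc; apply: gns_closed; first exact: (bop_lim bws hC hc).1.
move=> us e e0p.
have [M hM] := @uniform_N (size us)
  (fun i m => hnorm (ws m (nth 0 us i) - w (nth 0 us i)) < e) (fun i => hc _ _ e0p).
exists (ws M) => // u /(nthP 0)[i hi <-]; exact: (hM (Ordinal hi)).
Qed.

Lemma gns_alg a : N a -> gmN N (a \o e0).
Proof.
move=> Na; apply/gns_moduleP; split.
  by apply: bop_comp; [exact: (vn_bounded vN Na) | exact: proj0_bop].
by move=> us e e0p; exists a => // u _; rewrite subrr hnorm0.
Qed.

(** Left multiplication by a bounded operator of N is strongly continuous. *)
Lemma gns_left a x : N a -> gmN N x -> gmN N (a \o x).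
Proof.
move=> Na hx; have ba := vn_bounded vN Na.
apply: gns_closed; first by apply: bop_comp => //; exact: gns_bop.
move=> us e e0p.
have [c Nc hc] := gns_seq_fin (fun i : 'I_(size us) => nth 0 us i) hx.
have [M hM] := uniform_N (fun i => bop_cvg ba (hc i) e0p).
exists ((a \o c M) \o e0); first by apply: gns_alg; exact: (vn_mul vN).
move=> u /(nthP 0)[i hi <-]; exact: (hM (Ordinal hi) M (leqnn _)).
Qed.

(** For the algebra over J these are the vectors on which elements of algebras
   independent of it act with control. *)
Lemma gns_range x u : gmN N x -> closure [set y Om | y in N] (x u).
Proof.
move=> hx; have [a Na ha] := gns_seq_fin (fun _ : unit => u) hx.
apply: closureH_closed (ha tt) => n.
have /closure_seq[vs Xv hv] : space0 B (e0 u) by exact: proj0_in.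
have ba := vn_bounded vN (Na n).
apply: (seq_closure (v := fun m => a n (vs m))); last exact: bop_cvg.
move=> m; have [b Ab <-] := Xv m; exists (a n \o b) => //.
by apply: (vn_mul vN) => //; exact: A0N.
Qed.

(** Strongly closed subspaces are weakly closed, by the projection theorem in
   finite powers: a residual w that annihilates all tuples of N annihilates the
   tuple of y. *)
Lemma gns_weak y : bounded_op y -> 
  (forall (T : finType) (u w : T -> H),
    (forall a, N a -> \sum_i rip ip (a (e0 (u i))) (w i) = 0) ->
    \sum_i rip ip (y (u i)) (w i) = 0) -> gmN N y.
Proof.
move=> bY h; apply/gns_moduleP; split=> // us e e0p.
pose u (i : 'I_(size us)) := nth 0 us i.
pose K (f : 'I_(size us) -> H) := exists2 a, N a & forall i, f i = a (e0 (u i)).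
have K0 : K (fun=> 0) by exists 0 => //; exact: (vn_zero vN).
have KL (k : R) g1 g2 : K g1 -> K g2 -> K (fun i => k%:C *: g1 i + g2 i).
  move=> [a Na ga] [c Nc hc]; exists (k%:C *: a + c); first exact: (vn_linear vN).
  by move=> i; rewrite ga hc.
have [w [k [Kk hk hw]]] := tuple_projection Hip (fun i => y (u i)) K0 KL.
have s1 : \sum_i rip ip (y (u i)) (w i) = 0.
  by apply: h => a Na; apply: (hw (fun i => a (e0 (u i)))); exists a.
have s2 : \sum_i rip ip (y (u i) - w i) (w i) = 0.
  by apply: (sum_rip_lim Hip hk (fun i => hcvg_cst (w i))) => n; exact: hw.
have s3 : \sum_i rip ip (w i) (w i) = 0.
  transitivity (\sum_i rip ip (y (u i)) (w i) - \sum_i rip ip (y (u i) - w i) (w i)).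
    by rewrite -sumrB; apply: eq_bigr => i _; rewrite ripBl opprB addrC subrK.
  by rewrite s1 s2 subr0.
have w0 i : w i = 0.
  apply: (rip_eq0 Hip (ip := ip)); move/eqP: s3; rewrite psumr_eq0 => [/allP/(_ i)|j _].
    by rewrite mem_index_enum => /(_ isT)/eqP.
  by rewrite -(hnorm_sq Hip) sqr_ge0.
have [M hM] := uniform_N (fun i => hk i _ e0p).
have [a Na ha] := Kk M; exists a => // v /(nthP 0)[i hi <-].
by have := hM (Ordinal hi) M (leqnn _); rewrite ha w0 subr0.
Qed.

Lemma adj_lin k x y v : bounded_op x -> bounded_op y ->
  adj ip (k *: x + y) v = Num.conj k *: adj ip x v + adj ip y v.
Proof.
move=> bx bY; apply: (ip_nondeg Hip) => u.
rewrite -(adjP Hip (bop_lin k bx bY)) fct_linE ipDl ipZl ipDr ipZr conjCK.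
by rewrite !(adjP Hip).
Qed.

(** Strong-star approximation: the tuples made of the values of a and of its
   adjoint form a real subspace, and a pair of residuals orthogonal to it turns,
   after moving the adjoints, into a functional that annihilates N. *)
Lemma gns_strong_star x (us vs : seq H) (e : R) : gmN N x -> 0 < e ->
  exists a, [/\ N a, forall u, u \in us -> hnorm (a (e0 u) - x u) < e &
    forall v, v \in vs -> hnorm (e0 (adj ip a v) - adj ip x v) < e].
Proof.
move=> hx e0p; have bx := gns_bop hx.
pose T := ('I_(size us) + 'I_(size vs))%type.
pose val (a b : H -> H) (t : T) : H :=
  match t with inl i => a (nth 0 us i) | inr j => b (nth 0 vs j) end.
pose K (f : T -> H) := exists2 a, N a & f = val (a \o e0) (e0 \o adj ip a).
have K0 : K (fun=> 0).
  exists 0; first exact: (vn_zero vN); apply/funext => -[i|j] //=.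
  rewrite (_ : adj ip 0 = 0); first by rewrite (bop0 (proj0_bop B)).
  by apply: (adj_unique Hip) => [|u v]; [exact: bop_zero | rewrite ip0l ip0r].
have KL (k : R) g1 g2 : K g1 -> K g2 -> K (fun i => k%:C *: g1 i + g2 i).
  move=> [a Na ->] [c Nc ->]; exists (k%:C *: a + c); first exact: (vn_linear vN).
  have ba := vn_bounded vN Na; have bc := vn_bounded vN Nc.
  apply/funext => -[i|j] //=; rewrite adj_lin // (bopL (proj0_bop B)).
  by congr (_ *: _ + _); apply/eqP; rewrite eq_complex /= oppr0 !eqxx.
have [w [k [Kk hk hw]]] := tuple_projection Hip (val x (adj ip x)) K0 KL.
have s1 : \sum_t rip ip (val x (adj ip x) t) (w t) = 0.
  pose p (t : T) := match t with inl i => nth 0 us i | inr j => w (inr j) end.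
  have [a Na ha] := gns_seq_fin p hx.
  pose q (z : H -> H) (t : T) : H :=
    match t with inl i => z (nth 0 us i) | inr j => z (w (inr j)) end.
  pose r (t : T) : H := match t with inl i => w (inl i) | inr j => nth 0 vs j end.
  have qr (z z' : H -> H) : (forall u v, ip (z u) v = ip u (z' v)) ->
      \sum_t rip ip (val z z' t) (w t) = \sum_t rip ip (q z t) (r t).
    move=> zz; apply: eq_bigr => -[i|j] _ //=.
    by rewrite ripC /rip -zz.
  rewrite (qr _ _ (fun u v => adjP Hip bx u v)).
  apply: (@sum_rip_lim _ _ _ Hip T (fun n => q (a n \o e0)) (fun=> r)) => [[i|j]|t|n].
  - exact: (ha (inl i)).
  - exact: (ha (inr j)).
  - exact: hcvg_cst.
  have ba := vn_bounded vN (Na n).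
  rewrite -(qr _ (e0 \o adj ip (a n))); first by apply: hw; exists (a n).
  by move=> u v /=; rewrite (adjP Hip ba) proj0_sym.
have s2 : \sum_i rip ip (val x (adj ip x) i - w i) (w i) = 0.
  by apply: (sum_rip_lim Hip hk (fun i => hcvg_cst (w i))) => n; exact: hw.
have s3 : \sum_i rip ip (w i) (w i) = 0.
  transitivity (\sum_i rip ip (val x (adj ip x) i) (w i) -
    \sum_i rip ip (val x (adj ip x) i - w i) (w i)).
    by rewrite -sumrB; apply: eq_bigr => i _; rewrite ripBl opprB addrC subrK.
  by rewrite s1 s2 subr0.
have w0 i : w i = 0.
  apply: (rip_eq0 Hip (ip := ip)); move/eqP: s3; rewrite psumr_eq0 => [/allP/(_ i)|j _].
    by rewrite mem_index_enum => /(_ isT)/eqP.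
  by rewrite -(hnorm_sq Hip) sqr_ge0.
have [M1 h1] := uniform_N (fun i : 'I_(size us) => hk (inl i) _ e0p).
have [M2 h2] := uniform_N (fun i : 'I_(size vs) => hk (inr i) _ e0p).
have [a Na ha] := Kk (maxn M1 M2); exists a; split=> // v /(nthP 0)[i hi <-].
  by have := h1 (Ordinal hi) _ (leq_maxl M1 M2); rewrite ha w0 subr0.
by have := h2 (Ordinal hi) _ (leq_maxr M1 M2); rewrite ha w0 subr0.
Qed.

(** Right multiplication by the inner product x^* x, an element of A0 on the
   space of A0.  It maps the module into itself by weak closedness: the
   annihilator of N is tested first with elements of N for x, x and y, for
   which the product stays in N, and then in three limits. *)
Lemma gns_right_sq x y : gmN N x -> gmN N y -> gmN N (y \o (adj ip x \o x)).
Proof.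
move=> hx hy; have bx := gns_bop hx; have bY := gns_bop hy.
have bx' := adj_bop Hip bx.
apply: gns_weak; first by apply: bop_comp => //; exact: bop_comp.
move=> T u w h.
(* a stands for y, b and c for x; on the space of A0 the product b^* c acts as
   its expectation, which belongs to N. *)
have step1 a b c : N a -> N b -> N c ->
    \sum_i rip ip (c (e0 (u i))) (b (e0 (adj ip a (w i)))) = 0.
  move=> Na Nb Nc; have ba := vn_bounded vN Na; have bb := vn_bounded vN Nb.
  have Abc : A (adj ip b \o c).
    by apply: (vn_mul vA); [exact: (vn_adj vA) (NA Nb) | exact: NA].
  have A0E : A0 (E0 (adj ip b \o c)) := exp0_alg Abc.
  have Na' : N (a \o E0 (adj ip b \o c)) by apply: (vn_mul vN) => //; exact: A0N.
  rewrite -[RHS](h _ Na'); apply: eq_bigr => i _ /=.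
  rewrite /rip [in RHS](adjP Hip ba); set z := adj ip a (w i).
  have s1 : space0 B (E0 (adj ip b \o c) (e0 (u i))).
    by apply: space0_alg0 => //; exact: proj0_in.
  rewrite -[in RHS](proj0_id s1) proj0_sym (exp0_ip0 Abc) /=; try exact: proj0_in.
  by rewrite -(adjPl Hip bb).
have step2 a b : N a -> N b -> \sum_i rip ip (x (u i)) (b (e0 (adj ip a (w i)))) = 0.
  move=> Na Nb; have [c Nc hc] := gns_seq_fin u hx.
  apply: (sum_rip_lim Hip hc (fun i => hcvg_cst _)) => n; exact: step1.
have step3 a : N a -> \sum_i rip ip (x (u i)) (x (adj ip a (w i))) = 0.
  move=> Na; have [b Nb hb] := gns_seq_fin (fun i => adj ip a (w i)) hx.
  apply: (sum_rip_lim Hip (fun i => hcvg_cst _) hb) => n; exact: step2.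
have [a Na ha] := gns_seq_fin (fun i => adj ip x (x (u i))) hy.
apply: (sum_rip_lim Hip ha (fun i => hcvg_cst _)) => n.
have ba := vn_bounded vN (Na n).
rewrite -[RHS](step3 _ (Na n)); apply: eq_bigr => i _.
rewrite /rip (adjP Hip ba) proj0_sym -(adjPl Hip bx) (gns_proj0 _ hx) //.
Qed.

(** Z = (1 + g)^-1 is obtained from a Neumann series: 1 + g is (1 + M)(1 - d),
   where M bounds g and d has norm at most M / (1 + M) < 1. *)
Lemma alg0_inverse g : A0 g -> positive_op ip g ->
  exists2 Z, A0 Z & (forall u, Z u + g (Z u) = u) /\ forall u, Z (u + g u) = u.
Proof.
move=> A0g pg; have bg := vn_bounded vA0 A0g; have sg := positive_sym pg.
have [M0 M0p hM0] := bopP bg.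
pose M := M0 + 1; have Mp : 0 < M by rewrite /M; lra.
have Mp1 : 0 < 1 + M by lra.
have gM u : 0 <= rip ip (g u) u <= M * hnorm u ^+ 2.
  apply/andP; split; first exact: (Re_mono (pg.2 u)).
  apply: le_trans (rip_le Hip _ _) _; rewrite expr2 mulrA; apply: ler_wpM2r => //.
  by apply: le_trans (hM0 u) _; apply: ler_wpM2r => //; rewrite /M; lra.
pose d1 : H -> H := M^-1%:C *: (M%:C *: idfun - g).
have d1E u : d1 u = M^-1%:C *: (M%:C *: u - g u) by [].
have A0d1 : A0 d1.
  apply: (vnZ vA0); apply: (vnB vA0) => //.
  by apply: (vnZ vA0); exact: (vn_one vA0).
have bd1 := vn_bounded vA0 A0d1.
have conjR (a : R) : Num.conj (a%:C) = a%:C :> R[i].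
  by apply/eqP; rewrite eq_complex /= oppr0 !eqxx.
have sd1 : sym_op ip d1.
  by move=> u v; rewrite !d1E ipZl ipZr ipBl ipBr ipZl ipZr sg !conjR.
have nd1 : forall u, hnorm (d1 u) <= hnorm u.
  apply: (pos_contraction Hip bd1 sd1) => u; have /andP[h1 h2] := gM u.
  rewrite d1E ripZl ripBl ripZl -(hnorm_sq Hip) ler_pdivrMl //.
  apply/andP; split; last lra.
  by apply: mulr_ge0; [rewrite invr_ge0 ltW | rewrite subr_ge0].
pose r := M / (1 + M).
have r1 : 0 < r < 1.
  by rewrite divr_gt0 //= ltr_pdivrMr // mul1r; lra.
pose d : H -> H := r%:C *: d1.
have dE u : d u = r%:C *: d1 u by [].
have A0d : A0 d by exact: (vnZ vA0).
have bd := vn_bounded vA0 A0d.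
have nd u : hnorm (d u) <= r * hnorm u.
  rewrite dE hnormZ ger0_norm; last by have /andP[/ltW] := r1.
  by apply: ler_wpM2l => //; have /andP[/ltW] := r1.
pose P := fix P n : H -> H := if n is m.+1 then idfun + (d \o P m) else 0.
pose s := fix s n : R := if n is m.+1 then 1 + r * s m else 0.
have A0P n : A0 (P n).
  elim: n => [|n IH] /=; first exact: (vn_zero vA0).
  by apply: (vnD vA0); [exact: (vn_one vA0) | exact: (vn_mul vA0)].
have sS n : s n.+1 = 1 + r * s n by [].
have /andP[r0 r1'] := r1.
have sb n : s n <= (1 - r)^-1.
  elim: n => [|n IH]; first by rewrite /= invr_ge0 subr_ge0 ltW.
  rewrite sS -[leRHS]mul1r ler_pdivlMr ?subr_gt0 //.
  rewrite -[leRHS]mul1r in IH; rewrite ler_pdivlMr ?subr_gt0 // in IH; nra.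
have sinc n : s n <= s n.+1.
  elim: n => [|n IH]; first by rewrite /= mulr0 addr0.
  by rewrite !sS lerD2l; apply: ler_wpM2l => //; exact: ltW.
have bP n := vn_bounded vA0 (A0P n).
have [||t [bt _ tP ht]] := dominated_limit bP sinc sb.
- by move=> u; rewrite mul0r hnorm0.
- elim=> [|n IH] u.
    have -> : P 1%N u - P 0%N u = u.
      by rewrite -[P 1%N u]/(u + d 0) (bop0 bd) addr0 subr0.
    by rewrite /= mulr0 addr0 subr0 mul1r.
  have -> : P n.+2 u - P n.+1 u = d (P n.+1 u - P n u).
    by rewrite (bopB bd) -[LHS]/((u + d (P n.+1 u)) - (u + d (P n u)))
      opprD addrACA subrr add0r.
  have -> : s n.+2 - s n.+1 = r * (s n.+1 - s n).
    by rewrite (sS n.+1) [in X in _ - X](sS n); ring.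
  apply: le_trans (nd _) _; rewrite -[X in _ <= X]mulrA.
  by apply: ler_wpM2l; [exact: ltW | exact: IH].
have tE u : t u = u + d (t u).
  apply: (hcvg_unique (u := fun n => P n.+1 u)).
    by move=> e /(ht u)[N0 hN]; exists N0 => n Nn; apply: hN; exact: leqW.
  by apply: hcvgD; [exact: hcvg_cst | exact: bop_cvg].
have td u : t (d u) = d (t u).
  apply: (hcvg_unique (ht (d u))); apply: (hcvg_eq _ (bop_cvg bd (ht u))) => n.
  elim: n => [|n IH]; first by rewrite /= (bop0 bd).
  by rewrite -[P n.+1 (d u)]/(d u + d (P n (d u))) -IH -(bopD bd).
have A0t : A0 t by apply: (vn_seq_closed vA0) ht; [exact: A0P | exact: bP | exact: tP].
have gd u : u + g u = (1 + M)%:C *: (u - d u).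
  rewrite dE d1E scalerBr !scalerA -!rmorphM.
  have -> : (1 + M) * (r * M^-1) = 1 by rewrite /r; field; rewrite !gt_eqF.
  by rewrite scale1r opprB rmorphD scalerDl scale1r -addrA [_ + (g u - _)]addrCA subrr addr0.
exists ((1 + M)^-1%:C *: t); first exact: (vnZ vA0).
have inv : ((1 + M)^-1%:C * (1 + M)%:C : R[i]) = 1.
  by rewrite -rmorphM mulVf // gt_eqF.
split=> u; rewrite !fct_scaleE.
  rewrite gd (bopZ bd) -scalerBr scalerA mulrC inv scale1r.
  by rewrite {1}tE addrK.
rewrite gd (bopZ bt) scalerA inv scale1r (bopB bt) td.
by rewrite {1}tE addrK.
Qed.
End Basic.
End Module.

(** * Kaplansky density and the product of independent elements *)

Section Product.
Variables (R : realType) (H : completeNormedModType R[i]).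
Variable ip : {dot H for (@Num.conj R[i])}.
Variable B : bernoulli_shift ip.

Local Notation A := (bs_alg B).
Local Notation Om := (bs_vec B).
Local Notation A0 := (bs_alg0 B).
Local Notation E0 := (bs_exp0 B).
Local Notation e0 := (proj0 B).
Local Notation F := (bs_filt B).
Local Notation S := (bs_shift B).
Local Notation Hip := (shift_hilbert B).
Local Notation vA := (shift_vn B).
Local Notation vA0 := (alg0_vn B).
Local Notation gmN := (gns_module B).

Section Kaplansky.
Variable N : set (H -> H).
Hypotheses (vN : vn_algebra ip N) (NA : N `<=` A) (A0N : A0 `<=` N).

(** A bound of a on the vectors of A0 alone, the norm of the module. *)
Definition le0 (K : R) (a : H -> H) :=
  forall v, space0 B v -> hnorm (a v) <= K * hnorm v.

(** With Z = (1 + E0 (a^* a))^-1, the element 2 a Z is the bounded transform of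
   a.  The two inequalities are 2 |a w| <= |w + a^* a w| and the bound of a Z a^*,
   read through expectations. *)
Lemma bounded_transform a : N a -> exists2 Z, A0 Z &
  [/\ forall u, Z u + exp_sq B a (Z u) = u, forall u, Z (u + exp_sq B a u) = u,
     forall v, space0 B v -> 2 * hnorm (a (Z v)) <= hnorm v &
     forall q, hnorm (a (Z (e0 (adj ip a q)))) <= hnorm q].
Proof.
move=> Na; have Aa := NA Na; have ba := alg_bop Aa.
have [Z A0Z [h1 h2]] := alg0_inverse (exp_sq_alg0 Aa) (exp_sq_pos Aa).
exists Z => //; split=> // [v hv|q].
  have s1 : space0 B (Z v) by exact: space0_alg0.
  rewrite -(@ler_pXn2r _ 2) ?nnegrE //; last exact: mulr_ge0.
  rewrite exprMn -[in leRHS](h1 v); set w := Z v in s1 *.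
  rewrite (hnorm_sqD Hip) (hnorm_sq Hip (a w)) /rip -(exp_sq_ip Aa s1 s1).
  rewrite -/(rip ip _ _) ripC.
  have := sqr_ge0 (hnorm (w - exp_sq B a w)); rewrite (hnorm_sqB Hip); lra.
set p := e0 (adj ip a q); have s0 : space0 B p by exact: proj0_in.
have s1 : space0 B (Z p) by exact: space0_alg0.
set w := Z p in s1 *.
have E1 : rip ip (a w) q = rip ip w p.
  by rewrite /rip (adjP Hip ba) -[in LHS](proj0_id s1) proj0_sym.
have E2 : rip ip w p = hnorm w ^+ 2 + hnorm (a w) ^+ 2.
  rewrite -(h1 p) -/w ripDr -(hnorm_sq Hip) (hnorm_sq Hip (a w)) /rip.
  by rewrite -(exp_sq_ip Aa s1 s1) (exp_sq_sym Aa).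
have h3 : hnorm (a w) ^+ 2 <= hnorm (a w) * hnorm q.
  have := rip_le Hip (a w) q; rewrite E1 E2; have := sqr_ge0 (hnorm w); lra.
have [z|z] := eqVneq (hnorm (a w)) 0; first by rewrite z.
by move: h3; rewrite expr2 ler_pM2l // lt_def z hnorm_ge0.
Qed.

(** Kaplansky density for the module, by the inverse of the bounded transform: a
   contraction x equals 2 y (1 + y^* y)^-1 with y in the same module, and if a
   is close to y in the strong-star sense, then 2 a (1 + E0 (a^* a))^-1 is
   close to x and is a contraction whatever the norm of a. *)
Lemma kaplansky1 x (us : seq H) (e : R) : gmN N x ->
  (forall u, hnorm (x u) <= hnorm u) -> (forall u, u \in us -> space0 B u) -> 0 < e ->
  exists a, [/\ N a, le0 1 a & forall u, u \in us -> hnorm (a u - x u) < e].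
Proof.
move=> hx nx hus e0p; have bx := gns_bop hx; have bx' := adj_bop Hip bx.
pose T : H -> H := adj ip x \o x.
have bT : bounded_op T by exact: bop_comp.
have nT u : hnorm (T u) <= hnorm u.
  have n1 v : hnorm (x v) <= 1 * hnorm v by rewrite mul1r.
  by apply: le_trans (nx u); have := adj_le Hip bx n1 (x u); rewrite mul1r.
have sT : sym_op ip T.
  by move=> u v; rewrite /T /= -(adjPl Hip bx) (adjP Hip bx).
have Te u : T (e0 u) = T u by rewrite /T /= (gns_proj0 u hx).
have eT u : e0 (T u) = T u.
  apply: (ip_nondeg Hip) => v; rewrite -proj0_sym -!sT Te //.
(* k = (1 + sqrt (1 - x^* x))^-1. *)
have [k [bk nk ke hP]] := sqrt_iter bT nT.
have [sk kc] := sqrt_iter_props Hip bT sT hP.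
have kT v : k (T v) = T (k v) by apply: kc.
have kk v := sqrt_iter2 ke v.
have rk : forall y, gmN N y -> gmN N (y \o k).
  apply: (hP (fun w => forall y, gmN N y -> gmN N (y \o w))).
  - move=> y hy; have -> : y \o ((fun=> 0) : H -> H) = 0.
      by apply/funext => u; rewrite /= (bop0 (gns_bop hy)).
    exact: (gns_zero B vN).
  - move=> w bw hw y hy.
    have -> : y \o sqrt_step T w = half R *: (y + (((y \o T) \o w) \o w)).
      apply/funext => u; rewrite /sqrt_step /= (bopZ (gns_bop hy)) (bopD (gns_bop hy)).
      by [].
    apply: (gns_scale vN); apply: (gns_add vN) => //.
    by do 2 apply: (hw); exact: gns_right_sq.
  - move=> ws w C hws bws hC hc y hy; have bY := gns_bop hy.
    have [L L0 hL] := bopP bY.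
    apply: (@gns_seq_closed _ _ _ _ _ (fun n => y \o ws n) _ (L * C)) => [n|n|n u|u].
    + exact: hws.
    + exact: bop_comp.
    + by apply: le_trans (hL _) _; rewrite -mulrA; apply: ler_wpM2l.
    + exact: bop_cvg.
(* y = x k and X = (1 + y^* y)^-1. *)
pose y := x \o k.
have hy : gmN N y by exact: rk.
have by_ := gns_bop hy.
have yE u : adj ip y (y u) = k (T (k u)).
  by rewrite (adj_comp Hip bx bk) (adj_fix Hip bk sk).
pose X u := u - half R *: T (k u).
have kX u : k (X u) = half R *: u.
  rewrite /X (bopB bk) (bopZ bk) kT kk !scalerBr scalerDr half2.
  by rewrite opprB addrC subrK.
have yX u : y (X u) = half R *: x u by rewrite /y /= kX (bopZ bx).
have XE u : X u + adj ip y (y (X u)) = u.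
  by rewrite yE kX (bopZ bT) (bopZ bk) kT /X subrK.
have ke0 u : k (e0 u) = e0 (k u).
  by apply: kc; [exact: proj0_bop | move=> v; rewrite eT Te].
have X0 u : space0 B u -> space0 B (X u).
  move=> hu; apply: (subspaceB (space0_subspace B)) => //.
  apply: (subspaceZ _ (space0_subspace B)); rewrite -eT; exact: proj0_in.
have e6 : 0 < e / 6 by lra.
have [a [Na ha1 ha2]] := gns_strong_star vN (map X us) [seq y (X u) | u <- us] hy e6.
have Aa := NA Na; have ba := alg_bop Aa.
have [Z A0Z [h1 h2 h3 h4]] := bounded_transform Na.
have bZ := vn_bounded vA0 A0Z.
exists ((2 : R)%:C *: (a \o Z)); split.
- by apply: (vnZ vN); apply: (vn_mul vN) => //; exact: A0N.
- move=> v hv; rewrite fct_scaleE hnormZ ger0_norm // mul1r; exact: h3.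
move=> u uus; have hu := hus u uus.
pose z := X u; have z0 : space0 B z by exact: X0.
have a1 : hnorm (a z - y z) < e / 6.
  by have := ha1 z (map_f X uus); rewrite proj0_id.
have a2 := ha2 (y z) (map_f (fun v => y (X v)) uus).
have gz : exp_sq B a z = e0 (adj ip a (a z)).
  apply/esym/proj0_unique; first by apply: space0_alg0 => //; exact: exp_sq_alg0.
  move=> b A0b; rewrite ipBr -(adjP Hip ba) -(exp_sq_sym Aa).
  by rewrite exp_sq_ip // ?subrr //; exact: space0_vec.
pose p := adj ip y (y z) - e0 (adj ip a (y z)).
have p0 : space0 B p.
  apply: (subspaceB (space0_subspace B)); last exact: proj0_in.
  rewrite yE -(eT (k z)) ke0; exact: proj0_in.
(* Resolvent identity; b1 and b2 bound its two terms by the strong-star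
   distances between a and y. *)
have E1 : a (Z u) - a z = a (Z p) + a (Z (e0 (adj ip a (y z - a z)))).
  rewrite -[in LHS](XE u) -/z -[X in _ - a X](h2 z) gz -(bopB ba) -(bopB bZ).
  rewrite -(bopD ba) -(bopD bZ); congr (a (Z _)).
  rewrite /p (bopB (adj_bop Hip ba)) (bopB (proj0_bop B)).
  by rewrite addrA subrK opprD addrACA subrr add0r.
have b1 := h3 p p0; have b2 := h4 (y z - a z).
have b3 : hnorm p < e / 6 by rewrite hnormB.
have b4 : hnorm (a (Z u) - y z) < e / 2.
  have := hnorm_triB (a (Z u)) (a z) (y z); rewrite E1.
  have := hnormD (a (Z p)) (a (Z (e0 (adj ip a (y z - a z))))).
  rewrite (hnormB (y z)) in b2; lra.
have -> : ((2 : R)%:C *: (a \o Z)) u - x u = (2 : R)%:C *: (a (Z u) - y z).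
  rewrite scalerBr fct_scaleE /=; congr (_ - _); rewrite yX scalerA.
  have -> : ((2 : R)%:C * half R = 1 :> R[i]).
    by rewrite /half -rmorphM mulfV // pnatr_eq0.
  by rewrite scale1r.
rewrite hnormZ ger0_norm //; lra.
Qed.

Lemma kaplansky x (K : R) (us : seq H) (e : R) : gmN N x -> 0 < K ->
  (forall u, hnorm (x u) <= K * hnorm u) -> (forall u, u \in us -> space0 B u) -> 0 < e ->
  exists a, [/\ N a, le0 K a & forall u, u \in us -> hnorm (a u - x u) < e].
Proof.
move=> hx K0 nx hus e0p.
have Ki : K%:C * K^-1%:C = 1 :> R[i] by rewrite -rmorphM mulfV // gt_eqF.
have [||a [Na la ha]] := @kaplansky1 (K^-1%:C *: x) us (e / K) (gns_scale vN _ hx) _ hus.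
- move=> u; rewrite fct_scaleE hnormZ gtr0_norm ?invr_gt0 // ler_pdivrMl //.
- by rewrite divr_gt0.
exists (K%:C *: a); split; first exact: (vnZ vN).
- move=> v hv; rewrite fct_scaleE hnormZ gtr0_norm // ler_pM2l //.
  by have := la v hv; rewrite mul1r.
move=> u uus; have -> : (K%:C *: a) u - x u = K%:C *: (a u - (K^-1%:C *: x) u).
  by rewrite scalerBr fct_scaleE [in RHS]fct_scaleE scalerA Ki scale1r.
by rewrite hnormZ gtr0_norm // mulrC -ltr_pdivlMr //; exact: ha.
Qed.

(** The bound lets convergence on a total sequence spread to all vectors, so that
   separability turns nets into sequences. *)
Lemma bounded_approx x (K : R) : gmN N x -> 0 < K ->
  (forall u, hnorm (x u) <= K * hnorm u) ->
  exists xs : nat -> H -> H, [/\ forall n, N (xs n), forall n, le0 K (xs n) &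
    forall u, space0 B u -> hcvg (xs^~ u) (x u)].
Proof.
move=> hx K0 nx; have [v hv] := total_sequence B.
have bx := gns_bop hx.
pose vs n := [seq e0 (v k) | k <- iota 0 n].
have h n : exists a, [/\ N a, le0 K a &
    forall u, u \in vs n -> hnorm (a u - x u) < n.+1%:R^-1].
  apply: (kaplansky hx K0 nx); last by rewrite invr_gt0.
  by move=> u /mapP[k _ ->]; exact: proj0_in.
have [xs hxs] := choice h; exists xs; split=> [n|n|]; try by have [] := hxs n.
pose D : set H := [set u | hcvg (fun n => xs n (e0 u)) (x u)].
have bxs n : bounded_op (xs n \o e0).
  apply: bop_comp; last exact: proj0_bop.
  by apply: (vn_bounded vN); have [] := hxs n.
have sD : subspace D.
  split; first by rewrite /D /= (bop0 bx); apply: (hcvg_eq _ (hcvg_cst 0)) => n;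
    have := bop0 (bxs n) => /= ->.
  move=> k u w hu hw; rewrite /D /= (bopL bx).
  apply: (hcvg_eq _ (hcvgD (hcvgZ k hu) hw)) => n.
  by have := bopL (bxs n) k u w => /= ->.
have nxs n u : hnorm (xs n (e0 u)) <= K * hnorm u.
  have [_ hl _] := hxs n; apply: le_trans (hl _ (proj0_in B u)) _.
  by rewrite ler_pM2l //; exact: proj0_le.
have cD : closure D `<=` D.
  move=> u /closureHP hu e e0p.
  have K1 : 0 < e / (4 * K) by rewrite divr_gt0 // mulr_gt0.
  have [w Dw huw] := hu _ K1.
  have [M hM] := Dw (e / 2) (ltac:(lra)); exists M => n /hM h1.
  have t1 := nxs n (u - w); have t2 := nx (w - u); rewrite (bopB bx) in t2.
  have t3 := bopB (bxs n) u w; rewrite /= in t3; rewrite t3 (hnormB u w) in t1.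
  rewrite (hnormB u w) ltr_pdivlMr ?mulr_gt0 // in huw.
  have := hnorm_triB (xs n (e0 u)) (xs n (e0 w)) (x u).
  have := hnorm_triB (xs n (e0 w)) (x w) (x u).
  lra.
have vD k : D (v k).
  move=> e e0p; have [M hM] := invS_small e0p.
  exists (maxn M k.+1) => n; rewrite geq_max => /andP[/hM h1 kn].
  rewrite -(gns_proj0 (v k) hx); apply: lt_trans h1.
  have [_ _] := hxs n; apply; apply/mapP; exists k => //.
  by rewrite mem_iota add0n.
have allD u : D u.
  apply: cD; apply: (dense_of_orth Hip sD) => w hw.
  by apply: hv => k; apply: hw.
move=> u hu; have := allD u; rewrite /D /=.
by apply: hcvg_eq => n; rewrite proj0_id.
Qed.
End Kaplansky.

Lemma stop_cvgP (ws : nat -> H -> H) z : (forall n, bounded_op (ws n)) -> bounded_op z ->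
  stop_cvg B ws z <-> forall u, space0 B u -> hcvg (ws^~ u) (z u).
Proof.
move=> bw bz; split=> h u hu.
  move/cvgrPdist_lt : (h u hu) => h' e /h'[N _ hN]; exists N => n /= Nn.
  have := hN n Nn; rewrite /= (dsnE Hip) ?sub0r ?normrN ?ger0_norm //.
  exact: bop_sub.
apply/cvgrPdist_lt => e e0p; have [N hN] := h u hu e e0p.
exists N => // n /= Nn; rewrite (dsnE Hip) ?sub0r ?normrN ?ger0_norm //; last exact: bop_sub.
exact: hN.
Qed.

Section Prod.
Variables I J L : set R.
Hypotheses (iI : is_interval I) (iJ : is_interval J) (iL : is_interval L).
Hypotheses (IL : I `<=` L) (JL : J `<=` L) (fIJ : free B I J).

(** Bounded sequences over I that converge to x; by uniform boundedness these are
   the sequences which the definition of the product quantifies over. *)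
Definition approximates (x : H -> H) (ws : nat -> H -> H) :=
  [/\ forall n, F I (ws n), exists2 K : R, 0 <= K & forall n, le0 K (ws n) &
   forall u, space0 B u -> hcvg (ws^~ u) (x u)].

Lemma approximates_small (ws : nat -> H -> H) (K : R) u : 0 <= K ->
  (forall n, F I (ws n)) -> (forall n, le0 K (ws n)) ->
  hcvg (fun n => ws n Om) 0 -> filt_space B J u -> hcvg (ws^~ u) 0.
Proof.
move=> K0 Iw lw hw hu e e0p.
have [d d0 hd] := free_small iI fIJ K0 hu e0p.
have [N hN] := hw d d0; exists N => n /hN; rewrite !subr0.
exact: (hd _ (Iw n) (lw n)).
Qed.

(** By free_small, a bounded sequence over I which is Cauchy at Om is Cauchy at
   every vector generated over J. *)
Lemma approximates_cauchy x ws u : approximates x ws -> filt_space B J u ->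
  hcauchy (ws^~ u).
Proof.
move=> [Iw [K K0 lw] hw] hu e e0p; have vI := filt_vn B iI.
have K2 : 0 <= 2 * K by lra.
have [d d0 hd] := free_small iI fIJ K2 hu e0p.
have [N hN] := hcvg_cauchy (hw Om (space0_Om B)) d0.
exists N => m n Nm Nn; apply: (hd (ws m - ws n)).
- exact: (vnB vI).
- move=> v hv; rewrite fct_subE; apply: le_trans (hnormD _ _) _; rewrite hnormN.
  by have := lw m v hv; have := lw n v hv; lra.
- exact: hN.
Qed.

(** The difference of two approximating sequences is small at Om. *)
Lemma approximates_same x ws ws' u z : approximates x ws -> approximates x ws' ->
  filt_space B J u -> hcvg (ws^~ u) z -> hcvg (ws'^~ u) z.
Proof.
move=> [Iw [K K0 lw] hw] [Iw' [K' K0' lw'] hw'] hu hz; have vI := filt_vn B iI.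
have : hcvg (fun n => (ws' n - ws n) u) 0.
  apply: (@approximates_small (fun n => ws' n - ws n) (K + K')) => //.
  - exact: addr_ge0.
  - by move=> n; exact: (vnB vI).
  - move=> n v hv; rewrite fct_subE; apply: le_trans (hnormD _ _) _; rewrite hnormN.
    by have := lw n v hv; have := lw' n v hv; lra.
  have := hcvgB (hw' Om (space0_Om B)) (hw Om (space0_Om B)); rewrite subrr; exact.
move=> h; have := hcvgD h hz; rewrite add0r; apply: hcvg_eq => n.
by rewrite fct_subE subrK.
Qed.

Lemma approximates_ex x (K : R) : gmodI B I x -> 0 < K ->
  (forall u, hnorm (x u) <= K * hnorm u) ->
  exists ws, approximates x ws /\ forall n, le0 K (ws n).
Proof.
move=> hx K0 hK; have vI := filt_vn B iI.
have [ws [h1 h2 h3]] := bounded_approx vI (filt_sub iI) (alg0_filt iI) hx K0 hK.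
by exists ws; split=> //; split=> //; exists K => //; exact: ltW.
Qed.

(** Stop convergent sequences are bounded, by uniform boundedness. *)
Lemma approx_by_approximates x ws : gmodI B I x -> approx_by B (F I) x ws ->
  approximates x ws.
Proof.
move=> hx [Iw hw]; have bx := gns_bop hx.
have bw n : bounded_op (ws n \o e0).
  apply: bop_comp; last exact: proj0_bop.
  exact: (vn_bounded (filt_vn B iI)).
have {}hw := (stop_cvgP bw bx).1 hw.
have hw0 u : hcvg (fun n => ws n (e0 u)) (x u).
  have := hw (e0 u) (proj0_in B u); rewrite (gns_proj0 u hx).
  by apply: hcvg_eq => n /=; rewrite proj0_proj.
split=> //; last first.
  move=> u hu; have := hw0 u; by apply: hcvg_eq => n; rewrite proj0_id.
have [|K K0 hK] := uniform_boundedness bw.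
  move=> u; exact: hcvg_bounded (hw0 u).
exists K => // n v hv; have := hK n v; by rewrite /= proj0_id.
Qed.

Lemma approximates_approx_by x ws : gmodI B I x -> approximates x ws ->
  approx_by B (F I) x ws.
Proof.
move=> hx [Iw _ hw]; split=> //; apply/stop_cvgP => [n||u hu].
- apply: bop_comp; last exact: proj0_bop.
  exact: (vn_bounded (filt_vn B iI)).
- exact: gns_bop hx.
by have := hw u hu; apply: hcvg_eq => n /=; rewrite proj0_id.
Qed.

(** Pointwise limits on all of H, stronger than the stop limits in gmul. *)
Definition is_prod (x y z : H -> H) := forall ws, approximates x ws ->
  forall u, hcvg (fun n => ws n (y u)) (z u).

Lemma is_prod_unique x y z z' : gmodI B I x -> is_prod x y z -> is_prod x y z' -> z = z'.
Proof.
move=> hx hz hz'; have bx := gns_bop hx; have [K K0 hK] := bopP bx.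
have [ws [hw _]] : exists ws, approximates x ws /\ forall n, le0 (K + 1) (ws n).
  apply: approximates_ex => //; first lra.
  move=> u; apply: le_trans (hK u) _; apply: ler_wpM2r => //; lra.
by apply/funext => u; exact: hcvg_unique (hz ws hw u) (hz' ws hw u).
Qed.

Lemma filt_range y u : gmodI B J y -> filt_space B J (y u).
Proof. by move=> hy; exact: (gns_range (filt_vn B iJ) (alg0_filt iJ)). Qed.

(** The norm estimate comes from an approximating sequence with the same bound as
   x, which Kaplansky density provides. *)
Lemma prod_ex x y : gmodI B I x -> gmodI B J y ->
  exists z, [/\ is_prod x y z, gmodI B L z &
    forall K : R, 0 < K -> (forall u, hnorm (x u) <= K * hnorm u) ->
      forall u, hnorm (z u) <= K * hnorm (y u)].
Proof.
move=> hx hy; have bx := gns_bop hx; have bY := gns_bop hy.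
have [K0 K0p hK0] := bopP bx.
have [||ws [hw lw]] := @approximates_ex x (K0 + 1) hx.
- lra.
- by move=> u; apply: le_trans (hK0 u) _; apply: ler_wpM2r => //; lra.
have hc u : hcauchy (fun n => ws n (y u)).
  exact: (approximates_cauchy hw (filt_range hy)).
have [z hz] := choice (fun u => hcauchy_cvg (hc u)).
have pz : is_prod x y z.
  move=> ws' hw' u; exact: (approximates_same hw hw' (filt_range hy) (hz u)).
exists z; split=> //.
  have [L0 L0p hL] := bopP bY; have [Iw _ _] := hw; have vL := filt_vn B iL.
  apply: (@gns_seq_closed _ _ _ _ _ (fun n => ws n \o y) _ ((K0 + 1) * L0)) => [n|n|n u|//].
  - apply: (gns_left vL); first by apply: (bs_filt_mono iI iL IL).
    have /gns_moduleP[_ h] := hy; apply/gns_moduleP; split=> // us e e0p.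
    by have [a Ja ha] := h us e e0p; exists a => //; apply: (bs_filt_mono iJ iL JL).
  - apply: bop_comp => //; exact: (vn_bounded (filt_vn B iI)).
  - apply: le_trans (free_le iI fIJ (Iw n) (filt_range hy) _ (lw n)) _; first lra.
    by rewrite -mulrA; apply: ler_wpM2l => //; lra.
move=> K Kp hK u.
have [ws' [hw' lw']] := approximates_ex hx Kp hK; have [Iw' _ _] := hw'.
apply: (hcvg_le (pz ws' hw' u)) => n.
by apply: (free_le iI fIJ (Iw' n) (filt_range hy) _ (lw' n)); exact: ltW.
Qed.

Lemma gmodI_gmod M x : is_interval M -> gmodI B M x -> gmod B x.
Proof.
move=> iM /gns_moduleP[bx h]; apply/gns_moduleP; split=> // us e e0p.
by have [a Ma ha] := h us e e0p; exists a => //; exact: (filt_sub iM).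
Qed.

(** The limit constructed in prod_ex satisfies the specification under gmul, and
   this specification determines its values on the space of A0. *)
Lemma gmul_spec x y : gmodI B I x -> gmodI B J y ->
  [/\ is_prod x y (gmul B (F I) x y), gmodI B L (gmul B (F I) x y) &
    forall K : R, 0 < K -> (forall u, hnorm (x u) <= K * hnorm u) ->
      forall u, hnorm (gmul B (F I) x y u) <= K * hnorm (y u)].
Proof.
move=> hx hy; have [z [pz Lz nz]] := prod_ex hx hy.
suff -> : gmul B (F I) x y = z by [].
have gz := gmodI_gmod iL Lz; have bz := gns_bop Lz.
have bx := gns_bop hx; have bY := gns_bop hy; have [K0 K0p hK0] := bopP bx.
have [||ws [hw lw]] := @approximates_ex x (K0 + 1) hx.
- lra.
- by move=> u; apply: le_trans (hK0 u) _; apply: ler_wpM2r => //; lra.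
have bwy (vs : nat -> H -> H) : (forall n, F I (vs n)) -> forall n, bounded_op (vs n \o y).
  move=> Iv n; apply: bop_comp => //; exact: (vn_bounded (filt_vn B iI)).
have Pz : [/\ gmod B z, exists xs, approx_by B (F I) x xs &
    forall xs, approx_by B (F I) x xs -> stop_cvg B (fun n => xs n \o y) z].
  split=> //; first by exists ws; exact: approximates_approx_by.
  move=> xs hxs; apply/stop_cvgP => //; first exact: bwy hxs.1.
  by move=> u _; apply: pz; exact: approx_by_approximates.
have [gz' _ hz'] := xgetPex 0 (ex_intro (fun z => [/\ gmod B z,
  exists xs, approx_by B (F I) x xs & forall xs, approx_by B (F I) x xs ->
  stop_cvg B (fun n => xs n \o y) z]) z Pz).
apply: (gns_eq_on gz' gz) => u hu.
have h := hz' ws (approximates_approx_by hx hw); have [Iw _ _] := hw.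
move/stop_cvgP : h => h.
have {}h := h (bwy ws Iw) (gns_bop gz') u hu.
exact: hcvg_unique h (pz ws hw u).
Qed.

(** Between vectors generated over J, each approximant acts as its expectation,
   and these expectations tend to the expectation of x, which is 0. *)
Lemma centred_orth x y y' z : gmodI B I x -> gmodI B J y -> gmodI B J y' ->
  is_prod x y z -> (forall u, e0 (x u) = 0) -> forall u u', ip (z u) (y' u') = 0.
Proof.
move=> hx hy hy' pz cx u u'.
have bx := gns_bop hx; have [K0 K0p hK0] := bopP bx.
have [||ws [hw lw]] := @approximates_ex x (K0 + 1) hx.
- lra.
- by move=> v; apply: le_trans (hK0 v) _; apply: ler_wpM2r => //; lra.
have [Iw _ hwx] := hw; have vI := filt_vn B iI.
have Aw n : A (ws n) := filt_sub iI (Iw n).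
have E0w n v : space0 B v -> E0 (ws n) v = e0 (ws n v).
  move=> hv; apply/esym/proj0_unique.
    by apply: space0_alg0 => //; exact: exp0_alg.
  move=> a A0a; rewrite ipC ipBl (exp0_ip0 (Aw n) hv (space0_vec A0a)).
  by rewrite subrr rmorph0.
(* The expectations lie in A0, hence over I, and tend to 0 at Om. *)
have hE : hcvg (fun n => E0 (ws n) (y u)) 0.
  apply: (@approximates_small (fun n => E0 (ws n)) (K0 + 1)).
  - lra.
  - by move=> n; apply: (alg0_filt iI); exact: exp0_alg.
  - by move=> n v hv; rewrite E0w //; apply: le_trans (proj0_le B _) (lw n v hv).
  - have := bop_cvg (proj0_bop B) (hwx Om (space0_Om B)); rewrite cx.
    by apply: hcvg_eq => n; rewrite E0w //; exact: space0_Om.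
  - exact: filt_range.
rewrite -(ip0l ip (y' u')).
apply: (hcvg_ip_eq2 Hip (pz ws hw u) (hcvg_cst (y' u')) hE (hcvg_cst (y' u'))) => n.
by rewrite (free_ip iI fIJ (Iw n) (filt_range hy) (filt_range hy')).
Qed.
End Prod.
End Product.

(** * Growth and increments of a centred additive cocycle *)

Section Cocycle.
Variables (R : realType) (H : completeNormedModType R[i]).
Variable ip : {dot H for (@Num.conj R[i])}.
Variable B : bernoulli_shift ip.

Local Notation A := (bs_alg B).
Local Notation Om := (bs_vec B).
Local Notation A0 := (bs_alg0 B).
Local Notation E0 := (bs_exp0 B).
Local Notation e0 := (proj0 B).
Local Notation F := (bs_filt B).
Local Notation S := (bs_shift B).
Local Notation Hip := (shift_hilbert B).
Local Notation vA := (shift_vn B).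
Local Notation vA0 := (alg0_vn B).

(** Om is cyclic. *)
Lemma cyclic_seq u : exists2 a : nat -> H -> H, forall n, A (a n) &
  hcvg (fun n => a n Om) u.
Proof.
have : closure [set a Om | a in A] u by rewrite (ps_cyclic (bs_prob B)).
move=> /closure_seq[v Xv hv].
have [a ha] := choice (fun n => let: ex_intro2 a Aa av := Xv n in
  ex_intro (fun a => A a /\ a Om = v n) a (conj Aa av)).
exists a => [n|]; first exact: (ha n).1.
by apply: hcvg_eq hv => n; rewrite (ha n).2.
Qed.

Lemma gns_op_unique T V : bounded_op V -> (forall a, A a -> V (a Om) = T a Om) ->
  gns_op B T = V.
Proof.
move=> bV hV; have [bG hG] := xgetPex 0 (ex_intro (fun V => bounded_op V /\
  forall a, A a -> V (a Om) = T a Om) V (conj bV hV)).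
apply/funext => u; have [a Aa ha] := cyclic_seq u.
apply: (hcvg_unique (bop_cvg bG ha)); apply: (hcvg_eq _ (bop_cvg bV ha)) => n.
by rewrite hV // hG.
Qed.

Lemma gns_ext_exp0 x : gns_ext B E0 x = e0 \o x.
Proof.
rewrite /gns_ext (@gns_op_unique E0 e0) //; first exact: proj0_bop.
by move=> a Aa; rewrite exp0_vec.
Qed.

Lemma shift_isom t a : A a -> hnorm (S t a Om) = hnorm (a Om).
Proof.
move=> Aa; have ASa := shift_alg t Aa; have ba := alg_bop Aa; have bs := alg_bop ASa.
have Aa' := vn_adj vA Aa.
apply/eqP; rewrite -(@eqrXn2 _ 2) //; apply/eqP.
rewrite !(hnorm_sq Hip) /rip (adjPl Hip bs) (adjPl Hip ba).
rewrite -(aut_adj (bs_aut B t) Aa); congr complex.Re.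
have := aut_state (bs_aut B t) (vn_mul vA Aa' Aa).
by rewrite (aut_mul (bs_aut B t) Aa' Aa).
Qed.

Lemma shift_sub t a b : A a -> A b -> S t (a - b) = S t a - S t b.
Proof.
move=> Aa Ab; have := aut_linear (bs_aut B t) (-1) Ab Aa.
by rewrite scaleN1r addrC => ->; rewrite scaleN1r addrC.
Qed.

(** The shift preserves the state, so a Om |-> S t a Om is isometric and extends
   by continuity. *)
Lemma shift_unitary t : exists V : H -> H, [/\ bounded_op V,
  forall a, A a -> V (a Om) = S t a Om & forall u, hnorm (V u) = hnorm u].
Proof.
pose lim u v := forall a : nat -> H -> H, (forall n, A (a n)) ->
  hcvg (fun n => a n Om) u -> hcvg (fun n => S t (a n) Om) v.
have ex u : exists v, lim u v.
  have [a Aa ha] := cyclic_seq u.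
  have [|v hv] := @hcauchy_cvg _ _ (fun n => S t (a n) Om).
    move=> e e0p; have [N hN] := hcvg_cauchy ha e0p.
    exists N => m n Nm Nn; rewrite -fct_subE -shift_sub // shift_isom; last exact: (vnB vA).
    exact: hN.
  exists v => b Ab hb.
  have h0 : hcvg (fun n => S t (b n) Om - S t (a n) Om) 0.
    have := hcvgB hb ha; rewrite subrr; apply: (hcvg_lip (K := 1)) => n.
    rewrite !subr0 mul1r -fct_subE -shift_sub // shift_isom //; exact: (vnB vA).
  have := hcvgD h0 hv; rewrite add0r; apply: hcvg_eq => n; by rewrite subrK.
have [V hV] := choice ex.
have Viso u : hnorm (V u) = hnorm u.
  have [a Aa ha] := cyclic_seq u.
  have h1 := hV u a Aa ha.
  apply/eqP; rewrite -(@eqrXn2 _ 2) //; apply/eqP.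
  rewrite !(hnorm_sq Hip); congr complex.Re.
  apply/eqP; rewrite eq_le; apply/andP.
  have E n : rip ip (S t (a n) Om) (S t (a n) Om) = rip ip (a n Om) (a n Om).
    by rewrite -!(hnorm_sq Hip) shift_isom.
  have E2 : rip ip (V u) (V u) = rip ip u u.
    apply/eqP; rewrite eq_le; apply/andP; split.
      by apply: (hcvg_rip_le2 Hip h1 h1 ha ha) => n; rewrite E.
    by apply: (hcvg_rip_le2 Hip ha ha h1 h1) => n; rewrite E.
  by rewrite (ip_self Hip) (ip_self Hip) -!(hnorm_sq Hip) in E2 *; rewrite E2.
have VaOm a : A a -> V (a Om) = S t a Om.
  move=> Aa; have h := hV (a Om) (fun=> a) (fun=> Aa) (hcvg_cst _).
  exact: hcvg_unique h (hcvg_cst _).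
exists V; split=> //; apply: (@bop_intro _ _ _ 1) => [k u v|u]; last by rewrite Viso mul1r.
have [a Aa ha] := cyclic_seq u; have [b Ab hb] := cyclic_seq v.
have Aab n : A (k *: a n + b n) by exact: (vn_linear vA).
have h1 := hV (k *: u + v) _ Aab (hcvgD (hcvgZ k ha) hb).
apply: (hcvg_unique h1).
apply: (hcvg_eq _ (hcvgD (hcvgZ k (hV u a Aa ha)) (hV v b Ab hb))) => n.
by rewrite (aut_linear (bs_aut B t)).
Qed.

Section Shifted.
Variable t : R.

Lemma shift_op : exists V : H -> H, [/\ bounded_op V,
  forall a, A a -> V (a Om) = S t a Om, forall u, hnorm (V u) = hnorm u &
  forall x, gns_ext B (S t) x = V \o x].
Proof.
have [V [bV hV iV]] := shift_unitary t; exists V; split=> // x.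
by rewrite /gns_ext (@gns_op_unique (S t) V).
Qed.

(** On the space of A0 the operator of S t intertwines a and S t a, since S t
   fixes A0. *)
Lemma gns_ext_shift I x : is_interval I -> gmodI B I x ->
  gmodI B [set s + t | s in I] (gns_ext B (S t) x).
Proof.
move=> iI hx; have [V [bV hV iV ->]] := shift_op.
apply/gns_moduleP; split; first by apply: bop_comp => //; exact: gns_bop hx.
have /gns_moduleP[_ h] := hx.
move=> us e e0p; have [a Ia ha] := h us e e0p.
exists (S t a); first by rewrite -(bs_covariant B t iI); exists a.
move=> u /ha; have Aa := filt_sub iI Ia.
suff -> : S t a (e0 u) = V (a (e0 u)) by rewrite /= -(bopB bV) iV.
have : space0 B (e0 u) by exact: proj0_in.
move=> /closure_seq[v Xv hv].
have b1 := alg_bop (shift_alg t Aa); have b2 := alg_bop Aa.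
apply: (hcvg_unique (bop_cvg b1 hv)).
apply: (hcvg_eq _ (bop_cvg bV (bop_cvg b2 hv))) => n.
have [b A0b <-] := Xv n; have Ab := alg0_sub A0b.
rewrite -[a (b Om)]/((a \o b) Om) hV; last exact: (vn_mul vA).
by rewrite (aut_mul (bs_aut B t)) //= (shift_fix t A0b).
Qed.
End Shifted.

Lemma gmodI_mono I J x : is_interval I -> is_interval J -> I `<=` J ->
  gmodI B I x -> gmodI B J x.
Proof.
move=> iI iJ IJ /gns_moduleP[bx h]; apply/gns_moduleP; split=> // us e e0p.
by have [a Ia ha] := h us e e0p; exists a => //; apply: (bs_filt_mono iI iJ IJ).
Qed.

Lemma itv_cc (a b : R) : is_interval `[a, b].
Proof. exact: interval_is_interval. Qed.

Lemma itv_oc (a : R) : is_interval `]-oo, a].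
Proof. exact: interval_is_interval. Qed.

Arguments itv_cc : clear implicits.
Arguments itv_oc : clear implicits.

(** The two intervals share only the point s. *)
Lemma free_past (s t : R) : free B `[s, t] `]-oo, s].
Proof.
apply: free_touching; [exact: itv_cc | exact: itv_oc | move=> r r0].
apply/seteqP; split=> // z [[y /=]]; rewrite in_itv /= => /andP[h1 h2] <-.
rewrite /= in_itv /=; lra.
Qed.

Lemma free_local (s t : R) : free B `[s, t] `[0, s].
Proof.
apply: free_touching; [exact: itv_cc | exact: itv_cc | move=> r r0].
apply/seteqP; split=> // z [[y /=]]; rewrite in_itv /= => /andP[h1 h2] <-.
rewrite /= in_itv /= => /andP[h3 h4]; lra.
Qed.

Arguments free_past : clear implicits.
Arguments free_local : clear implicits.

Variable c : R -> H -> H.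
Hypotheses (Hc : additive_cocycle B c) (Hcentred : centred B c).

Lemma cocycle_bop t : 0 <= t -> bounded_op (c t).
Proof. by move=> t0; exact: gns_bop (ac_local Hc t0). Qed.

(** The cocycle identity at (0, 0); the operator of S 0 is isometric. *)
Lemma cocycle_zero : c 0 = 0.
Proof.
have [V [bV hV iV VE]] := shift_op 0.
have := ac_cocycle Hc (lexx 0) (lexx 0); rewrite addr0 VE => h.
apply/funext => u; have := congr1 (@^~ u) h; rewrite fct_addE /=.
rewrite -[X in X = _]addr0 => /addrI /esym hu; apply: hnorm_eq0.
by rewrite -iV hu hnorm0.
Qed.

(** The cocycle identity: increments are shifts of the cocycle. *)
Lemma incrE s t : 0 <= s -> s <= t -> c t - c s = gns_ext B (S s) (c (t - s)).
Proof.
move=> s0 st; have ts : 0 <= t - s by lra.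
have := ac_cocycle Hc ts s0; rewrite (addrC s) subrK => ->.
by rewrite addrC addKr.
Qed.

Lemma incr_mod s t : 0 <= s -> s <= t -> gmodI B `[s, t] (c t - c s).
Proof.
move=> s0 st; rewrite incrE //; have ts : 0 <= t - s by lra.
have h := gns_ext_shift s (itv_cc 0 (t - s)) (ac_local Hc ts).
have E : [set x + s | x in `[0, t - s]%classic] = `[s, t]%classic.
  apply/seteqP; split=> z /=.
    move=> [y]; rewrite in_itv /= => /andP[h1 h2] <-.
    by rewrite in_itv /=; apply/andP; split; lra.
  rewrite in_itv /= => /andP[h1 h2]; exists (z - s); last by rewrite subrK.
  by rewrite in_itv /=; apply/andP; split; lra.
by rewrite E in h.
Qed.

Lemma incr_centred s t u : 0 <= s -> s <= t -> e0 ((c t - c s) u) = 0.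
Proof.
move=> s0 st; have t0 : 0 <= t by lra.
rewrite fct_subE (bopB (proj0_bop B)).
have h r : 0 <= r -> e0 (c r u) = 0.
  by move=> r0; have := Hcentred r0; rewrite gns_ext_exp0 => /(congr1 (@^~ u)).
by rewrite !h // subrr.
Qed.

Lemma incr_norm s t u : 0 <= s -> s <= t -> hnorm ((c t - c s) u) = hnorm (c (t - s) u).
Proof.
move=> s0 st; rewrite incrE //; have [V [_ _ iV ->]] := shift_op s.
exact: iV.
Qed.

Lemma proj0_mod I : is_interval I -> gmodI B I e0.
Proof.
move=> iI; have := gns_alg B (filt_vn B iI) (vn_one (filt_vn B iI)); exact.
Qed.

Lemma past_local (s t : R) x : s <= t -> gmodI B `[0, s] x -> gmodI B `]-oo, t] x.
Proof.
move=> st; apply: gmodI_mono; [exact: itv_cc|exact: itv_oc|].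
by move=> y /=; rewrite !in_itv /= => /andP[_ h]; lra.
Qed.

Lemma past_mono (s t : R) x : s <= t -> gmodI B `]-oo, s] x -> gmodI B `]-oo, t] x.
Proof.
move=> st; apply: gmodI_mono; [exact: itv_oc|exact: itv_oc|].
by move=> y /=; rewrite !in_itv /= => h; lra.
Qed.

(** Pythagoras: the increment over [s, s + t] is centred and independent of the
   past, hence orthogonal to c s u, and it has the same length as c t u. *)
Lemma cocycle_sq s t u : 0 <= s -> 0 <= t ->
  hnorm (c (s + t) u) ^+ 2 = hnorm (c s u) ^+ 2 + hnorm (c t u) ^+ 2.
Proof.
move=> s0 t0; have st : s <= s + t by lra.
have h1 := incr_mod s0 st.
(* The increment as its own product with the unit of the module. *)
have pz : is_prod B `[s, s + t] (c (s + t) - c s) e0 (c (s + t) - c s).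
  move=> ws [_ _ hw] v; have := hw _ (proj0_in B v).
  by rewrite (gns_proj0 v h1).
have orth := centred_orth (itv_cc s (s + t)) (itv_oc s) (free_past s (s + t))
  h1 (proj0_mod (itv_oc s)) (past_local (lexx s) (ac_local Hc s0)) pz
  (fun v => incr_centred v s0 st) u u.
have -> : c (s + t) u = (c (s + t) - c s) u + c s u by rewrite fct_subE subrK.
rewrite (hnorm_sqD Hip) incr_norm // (_ : s + t - s = t); last first.
  by rewrite addrAC subrr add0r.
by rewrite {1}/rip orth /= mulr0 addr0 addrC.
Qed.

(** A nonnegative additive function of time is monotone, hence linear; comparison
   with multiples of 1 / n gives the estimate. *)
Lemma cocycle_growth t u : 0 <= t -> hnorm (c t u) ^+ 2 <= t * hnorm (c 1 u) ^+ 2.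
Proof.
move=> t0; pose q r := hnorm (c r u) ^+ 2.
have q0 r : 0 <= q r by exact: sqr_ge0.
have qD r s : 0 <= r -> 0 <= s -> q (r + s) = q r + q s by exact: cocycle_sq.
have qM n r : 0 <= r -> q (n%:R * r) = n%:R * q r.
  move=> r0; elim: n => [|n IH]; first by rewrite !mul0r /q cocycle_zero hnorm0 expr0n.
  by rewrite -addn1 natrD !mulrDl !mul1r qD ?IH // mulr_ge0.
have qmono r s : 0 <= r -> r <= s -> q r <= q s.
  move=> r0 rs; have -> : s = r + (s - r) by rewrite addrC subrK.
  by rewrite qD ?subr_ge0 // lerDl.
have key n : q t <= (t + n.+1%:R^-1) * q 1.
  have n0 : 0 < n.+1%:R :> R by [].
  have n0' : 0 <= n.+1%:R^-1 :> R by rewrite invr_ge0.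
  pose m := (Num.truncn (n.+1%:R * t)).+1.
  have m1 : n.+1%:R * t < m%:R by exact: truncnS_gt.
  have m2 : m%:R <= n.+1%:R * t + 1.
    by rewrite /m -addn1 natrD lerD2r; rewrite truncn_le mulr_ge0.
  have qn : q 1 = n.+1%:R * q n.+1%:R^-1 by rewrite -qM // mulfV // gt_eqF.
  have h1 : q t <= q (m%:R * n.+1%:R^-1).
    by apply: qmono => //; rewrite ler_pdivlMr // mulrC ltW.
  rewrite qM // in h1; apply: le_trans h1 _.
  have -> : q n.+1%:R^-1 = n.+1%:R^-1 * q 1 by rewrite qn mulKf // gt_eqF.
  rewrite mulrA; apply: ler_wpM2r => //; rewrite ler_pdivrMr // mulrDl mulVf ?gt_eqF //.
  by rewrite mulrC.
apply/ler_addgt0Pr => e e0p.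
have q1 : 0 < q 1 + 1 by have := q0 1; lra.
have [n /(_ n (leqnn _))] := invS_small (divr_gt0 e0p q1).
have := key n; rewrite -/(q t) -/(q 1); move: (n.+1%:R^-1) => z.
rewrite ltr_pdivlMr // => h1 h2; have := q0 1.
have [z0|z0] := leP 0 z; first by nra.
by nra.
Qed.

(** The square root of time is the modulus of continuity of the cocycle in norm. *)
Lemma cocycle_bound : exists2 K : R, 0 < K & forall s t u, 0 <= s -> s <= t ->
  hnorm ((c t - c s) u) <= Num.sqrt (t - s) * K * hnorm u.
Proof.
have [K K0 hK] := bopP (cocycle_bop ler01).
exists (K + 1); first lra.
move=> s t u s0 st; rewrite incr_norm //; have ts : 0 <= t - s by lra.
rewrite -(@ler_pXn2r _ 2) ?nnegrE //; last by rewrite !mulr_ge0 // ?sqrtr_ge0 //; lra.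
apply: le_trans (cocycle_growth u ts) _; rewrite !exprMn sqr_sqrtr // -mulrA.
apply: ler_wpM2l => //; rewrite -exprMn ler_pXn2r ?nnegrE //; last by rewrite mulr_ge0 //; lra.
by apply: le_trans (hK u) _; apply: ler_wpM2r => //; lra.
Qed.

(** The term of an Ito sum on [s, t] with integrand y at time s. *)
Definition dc (s t : R) (y : H -> H) : H -> H := gmul B (F `[s, t]) (c t - c s) y.

Lemma incl_cc_oc (s t : R) : `[s, t]%classic `<=` `]-oo, t]%classic.
Proof. by move=> z /=; rewrite !in_itv /= => /andP[]. Qed.

Lemma dc_local (s t : R) y : 0 <= s -> s <= t -> gmodI B `[0, s] y -> gmodI B `[0, t] (dc s t y).
Proof.
move=> s0 st hy.
have I1 : `[s, t]%classic `<=` `[0, t]%classic.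
  by move=> z /=; rewrite !in_itv /= => /andP[h1 h2]; apply/andP; split; lra.
have I2 : `[0, s]%classic `<=` `[0, t]%classic.
  by move=> z /=; rewrite !in_itv /= => /andP[h1 h2]; apply/andP; split; lra.
by have [] := gmul_spec (itv_cc s t) (itv_cc 0 s) (itv_cc 0 t) I1 I2 (free_local s t)
  (incr_mod s0 st) hy.
Qed.

Lemma dc_spec (s t : R) y : 0 <= s -> s <= t -> gmodI B `]-oo, s] y ->
  [/\ is_prod B `[s, t] (c t - c s) y (dc s t y), gmodI B `]-oo, t] (dc s t y) &
    forall K : R, 0 < K -> (forall u, hnorm ((c t - c s) u) <= K * hnorm u) ->
      forall u, hnorm (dc s t y u) <= K * hnorm (y u)].
Proof.
move=> s0 st hy.
have I2 : `]-oo, s]%classic `<=` `]-oo, t]%classic.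
  by move=> z /=; rewrite !in_itv /= => h1; lra.
exact: (gmul_spec (itv_cc s t) (itv_oc s) (itv_oc t) (@incl_cc_oc s t) I2 (free_past s t)
  (incr_mod s0 st) hy).
Qed.

Lemma dc_past (s t : R) y : 0 <= s -> s <= t -> gmodI B `]-oo, s] y ->
  gmodI B `]-oo, t] (dc s t y).
Proof. by move=> s0 st hy; have [] := dc_spec s0 st hy. Qed.

Lemma dc_prod (s t : R) y : 0 <= s -> s <= t -> gmodI B `]-oo, s] y ->
  is_prod B `[s, t] (c t - c s) y (dc s t y).
Proof. by move=> s0 st hy; have [] := dc_spec s0 st hy. Qed.

(** The case of centred_orth for the past of s. *)
Lemma dc_orth (s t : R) y y' u u' : 0 <= s -> s <= t -> gmodI B `]-oo, s] y ->
  gmodI B `]-oo, s] y' -> ip (dc s t y u) (y' u') = 0.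
Proof.
move=> s0 st hy hy'; apply: (centred_orth (itv_cc s t) (itv_oc s) (free_past s t)
  (incr_mod s0 st) hy hy' (dc_prod s0 st hy)) => v; exact: incr_centred.
Qed.

(** The norm estimate of the product takes positive bounds of the increment; when
   s = t the bound sqrt (t - s) K is 0, and arbitrarily small ones replace it. *)
Lemma dc_bound (s t : R) y K : 0 <= s -> s <= t -> gmodI B `]-oo, s] y -> 0 < K ->
  (forall r r' u, 0 <= r -> r <= r' ->
    hnorm ((c r' - c r) u) <= Num.sqrt (r' - r) * K * hnorm u) ->
  forall u, hnorm (dc s t y u) ^+ 2 <= K ^+ 2 * ((t - s) * hnorm (y u) ^+ 2).
Proof.
move=> s0 st hy K0 hK u; have [_ _ h] := dc_spec s0 st hy.
have ts : 0 <= t - s by lra.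
have [e|e] := eqVneq s t.
  have z v : hnorm ((c t - c s) v) = 0 by rewrite e subrr hnorm0.
  have hz e' : 0 < e' -> hnorm (dc s t y u) <= e' * hnorm (y u).
    move=> e'0; apply: h => // v; rewrite z mulr_ge0 // ltW //.
  suff -> : dc s t y u = 0.
    rewrite hnorm0 expr0n /=; apply: mulr_ge0; first exact: sqr_ge0.
    by apply: mulr_ge0 => //; exact: sqr_ge0.
  apply: hnorm_le_eps => d d0.
  have p1 : 0 < hnorm (y u) + 1 by have := hnorm_ge0 (y u); lra.
  apply: le_trans (hz (d / (hnorm (y u) + 1)) (divr_gt0 d0 p1)) _.
  by rewrite mulrAC ler_pdivrMr // ler_pM2l //; lra.
have tsp : 0 < t - s by rewrite lt_def ts andbT subr_eq0 eq_sym.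
have Kp : 0 < Num.sqrt (t - s) * K by rewrite mulr_gt0 // sqrtr_gt0.
have := h _ Kp (fun v => hK s t v s0 st) u.
rewrite -(@ler_pXn2r _ 2) ?nnegrE //; last by rewrite mulr_ge0 // ltW.
move=> h2; apply: le_trans h2 _; rewrite !exprMn sqr_sqrtr //.
by rewrite le_eqVlt; apply/orP; left; apply/eqP; ring.
Qed.

(** Both sides are products of the increment with y - y'. *)
Lemma dc_sub (s t : R) y y' : 0 <= s -> s <= t -> gmodI B `]-oo, s] y ->
  gmodI B `]-oo, s] y' -> dc s t (y - y') = dc s t y - dc s t y'.
Proof.
move=> s0 st hy hy'; have iI := itv_cc s t.
have hyy' : gmodI B `]-oo, s] (y - y') by exact: (gns_sub (filt_vn B (itv_oc s))).
have I2 : `]-oo, s]%classic `<=` `]-oo, t]%classic.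
  by move=> z /=; rewrite !in_itv /= => h1; lra.
have spec w : gmodI B `]-oo, s] w -> is_prod B `[s, t] (c t - c s) w (dc s t w).
  by move=> hw; have [] := gmul_spec iI (itv_oc s) (itv_oc t) (@incl_cc_oc s t) I2
    (free_past s t) (incr_mod s0 st) hw.
apply: (is_prod_unique iI (incr_mod s0 st) (spec _ hyy')) => ws hw u.
have [Iw _ _] := hw.
apply: (hcvg_eq _ (hcvgB (spec _ hy ws hw u) (spec _ hy' ws hw u))) => n.
by rewrite -(bopB (vn_bounded (filt_vn B iI) (Iw n))).
Qed.

Lemma approximates_mono I J x ws : is_interval I -> is_interval J -> I `<=` J ->
  approximates B I x ws -> approximates B J x ws.
Proof.
by move=> iI iJ IJ [h1 h2 h3]; split=> // n; apply: (bs_filt_mono iI iJ IJ).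
Qed.

Lemma approximates_add I x x' ws ws' : is_interval I -> approximates B I x ws ->
  approximates B I x' ws' -> approximates B I (x + x') (fun n => ws n + ws' n).
Proof.
move=> iI [h1 [K K0 h2] h3] [h1' [K' K0' h2'] h3']; split.
- by move=> n; apply: (vnD (filt_vn B iI)).
- exists (K + K'); first exact: addr_ge0.
  move=> n v hv; rewrite fct_addE; apply: le_trans (hnormD _ _) _; rewrite mulrDl.
  by apply: lerD; [exact: h2 | exact: h2'].
- by move=> u hu; apply: hcvgD; [exact: h3 | exact: h3'].
Qed.

Lemma approx_exists I x : is_interval I -> gmodI B I x -> exists ws, approximates B I x ws.
Proof.
move=> iI hx; have [K K0 hK] := bopP (gns_bop hx).
have [||ws [hw _]] := @approximates_ex _ _ _ B I iI x (K + 1) hx.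
- lra.
- by move=> u; apply: le_trans (hK u) _; apply: ler_wpM2r => //; lra.
by exists ws.
Qed.

(** The product of a sum is computed along the sum of approximating sequences over
   the two halves of the interval. *)
Lemma dc_add s r t y : 0 <= s -> s <= r -> r <= t -> gmodI B `]-oo, s] y ->
  dc s t y = dc s r y + dc r t y.
Proof.
move=> s0 sr rt hy; have st : s <= t by lra. have r0 : 0 <= r by lra.
have hyr := past_mono sr hy.
have [w1 h1] := approx_exists (itv_cc s r) (incr_mod s0 sr).
have [w2 h2] := approx_exists (itv_cc r t) (incr_mod r0 rt).
have I1 : `[s, r]%classic `<=` `[s, t]%classic.
  by move=> z /=; rewrite !in_itv /= => /andP[? ?]; apply/andP; split; lra.
have I2 : `[r, t]%classic `<=` `[s, t]%classic.
  by move=> z /=; rewrite !in_itv /= => /andP[? ?]; apply/andP; split; lra.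
have h := approximates_add (itv_cc s t)
  (approximates_mono (itv_cc s r) (itv_cc s t) I1 h1)
  (approximates_mono (itv_cc r t) (itv_cc s t) I2 h2).
have e : (c r - c s) + (c t - c r) = c t - c s by rewrite addrC addrA subrK.
rewrite e in h; apply/funext => u.
apply: (hcvg_unique (dc_prod s0 st hy h u)).
exact: (hcvgD (dc_prod s0 sr hy h1 u) (dc_prod r0 rt hyr h2 u)).
Qed.
End Cocycle.

Arguments itv_cc {R} a b.
Arguments itv_oc {R} a.

(** * Partitions and weighted sums *)

Section Partitions.
Variable R : realType.
Implicit Types (s t a b d : R) (p q : seq R).

(** The recursion on p fits the induction by which all sums over partitions are
   treated; mesh_ltE relates it to the form by indices. *)
Fixpoint mesh t0 p d : Prop :=
  if p is m :: p' then m - t0 < d /\ mesh m p' d else True.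

Lemma mesh_ltE t0 p d : mesh_lt t0 p d <-> mesh t0 p d.
Proof.
elim: p t0 => [|m p IH] t0 /=; first by split.
split=> [h|[h1 /IH h2]].
  split; first exact: (h 0%N).
  by apply/IH => i hi; exact: (h i.+1).
by case=> [_|i hi] //=; exact: h2.
Qed.

(** The left Riemann sum of a scalar function. *)
Fixpoint wsum (g : R -> R) t0 p : R :=
  if p is m :: p' then (m - t0) * g t0 + wsum g m p' else 0.

Lemma path_le_last t0 p : path <%R t0 p -> t0 <= last t0 p.
Proof.
elim: p t0 => [|m p IH] t0 //= /andP[h1 /IH]; apply: le_trans; exact: ltW.
Qed.

Lemma wsum_le (g h : R -> R) t0 p : path <%R t0 p ->
  (forall s, t0 <= s -> s < last t0 p -> g s <= h s) -> wsum g t0 p <= wsum h t0 p.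
Proof.
elim: p t0 => [|m p IH] t0 //= /andP[h1 hp] hgh.
have ml := path_le_last hp.
apply: lerD.
  by apply: ler_wpM2l; [lra | apply: hgh => //; lra].
by apply: IH => // s hs; apply: hgh; lra.
Qed.

Lemma wsum_cst (c : R) t0 p : wsum (fun=> c) t0 p = (last t0 p - t0) * c.
Proof. by elim: p t0 => [|m p IH] t0 /=; rewrite ?IH; ring. Qed.

(** The left sum of an increasing exponential is below its integral. *)
Lemma wsum_exp (l M : R) a t0 p : 0 < l -> 0 <= M -> path <%R t0 p ->
  wsum (fun s => M * expR (l * (s - a))) t0 p <=
  M * (expR (l * (last t0 p - a)) - expR (l * (t0 - a))) / l.
Proof.
move=> l0 M0; elim: p t0 => [|m p IH] t0 /=.
  by move=> _; rewrite subrr mulr0 mul0r.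
move=> /andP[h1 /IH h2].
have e1 : l * (m - t0) * expR (l * (t0 - a)) <= expR (l * (m - a)) - expR (l * (t0 - a)).
  have -> : l * (m - a) = l * (m - t0) + l * (t0 - a) by ring.
  rewrite expRD; have := expR_ge1Dx (l * (m - t0)).
  have := expR_gt0 (l * (t0 - a)); move: (expR (l * (t0 - a))) (expR _) => x y; nra.
have e2 : (m - t0) * (M * expR (l * (t0 - a))) <=
    M * (expR (l * (m - a)) - expR (l * (t0 - a))) / l.
  rewrite ler_pdivlMr //; apply: le_trans (ler_wpM2l M0 e1).
  by rewrite le_eqVlt; apply/orP; left; apply/eqP; ring.
apply: le_trans (lerD e2 h2) _.
by rewrite le_eqVlt; apply/orP; left; apply/eqP; ring.
Qed.

Lemma path_min t0 p : path <%R t0 p -> forall s, s \in p -> t0 < s.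
Proof.
move=> h s sp; have := order_path_min lt_trans h.
by move=> /allP/(_ _ sp).
Qed.

Lemma path_last_max t0 p : path <%R t0 p -> forall s, s \in p -> s <= last t0 p.
Proof.
elim: p t0 => [|m p IH] t0 //= /andP[h1 hp] s; rewrite inE => /predU1P[->|].
  exact: path_le_last.
exact: IH.
Qed.

Lemma path_mem_last t0 p : path <%R t0 p -> t0 < last t0 p -> last t0 p \in p.
Proof. by case: p => [|m p] /= _; [rewrite ltxx | rewrite mem_last]. Qed.

(** Sort the union of the partition points. *)
Lemma common_refinement t0 p q : path <%R t0 p -> path <%R t0 q ->
  last t0 p = last t0 q -> exists r, [/\ path <%R t0 r, last t0 r = last t0 p,
    {subset p <= r} & {subset q <= r}].
Proof.
move=> hp hq hl; pose r := sort <=%R (undup (p ++ q)).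
have memr s : (s \in r) = (s \in p) || (s \in q) by rewrite mem_sort mem_undup mem_cat.
have rmin s : s \in r -> t0 < s.
  by rewrite memr => /orP[/(path_min hp)|/(path_min hq)].
have pr : path <%R t0 r.
  rewrite path_min_sorted; last by apply/allP.
  by rewrite sort_lt_sorted undup_uniq.
exists r; split=> //; last first.
- by move=> s sq; rewrite memr sq orbT.
- by move=> s sp; rewrite memr sp.
apply/eqP; rewrite eq_le; apply/andP; split.
  have [lr|lr] := leP (last t0 r) t0; first exact: le_trans lr (path_le_last hp).
  have := path_mem_last pr lr; rewrite memr => /orP[]; first exact: path_last_max.
  by rewrite hl; exact: path_last_max.
have [lp|lp] := leP (last t0 p) t0; first exact: le_trans lp (path_le_last pr).
by apply: path_last_max => //; rewrite memr (path_mem_last hp lp).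
Qed.

Lemma mesh_cat t0 p q d : mesh t0 p d -> mesh (last t0 p) q d -> mesh t0 (p ++ q) d.
Proof. by elim: p t0 => [|m p IH] t0 //= [h1 h2] h3; split=> //; exact: IH. Qed.

Lemma mesh_mono t0 p d d' : d <= d' -> mesh t0 p d -> mesh t0 p d'.
Proof.
move=> dd; elim: p t0 => [|m p IH] t0 //= [h1 /IH h2]; split=> //; lra.
Qed.

Definition upart a b n : seq R :=
  if a < b then [seq a + (b - a) * (i.+1%:R / n.+1%:R) | i <- iota 0 n.+1] else [::].

Lemma upartP a b n : a <= b -> partition_pts a b (upart a b n).
Proof.
move=> ab; rewrite /upart; have [lt|ge] := ltP a b; last first.
  by split=> //=; apply/eqP; rewrite eq_le ab.
have n0 : 0 < n.+1%:R^-1 :> R by rewrite invr_gt0.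
pose f i : R := a + (b - a) * (i%:R / n.+1%:R).
have f0 : f 0%N = a by rewrite /f mul0r mulr0 addr0.
have fS i : f i < f i.+1.
  rewrite /f ltrD2l ltr_pM2l ?subr_gt0 // ltr_pM2r // ltr_nat //.
have key k j : path <%R (f j) [seq f i.+1 | i <- iota j k] /\
    last (f j) [seq f i.+1 | i <- iota j k] = f (j + k)%N.
  elim: k j => [|k IH] j /=; first by rewrite addn0.
  by rewrite fS /=; have [h1 h2] := IH j.+1; rewrite h1 h2 addSnnS.
have [h1 h2] := key n.+1 0%N; rewrite f0 in h1 h2.
split; first exact: h1.
by rewrite [LHS]h2 add0n /f divff ?pnatr_eq0 // mulr1 addrC subrK.
Qed.

Lemma upart_mesh a b n d : a <= b -> (b - a) / n.+1%:R < d -> mesh a (upart a b n) d.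
Proof.
move=> ab hd; rewrite /upart; have [lt|ge //] := ltP a b.
pose f i : R := a + (b - a) * (i%:R / n.+1%:R).
have f0 : f 0%N = a by rewrite /f mul0r mulr0 addr0.
have fS i : f i.+1 - f i < d.
  apply: le_lt_trans hd; rewrite /f le_eqVlt; apply/orP; left; apply/eqP.
  by rewrite -[i.+1]addn1 natrD; ring.
have key k j : mesh (f j) [seq f i.+1 | i <- iota j k] d.
  by elim: k j => [|k IH] j //=.
by rewrite -[X in mesh X]f0; exact: key.
Qed.

Lemma upart_small a b d : a <= b -> 0 < d ->
  exists N, forall n, (N <= n)%N -> mesh a (upart a b n) d.
Proof.
move=> ab d0; have p1 : 0 < b - a + 1 by lra.
have [N hN] := @invS_small R (d / (b - a + 1)) (divr_gt0 d0 p1).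
exists N => n /hN h; apply: upart_mesh => //.
move: h; rewrite ltr_pdivlMr //; have : 0 < n.+1%:R^-1 :> R by rewrite invr_gt0.
move: (n.+1%:R^-1) => z; nra.
Qed.

End Partitions.

(** * Integration against an additive increment process *)

Section Integral.
Variables (R : realType) (H : completeNormedModType R[i]).
Variable ip : {dot H for (@Num.conj R[i])}.
Variable B : bernoulli_shift ip.
Local Notation e0 := (proj0 B).
Local Notation Hip := (shift_hilbert B).

Implicit Types (s t : R) (p q r : seq R) (G : R -> H -> H).

(** Adaptedness at time t. *)
Definition past (t : R) : set (H -> H) := gmodI B `]-oo, t].

Variable mu : R -> R -> (H -> H) -> (H -> H).

(** What the Ito term gmul (c t - c s) y and the Riemann term (t - s) y have in
   common: adaptedness, additivity in the interval and in the integrand. *)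
Record increments := {
  mu_past : forall s t y, 0 <= s -> s <= t -> past s y -> past t (mu s t y);
  mu_add : forall s (m : R) t y, 0 <= s -> s <= m -> m <= t -> past s y ->
    mu s t y = mu s m y + mu m t y;
  mu_sub : forall s t y y', 0 <= s -> s <= t -> past s y -> past s y' ->
    mu s t (y - y') = mu s t y - mu s t y' }.

Fixpoint isum (G : R -> H -> H) (t0 : R) (p : seq R) : H -> H :=
  if p is m :: p' then mu t0 m (G t0) + isum G m p' else 0.

(** The mean-square estimate which drives the whole theory: for Ito increments it
   comes from orthogonality, for Riemann increments from Cauchy-Schwarz, where
   the constant depends on the horizon T. *)
Definition estimate (T L : R) := forall G t0 p u, 0 <= t0 -> path <%R t0 p ->
  last t0 p <= T -> (forall s, t0 <= s -> s <= last t0 p -> past s (G s)) ->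
  hnorm (isum G t0 p u) ^+ 2 <= L * wsum (fun s => hnorm (G s u) ^+ 2) t0 p.

Hypothesis hmu : increments.

Lemma past_gns t x : past t x -> gmod B x.
Proof. exact: (gmodI_gmod (itv_oc t)). Qed.

Lemma pastB t x y : past t x -> past t y -> past t (x - y).
Proof. exact: (gns_sub (filt_vn B (itv_oc t))). Qed.

Lemma pastD t x y : past t x -> past t y -> past t (x + y).
Proof. exact: (gns_add (filt_vn B (itv_oc t))). Qed.

Lemma past0 t : past t 0.
Proof. exact: (gns_zero B (filt_vn B (itv_oc t))). Qed.

Lemma past_le s t x : s <= t -> past s x -> past t x.
Proof. exact: past_mono. Qed.

Lemma past_bop t x : past t x -> bounded_op x.
Proof. exact: gns_bop. Qed.

Lemma isum_ext G G' t0 p : path <%R t0 p ->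
  (forall s, t0 <= s -> s < last t0 p -> G s = G' s) -> isum G t0 p = isum G' t0 p.
Proof.
elim: p t0 => [|m p IH] t0 //= /andP[h1 hp] h.
have ml := path_le_last hp.
rewrite h //; last lra; rewrite (IH m) // => s ms; apply: h; lra.
Qed.

Lemma isum_past G t0 p : 0 <= t0 -> path <%R t0 p ->
  (forall s, t0 <= s -> s <= last t0 p -> past s (G s)) -> past (last t0 p) (isum G t0 p).
Proof.
elim: p t0 => [|m p IH] t0 t00 /=; first by move=> _ _; exact: past0.
move=> /andP[h1 hp] h; have ml := path_le_last hp.
apply: pastD; last by apply: IH => //; [lra | move=> s ms; apply: h; lra].
apply: (past_le ml); apply: mu_past => //; [exact: ltW | apply: h; lra].
Qed.

Lemma isum_sub G G' t0 p : 0 <= t0 -> path <%R t0 p ->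
  (forall s, t0 <= s -> s <= last t0 p -> past s (G s)) ->
  (forall s, t0 <= s -> s <= last t0 p -> past s (G' s)) ->
  isum (fun s => G s - G' s) t0 p = isum G t0 p - isum G' t0 p.
Proof.
elim: p t0 => [|m p IH] t0 t00 /=; first by rewrite subr0.
move=> /andP[h1 hp] h h'; have ml := path_le_last hp.
rewrite mu_sub //; [|exact: ltW|apply: h; lra|apply: h'; lra].
rewrite IH //; [|lra|by move=> s ms; apply: h; lra|by move=> s ms; apply: h'; lra].
by rewrite opprD addrACA.
Qed.

Lemma isum_cat G t0 p q : isum G t0 (p ++ q) = isum G t0 p + isum G (last t0 p) q.
Proof. by elim: p t0 => [|m p IH] t0 /=; rewrite ?add0r // IH addrA. Qed.

Lemma mu_refl s y : 0 <= s -> past s y -> mu s s y = 0.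
Proof.
move=> s0 hy; have := mu_add hmu s0 (lexx s) (lexx s) hy.
by rewrite -[X in X = _]addr0 => /addrI/esym.
Qed.

(** Additivity telescopes. *)
Lemma isum_const g t0 p : 0 <= t0 -> path <%R t0 p -> past t0 g ->
  isum (fun=> g) t0 p = mu t0 (last t0 p) g.
Proof.
elim: p t0 => [|m p IH] t0 t00 /=; first by move=> _ hg; rewrite mu_refl.
move=> /andP[h1 hp] hg; have ml := path_le_last hp.
rewrite IH //; [|lra|exact: past_le (ltW h1) hg].
by rewrite -(mu_add hmu t00 (ltW h1) ml hg).
Qed.

(** The integrand whose sum along any refinement of p is the sum of G along p. *)
Fixpoint stepf (G : R -> H -> H) (t0 : R) (p : seq R) (s : R) : H -> H :=
  if p is m :: p' then (if s < m then G t0 else stepf G m p' s) else G t0.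

Lemma stepf_val G t0 p s d : path <%R t0 p -> t0 <= s -> mesh t0 p d ->
  exists s', [/\ stepf G t0 p s = G s', t0 <= s', s' <= s & s < last t0 p -> s - s' < d].
Proof.
elim: p t0 => [|m p IH] t0 /=.
  by move=> _ ts _; exists t0; split=> // h; lra.
move=> /andP[h1 hp] ts [md hm]; have [sm|ms] := ltP s m.
  by exists t0; split=> // _; lra.
have [s' [e1 e2 e3 e4]] := IH m hp ms hm; exists s'; split=> //; lra.
Qed.

Lemma stepf_past G t0 p s : path <%R t0 p -> t0 <= s -> s <= last t0 p ->
  (forall s, t0 <= s -> s <= last t0 p -> past s (G s)) -> past s (stepf G t0 p s).
Proof.
move=> hp ts sl h.
have [d hd] : exists d, mesh t0 p d.
  elim: p t0 {ts sl h} hp => [|m p IH] t0 /=; first by exists 0.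
  move=> /andP[_ /IH[d hd]]; exists (Num.max d (m - t0 + 1)); split.
    by rewrite lt_max; apply/orP; right; lra.
  by apply: mesh_mono hd; rewrite le_max lexx.
have [s' [-> e2 e3 _]] := stepf_val G hp ts hd.
by apply: (past_le e3); apply: h => //; exact: le_trans sl.
Qed.

(** On a finer partition the step process is constant between points of p, so the
   additional points do not change its sum. *)
Lemma isum_refine G t0 p r : 0 <= t0 -> path <%R t0 p -> path <%R t0 r ->
  last t0 r = last t0 p -> {subset p <= r} ->
  (forall s, t0 <= s -> s <= last t0 p -> past s (G s)) ->
  isum (stepf G t0 p) t0 r = isum G t0 p.
Proof.
elim: p t0 r => [|m p IH] t0 r t00.
  move=> _ hr /= lr _ h; case: r hr lr => [//|m r] /= /andP[h1 hr] lr.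
  by exfalso; have := path_le_last hr; rewrite lr; lra.
move=> /= /andP[h1 hp] hr lr sub h.
have mr : m \in r by apply: sub; rewrite inE eqxx.
have ml := path_le_last hp; have m0 : 0 <= m by lra.
case/splitPr: mr hr lr sub => r1 r2 hr lr sub.
move: hr; rewrite cat_path /= => /and3P[hr1 hlm hr2].
rewrite last_cat /= in lr.
rewrite -cat_rcons isum_cat last_rcons.
have hr1' : path <%R t0 (rcons r1 m) by rewrite rcons_path hr1.
have -> : isum (fun s => if s < m then G t0 else stepf G m p s) t0 (rcons r1 m)
    = mu t0 m (G t0).
  rewrite (@isum_ext _ (fun=> G t0)) //; last first.
    by move=> s _; rewrite last_rcons => ->.
  rewrite isum_const // ?last_rcons //; apply: h => //; lra.
congr (_ + _).
rewrite (@isum_ext _ (stepf G m p)) //; last by move=> s ms _; rewrite ltNge ms.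
apply: IH => //; last by move=> s ms; apply: h; lra.
move=> s sp; have := sub s; rewrite inE sp orbT => /(_ isT).
have ms := path_min hp sp.
rewrite mem_cat inE => /or3P[sr1|/eqP sm|//].
  have := path_last_max hr1' (s := s); rewrite mem_rcons inE sr1 orbT last_rcons.
  by move=> /(_ isT); lra.
by rewrite sm ltxx in ms.
Qed.

Definition unif_cont (x : R -> H -> H) (a b : R) (xi : H) := forall e : R, 0 < e -> exists2 d : R, 0 < d &
  forall s s', a <= s -> s <= b -> a <= s' -> s' <= b -> `|s - s'| < d ->
    hnorm ((x s - x s') xi) < e.

Definition is_int (G : R -> H -> H) (a b : R) (z : H -> H) := gmod B z /\
  forall xi, space0 B xi -> forall e : R, 0 < e -> exists2 d : R, 0 < d &
    forall p, partition_pts a b p -> mesh_lt a p d -> hnorm ((isum G a p - z) xi) < e.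

Definition fine (a b : R) (p : nat -> seq R) : Prop :=
  (forall n, partition_pts a b (p n)) /\
  forall d, 0 < d -> exists N, forall n, (N <= n)%N -> mesh a (p n) d.

Lemma fine_upart a b : a <= b -> fine a b (upart a b).
Proof. by move=> ab; split=> [n|d d0]; [exact: upartP | exact: upart_small]. Qed.

Lemma fine_cat a b m (p q : nat -> seq R) : fine a m p -> fine m b q ->
  fine a b (fun n => p n ++ q n).
Proof.
move=> [h1 h2] [h3 h4]; split=> [n|d d0].
  have [e1 e2] := h1 n; have [e3 e4] := h3 n.
  by split; rewrite ?cat_path ?last_cat e2 ?e1.
have [N1 hN1] := h2 d d0; have [N2 hN2] := h4 d d0.
exists (maxn N1 N2) => n; rewrite geq_max => /andP[n1 n2].
by apply: mesh_cat; [exact: hN1 | have [_ ->] := h1 n; exact: hN2].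
Qed.

(** A pointwise Cauchy sequence is uniformly bounded, so the modules are
   sequentially complete. *)
Lemma gns_complete N (z : nat -> H -> H) : (forall n, gns_module B N (z n)) ->
  (forall xi, space0 B xi -> hcauchy (fun n => z n xi)) ->
  exists2 w, gns_module B N w & forall u, hcvg (z^~ u) (w u).
Proof.
move=> hz hc.
have ex u : exists l, hcvg (z^~ u) l.
  apply: hcauchy_cvg => e ee; have [M hM] := hc _ (proj0_in B u) e ee.
  by exists M => m n hm hn; rewrite -(gns_proj0 u (hz m)) -(gns_proj0 u (hz n)); exact: hM.
have [w hw] := choice ex.
have [K K0 hK] : exists2 K : R, 0 <= K & forall n u, hnorm (z n u) <= K * hnorm u.
  apply: uniform_boundedness => [n|u]; first exact: gns_bop (hz n).
  exact: hcvg_bounded (hw u).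
have bz n : bounded_op (z n) := gns_bop (hz n).
by exists w => //; exact: (gns_seq_closed hz bz hK hw).
Qed.

Section Existence.
Variables (T L a b : R) (G : R -> H -> H).
Hypotheses (L0 : 0 <= L) (est : estimate T L).
Hypotheses (a0 : 0 <= a) (ab : a <= b) (bT : b <= T).
Hypothesis hG : forall s, a <= s -> s <= b -> past s (G s).

(** On a common refinement, both sums are sums of step processes which differ by
   at most 2 e, and the estimate applies to the difference. *)
Lemma isum_close p q d e xi : partition_pts a b p -> partition_pts a b q ->
  mesh a p d -> mesh a q d -> 0 <= e ->
  (forall s s', a <= s -> s <= b -> a <= s' -> s' <= b -> `|s - s'| < d ->
    hnorm ((G s - G s') xi) <= e) ->
  hnorm ((isum G a p - isum G a q) xi) ^+ 2 <= L * ((b - a) * (2 * e) ^+ 2).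
Proof.
have := (a0, ab, bT, L0) => -[[[a0' ab'] bT'] L0'].
move=> [hp lp] [hq lq] mp mq ep hd.
have lpq : last a p = last a q by rewrite lp.
have [r [hr lr pr qr]] := common_refinement hp hq lpq.
have Gp s : a <= s -> s <= last a p -> past s (G s) by rewrite lp; exact: hG.
have Gq s : a <= s -> s <= last a q -> past s (G s) by rewrite lq; exact: hG.
rewrite -(isum_refine a0 hp hr lr pr Gp).
rewrite lpq in lr; rewrite -(isum_refine a0 hq hr lr qr Gq).
have sp s : a <= s -> s <= last a r -> past s (stepf G a p s).
  by rewrite lr -lpq => h1 h2; apply: stepf_past.
have sq s : a <= s -> s <= last a r -> past s (stepf G a q s).
  by rewrite lr => h1 h2; apply: stepf_past.
rewrite -isum_sub //.
apply: le_trans (est xi a0 hr _ _) _; first by rewrite lr lq.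
  by move=> s h1 h2; apply: pastB; [exact: sp | exact: sq].
apply: ler_wpM2l => //.
apply: (@le_trans _ _ (wsum (fun=> (2 * e) ^+ 2) a r)); last first.
  by rewrite wsum_cst lr lq.
apply: wsum_le => // s h1; rewrite lr lq => h2.
have [s1 [e1 e2 e3 e4]] := stepf_val G hp h1 mp.
have [s2 [f1 f2 f3 f4]] := stepf_val G hq h1 mq.
rewrite lp in e4; rewrite lq in f4; have {}e4 := e4 h2; have {}f4 := f4 h2.
rewrite ler_pXn2r ?nnegrE //; last by rewrite mulr_ge0.
rewrite e1 f1 !fct_subE; apply: le_trans (hnorm_triB _ (G s xi) _) _.
have g1 : hnorm ((G s1 - G s) xi) <= e.
  by apply: hd; rewrite // ?(le_trans e3) ?(ltW h2) // distrC ger0_norm //; lra.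
have g2 : hnorm ((G s - G s2) xi) <= e.
  by apply: hd; rewrite // ?(le_trans f3) ?(ltW h2) // ger0_norm //; lra.
by rewrite !fct_subE in g1 g2; lra.
Qed.

Lemma isum_in_past p : partition_pts a b p -> past b (isum G a p).
Proof. by move=> [hp lp]; rewrite -lp; apply: isum_past => // s; rewrite lp; exact: hG. Qed.

(** The sums along fine partitions form a Cauchy sequence by isum_close; the limit
   exists by completeness and does not depend on the partitions. *)
Lemma int_exists : (forall xi, space0 B xi -> unif_cont G a b xi) ->
  exists2 z, past b z & is_int G a b z.
Proof.
move=> uc; have [hp hm] := fine_upart ab.
have close xi : space0 B xi -> forall e : R, 0 < e -> exists2 d : R, 0 < d &
    forall p q, partition_pts a b p -> partition_pts a b q -> mesh a p d -> mesh a q d ->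
      hnorm ((isum G a p - isum G a q) xi) <= e.
  move=> hxi e ee.
  have k0 : 0 < L * (b - a) * 4 + 1 by have := mulr_ge0 L0 (_ : 0 <= b - a); rewrite subr_ge0 => /(_ ab); lra.
  (* Chosen such that L (b - a) (2 e1)^2 <= e^2. *)
  pose e1 := Num.min 1 (e ^+ 2 / (L * (b - a) * 4 + 1)).
  have e2 : 0 < e ^+ 2 / (L * (b - a) * 4 + 1) by rewrite divr_gt0 // exprn_gt0.
  have e10 : 0 < e1 by rewrite lt_min ltr01.
  have e11 : e1 <= 1 by rewrite ge_min lexx.
  have e12 : e1 * (L * (b - a) * 4 + 1) <= e ^+ 2 by rewrite -ler_pdivlMr // ge_min lexx orbT.
  have [d d0 hd] := uc xi hxi e1 e10; exists d => // p q pp pq mp mq.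
  have hd' s s' : a <= s -> s <= b -> a <= s' -> s' <= b -> `|s - s'| < d ->
    hnorm ((G s - G s') xi) <= e1 by move=> *; exact/ltW/hd.
  have := isum_close pp pq mp mq (ltW e10) hd'.
  move=> h; rewrite -(ler_pXn2r (n := 2)) ?nnegrE //; last exact: ltW.
  apply: le_trans h _; apply: le_trans e12.
  have : 0 <= L * (b - a) by rewrite mulr_ge0 // subr_ge0.
  have -> : L * ((b - a) * (2 * e1) ^+ 2) = L * (b - a) * (2 * e1) ^+ 2 by ring.
  move=> y0; have := mulr_ge0 y0 (mulr_ge0 (ltW e10) (_ : 0 <= 1 - e1)).
  by rewrite subr_ge0 => /(_ e11); move: (L * (b - a)) (e1) (e10) => y x; nra.
have cau xi : space0 B xi -> hcauchy (fun n => isum G a (upart a b n) xi).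
  move=> hxi e ee; have e2 : 0 < e / 2 by lra.
  have [d d0 hd] := close xi hxi _ e2; have [N hN] := hm d d0.
  exists N => m n Nm Nn; have := hd _ _ (hp m) (hp n) (hN m Nm) (hN n Nn).
  by rewrite fct_subE; lra.
have [z zp hz] := gns_complete (fun n => isum_in_past (hp n)) cau.
exists z => //; split; first exact: past_gns zp.
move=> xi hxi e ee; have e2 : 0 < e / 2 by lra.
have [d d0 hd] := close xi hxi _ e2; exists d => // p pp /mesh_ltE mp.
have [N1 hN1] := hm d d0; have [N2 hN2] := hz xi _ e2.
have := hd _ _ pp (hp (maxn N1 N2)) mp (hN1 _ (leq_maxl _ _)).
have := hN2 _ (leq_maxr N1 N2).
have := hnorm_triB (isum G a p xi) (isum G a (upart a b (maxn N1 N2)) xi) (z xi).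
by rewrite !fct_subE; lra.
Qed.

Section Limits.
Variable z : H -> H.
Hypothesis iz : is_int G a b z.

(** Sequences of sums reach the integral on every vector, not only on those of A0;
   all properties of integrals below are limits of properties of sums. *)
Lemma int_seq (p : nat -> seq R) u : fine a b p -> hcvg (fun n => isum G a (p n) u) (z u).
Proof.
move=> [hp hm] e ee; have [d d0 hd] := iz.2 _ (proj0_in B u) e ee.
have [N hN] := hm d d0; exists N => n /hN/mesh_ltE mn.
have := hd _ (hp n) mn; rewrite fct_subE (gns_proj0 u iz.1).
by rewrite (gns_proj0 u (isum_in_past (hp n))).
Qed.

Lemma int_in N : (forall p, partition_pts a b p -> gns_module B N (isum G a p)) ->
  gns_module B N z.
Proof.
move=> h; have [hp hm] := fine_upart ab.
have cv u := int_seq u (fine_upart ab).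
have [w wN hw] := gns_complete (fun n => h _ (hp n)) (fun xi _ => hcvg_cauchy (cv xi)).
suff -> : z = w by [].
by apply/funext => u; exact: hcvg_unique (cv u) (hw u).
Qed.

Lemma int_past : past b z.
Proof. by apply: int_in => p; exact: isum_in_past. Qed.

(** The estimate for sums passes to the limit. *)
Lemma int_le (g : R -> R) M u :
  (forall s, a <= s -> s < b -> hnorm (G s u) ^+ 2 <= g s) ->
  (forall p, partition_pts a b p -> wsum g a p <= M) -> hnorm (z u) ^+ 2 <= L * M.
Proof.
move=> hg hM; have [hp hm] := fine_upart ab.
apply: (hcvg_sq_le (int_seq u (fine_upart ab))) => n; have [h1 h2] := hp n.
apply: le_trans (est u a0 h1 _ _) _; first by rewrite h2.
  by move=> s; rewrite h2; exact: hG.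
apply: ler_wpM2l => //; apply: le_trans (hM _ (hp n)).
by apply: wsum_le => // s; rewrite h2; exact: hg.
Qed.

Lemma int_le_cst M u : (forall s, a <= s -> s < b -> hnorm (G s u) ^+ 2 <= M) ->
  hnorm (z u) ^+ 2 <= L * ((b - a) * M).
Proof. by move=> /int_le; apply=> p [_ lp]; rewrite wsum_cst lp. Qed.

(** The weight exp (l s) gains a factor 1 / l, as in Bielecki norms. *)
Lemma int_le_exp l M u : 0 < l -> 0 <= M ->
  (forall s, a <= s -> s < b -> hnorm (G s u) ^+ 2 <= M * expR (l * (s - a))) ->
  hnorm (z u) ^+ 2 <= L * (M * expR (l * (b - a)) / l).
Proof.
move=> l0 M0 /int_le; apply=> p [pp lp].
apply: le_trans (wsum_exp a l0 M0 pp) _; rewrite lp.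
rewrite ler_pM2r ?invr_gt0 //; apply: ler_wpM2l => //.
by have := expR_gt0 (l * (a - a)); lra.
Qed.
End Limits.
End Existence.

Lemma int_sub G G' a b z z' : 0 <= a -> a <= b ->
  (forall s, a <= s -> s <= b -> past s (G s)) ->
  (forall s, a <= s -> s <= b -> past s (G' s)) ->
  is_int G a b z -> is_int G' a b z' -> is_int (fun s => G s - G' s) a b (z - z').
Proof.
move=> a0 ab hG hG' iz iz'; split.
  exact: (gns_sub (shift_vn B) iz.1 iz'.1).
move=> xi hxi e ee; have e2 : 0 < e / 2 by lra.
have [d d0 hd] := iz.2 _ hxi _ e2; have [d' d0' hd'] := iz'.2 _ hxi _ e2.
exists (Num.min d d') => [|p pp /mesh_ltE mp]; first by rewrite lt_min d0.
have m1 : mesh_lt a p d by apply/mesh_ltE; apply: mesh_mono mp; rewrite ge_min lexx.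
have m2 : mesh_lt a p d' by apply/mesh_ltE; apply: mesh_mono mp; rewrite ge_min lexx orbT.
have := hd p pp m1; have := hd' p pp m2; have [p1 p2] := pp.
rewrite isum_sub // ?p2 // !fct_subE.
have -> : isum G a p xi - isum G' a p xi - (z xi - z' xi) =
  (isum G a p xi - z xi) - (isum G' a p xi - z' xi).
  by rewrite opprD addrACA -opprD.
move: (isum G a p xi - z xi) (isum G' a p xi - z' xi) => v v' h h'.
by have := hnormD v (- v'); rewrite hnormN; lra.
Qed.

Lemma int_add G a m b z z1 z2 : 0 <= a -> a <= m -> m <= b ->
  (forall s, a <= s -> s <= b -> past s (G s)) ->
  is_int G a m z1 -> is_int G m b z2 -> is_int G a b z -> z = z1 + z2.
Proof.
move=> a0 am mb hG i1 i2 i; have m0 : 0 <= m by lra.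
have hG1 s : a <= s -> s <= m -> past s (G s) by move=> h1 h2; apply: hG => //; lra.
have hG2 s : m <= s -> s <= b -> past s (G s) by move=> h1 h2; apply: hG => //; lra.
have f1 := fine_upart am; have f2 := fine_upart mb.
apply/funext => u; have cv := int_seq a0 hG i u (fine_cat f1 f2).
apply: hcvg_unique cv _.
apply: hcvg_eq (hcvgD (int_seq a0 hG1 i1 u f1) (int_seq m0 hG2 i2 u f2)) => n.
by rewrite isum_cat fct_addE; have [_ ->] := f1.1 n.
Qed.

End Integral.

(** * Ito and Riemann integrals as instances *)

Section Instances.
Variables (R : realType) (H : completeNormedModType R[i]).
Variable ip : {dot H for (@Num.conj R[i])}.
Variable B : bernoulli_shift ip.
Local Notation Hip := (shift_hilbert B).
Local Notation past := (past B).

Implicit Types (s t a b : R) (p q : seq R) (G : R -> H -> H).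

Lemma local_mono s t x : s <= t -> gmodI B `[0, s] x -> gmodI B `[0, t] x.
Proof.
move=> st; apply: gmodI_mono; [exact: itv_cc|exact: itv_cc|].
by move=> r /=; rewrite !in_itv /= => /andP[-> /le_trans ->].
Qed.

Section Ito.
Variable c : R -> H -> H.
Hypotheses (Hc : additive_cocycle B c) (Hcentred : centred B c).

Lemma dc_increments : increments B (dc B c).
Proof.
by split; [exact: dc_past | move=> s m t y; exact: dc_add | exact: dc_sub].
Qed.

(** An increment is orthogonal to the past of its left end point, which contains
   the past of t0. *)
Lemma isum_orth G t0 p y u u' : 0 <= t0 -> path <%R t0 p ->
  (forall s, t0 <= s -> s <= last t0 p -> past s (G s)) ->
  past t0 y -> ip (isum (dc B c) G t0 p u) (y u') = 0.
Proof.
elim: p t0 => [|m p IH] t0 t00 /=; first by move=> _ _ _; exact: ip0l.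
move=> /andP[h1 hp] hG hy; have ml := path_le_last hp.
rewrite fct_addE ipDl dc_orth ?(ltW h1) //; last by apply: hG => //; lra.
rewrite add0r; apply: IH => //; [lra| |exact: past_le (ltW h1) hy].
by move=> s ms; apply: hG; lra.
Qed.

(** The Ito isometry as an inequality: by isum_orth the squares of the terms add
   up. *)
Lemma dc_estimate : exists2 L : R, 0 <= L & forall T, estimate B (dc B c) T L.
Proof.
have [K K0 hK] := cocycle_bound Hc Hcentred.
exists (K ^+ 2); first exact: sqr_ge0.
move=> T G t0 p u t00 hp _ hG.
elim: p t0 t00 hp hG => [|m p IH] t0 t00 /=.
  by move=> _ _; rewrite mulr0 -[X in hnorm X]/(0 : H) hnorm0 expr0n.
move=> /andP[h1 hp] hG; have ml := path_le_last hp; have m0 : 0 <= m by lra.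
have hGm s : m <= s -> s <= last m p -> past s (G s) by move=> ms; apply: hG; lra.
have ht : past t0 (G t0) by apply: hG => //; lra.
rewrite fct_addE addrC (hnorm_sqD Hip) /rip isum_orth //; last exact: (mu_past dc_increments t00 (ltW h1) ht).
have := IH m m0 hp hGm; have := dc_bound Hc t00 (ltW h1) ht K0 hK u.
by rewrite /= mulr0 addr0 mulrDr => h2 h3; rewrite addrC; apply: lerD.
Qed.

Lemma ito_sumE G t0 p : ito_sum B c G t0 p = isum (dc B c) G t0 p.
Proof.
elim: p t0 => [|m p IH] t0; first by rewrite /ito_sum big_ord0.
by rewrite /ito_sum big_ord_recl /= -IH.
Qed.

(** For adapted integrands the seminorms are norms of values. *)
Lemma ito_integralE G a b z : 0 <= a ->
  (forall s, a <= s -> s <= b -> past s (G s)) ->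
  is_ito_integral B c G a b z <-> is_int B (dc B c) G a b z.
Proof.
move=> a0 hG; split=> -[zg h]; split=> // xi hxi e ee; have [d d0 hd] := h xi hxi e ee;
  exists d => // p pp mp; have := hd p pp mp; rewrite ito_sumE dsnE //; 
  by [exact: Hip | apply: bop_sub (gns_bop zg); apply: past_bop (isum_in_past dc_increments a0 hG pp)].
Qed.

Lemma isum_dc_local G t0 p : 0 <= t0 -> path <%R t0 p ->
  (forall s, t0 <= s -> s <= last t0 p -> gmodI B `[0, s] (G s)) ->
  gmodI B `[0, last t0 p] (isum (dc B c) G t0 p).
Proof.
elim: p t0 => [|m p IH] t0 t00 /=.
  by move=> _ _; exact: (gns_zero B (filt_vn B (itv_cc 0 t0))).
move=> /andP[h1 hp] hG; have ml := path_le_last hp.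
apply: (gns_add (filt_vn B (itv_cc 0 (last m p)))); last first.
  by apply: IH => //; [lra | move=> s ms; apply: hG; lra].
apply: (local_mono ml); apply: dc_local => //; [exact: ltW | apply: hG; lra].
Qed.
End Ito.

Definition riem s t (y : H -> H) : H -> H := (t - s)%:C *: y.

Lemma riem_increments : increments B riem.
Proof.
split.
- move=> s t y s0 st hy; apply: (gns_scale (filt_vn B (itv_oc t))).
  exact: past_le st hy.
- move=> s m t y _ _ _ _; rewrite /riem -scalerDl -raddfD /=.
  by congr (_%:C *: _); ring.
- by move=> s t y y' _ _ _ _; rewrite /riem scalerBr.
Qed.

Lemma wsum_ge0 (g : R -> R) t0 p : (forall s, 0 <= g s) -> path <%R t0 p -> 0 <= wsum g t0 p.
Proof.
move=> hg; elim: p t0 => [|m p IH] t0 //= /andP[h1 /IH h2].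
by apply: addr_ge0 => //; apply: mulr_ge0 => //; rewrite subr_ge0 ltW.
Qed.

(** Induction on the partition, with the two-term case in each step. *)
Lemma wsum_cauchy_schwarz (g : R -> R) t0 p : (forall s, 0 <= g s) -> path <%R t0 p ->
  wsum g t0 p ^+ 2 <= (last t0 p - t0) * wsum (fun s => g s ^+ 2) t0 p.
Proof.
move=> hg; elim: p t0 => [|m p IH] t0 /=; first by rewrite expr0n mulr0.
move=> /andP[h1 hp]; have ml := path_le_last hp; have W0 := wsum_ge0 hg hp.
have V0 := wsum_ge0 (fun s => sqr_ge0 (g s)) hp.
have := IH m hp; have := hg t0.
have -> : last m p - t0 = (m - t0) + (last m p - m) by ring.
have : 0 <= last m p - m by rewrite subr_ge0.
have : 0 < m - t0 by rewrite subr_gt0.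
move: (wsum _ m p) (wsum _ m p) (m - t0) (last m p - m) (g t0) W0 V0.
move=> V W D E x W0 V0 D0 E0 x0 h.
suff h2 : 2 * x * W <= V + E * x ^+ 2.
  by have := ler_wpM2l (ltW D0) h2; lra.
rewrite -(ler_pXn2r (n := 2)) ?nnegrE //; first last.
- by rewrite addr_ge0 // mulr_ge0 // sqr_ge0.
- by rewrite !mulr_ge0.
have h3 := ler_wpM2l (sqr_ge0 x) h; have := sqr_ge0 (V - E * x ^+ 2).
by lra.
Qed.

Lemma isum_riem_le G t0 p u : path <%R t0 p ->
  hnorm (isum riem G t0 p u) <= wsum (fun s => hnorm (G s u)) t0 p.
Proof.
elim: p t0 => [|m p IH] t0 /=; first by rewrite -[X in hnorm X]/(0 : H) hnorm0.
move=> /andP[h1 /IH h2]; rewrite fct_addE; apply: le_trans (hnormD _ _) (lerD _ h2).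
by rewrite /riem fct_scaleE hnormZ ger0_norm // subr_ge0 ltW.
Qed.

Lemma riem_estimate T : estimate B riem T T.
Proof.
move=> G t0 p u t00 hp lT _.
apply: (@le_trans _ _ (wsum (fun s => hnorm (G s u)) t0 p ^+ 2)).
  rewrite ler_pXn2r ?nnegrE //; first exact: isum_riem_le.
  by apply: wsum_ge0.
apply: le_trans (wsum_cauchy_schwarz (fun s => hnorm_ge0 (G s u)) hp) _.
by apply: ler_wpM2r; [apply: wsum_ge0 => // s; exact: sqr_ge0 | lra].
Qed.

Lemma isum_riem_local G t0 p : 0 <= t0 -> path <%R t0 p ->
  (forall s, t0 <= s -> s <= last t0 p -> gmodI B `[0, s] (G s)) ->
  gmodI B `[0, last t0 p] (isum riem G t0 p).
Proof.
elim: p t0 => [|m p IH] t0 t00 /=.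
  by move=> _ _; exact: (gns_zero B (filt_vn B (itv_cc 0 t0))).
move=> /andP[h1 hp] hG; have ml := path_le_last hp.
apply: (gns_add (filt_vn B (itv_cc 0 (last m p)))); last first.
  by apply: IH => //; [lra | move=> s ms; apply: hG; lra].
apply: (gns_scale (filt_vn B (itv_cc 0 (last m p)))).
by apply: (@local_mono t0); [lra | apply: hG; lra].
Qed.

Lemma riemann_sum_left G t0 p : riemann_sum G t0 p (pt t0 p) = isum riem G t0 p.
Proof.
elim: p t0 => [|m p IH] t0; first by rewrite /riemann_sum big_ord0.
by rewrite /riemann_sum big_ord_recl /= -IH.
Qed.

Lemma pt_in t0 p i : path <%R t0 p -> (i < size p)%N ->
  t0 <= pt t0 p i /\ pt t0 p i.+1 <= last t0 p.
Proof.
elim: p t0 i => [|m p IH] t0 [|i] //= /andP[h1 hp] hi; have ml := path_le_last hp.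
  by split; rewrite /pt //=.
have [e1 e2] := IH m i hp hi; split; last exact: e2.
by apply: le_trans (ltW h1) e1.
Qed.

(** Terms with different sample points in the same interval differ by the
   oscillation of G. *)
Lemma riemann_sum_tag G t0 p (tag tag' : nat -> R) u e : path <%R t0 p ->
  (forall i, (i < size p)%N -> hnorm ((G (tag i) - G (tag' i)) u) <= e) ->
  hnorm ((riemann_sum G t0 p tag - riemann_sum G t0 p tag') u) <= (last t0 p - t0) * e.
Proof.
elim: p t0 tag tag' => [|m p IH] t0 tag tag' /=.
  move=> _ _; rewrite /riemann_sum !big_ord0 (subrr t0) mul0r.
  by rewrite fct_subE subrr hnorm0.
move=> /andP[h1 hp] h.
have eq tg : riemann_sum G t0 (m :: p) tg =
    (m - t0)%:C *: G (tg 0%N) + riemann_sum G m p (fun i => tg i.+1).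
  by rewrite /riemann_sum big_ord_recl.
rewrite !eq opprD addrACA -scalerBr fct_addE fct_scaleE.
apply: le_trans (hnormD _ _) _; rewrite hnormZ ger0_norm; last by rewrite subr_ge0 ltW.
have h2 := IH m _ _ hp (fun i hi => h i.+1 hi).
have d0 : 0 <= m - t0 by rewrite subr_ge0 ltW.
have h3 := ler_wpM2l d0 (h 0%N isT).
apply: le_trans (lerD h3 h2) _; rewrite /=; lra.
Qed.

(** Left end points are admissible sample points. *)
Lemma riemann_left G a b z : 0 <= a ->
  (forall s, a <= s -> s <= b -> past s (G s)) ->
  is_riemann_integral B G a b z -> is_int B riem G a b z.
Proof.
move=> a0 hG [zg h]; split=> // xi hxi e ee; have [d d0 hd] := h xi hxi e ee.
exists d => // p pp mp; have := hd p (pt a p) pp mp; rewrite riemann_sum_left dsnE; first last.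
- by apply: bop_sub (gns_bop zg); apply: past_bop (isum_in_past riem_increments a0 hG pp).
- exact: Hip.
apply=> i hi; rewrite lexx /=.
have [hp _] := pp; move: {h hG zg a0 hd mp pp} hp hi.
elim: p a i => [|m p IH] a [|i] //= /andP[h1 hp] hi; first by rewrite /pt /= ltW.
exact: IH hp hi.
Qed.

(** By uniform continuity, sums with arbitrary sample points are close to those
   with left end points. *)
Lemma riemann_int G a b z : 0 <= a -> a <= b ->
  (forall s, a <= s -> s <= b -> past s (G s)) ->
  (forall xi, space0 B xi -> unif_cont G a b xi) ->
  is_int B riem G a b z -> is_riemann_integral B G a b z.
Proof.
move=> a0 ab hG uc [zg h]; split=> // xi hxi e ee; have e2 : 0 < e / 2 by lra.
have [d1 d10 hd1] := h xi hxi _ e2.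
have k0 : 0 < b - a + 1 by lra.
have e3 : 0 < e / 2 / (b - a + 1) by rewrite divr_gt0.
have [d2 d20 hd2] := uc xi hxi _ e3.
exists (Num.min d1 d2) => [|p tag pp mp ht]; first by rewrite lt_min d10.
have [hp lp] := pp.
have mp1 : mesh_lt a p d1 by move=> i /mp; rewrite lt_min => /andP[].
have := hd1 p pp mp1; rewrite -riemann_sum_left.
have hi i : (i < size p)%N -> hnorm ((G (tag i) - G (pt a p i)) xi) <= e / 2 / (b - a + 1).
  move=> hi; have /andP[t1 t2] := ht i hi; have [p1 p2] := pt_in hp hi; rewrite lp in p2.
  have := mp i hi; rewrite lt_min => /andP[_ m2].
  by apply/ltW/hd2; rewrite ?ger0_norm ?subr_ge0 //; lra.
have := riemann_sum_tag hp hi; rewrite lp.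
have e4 : (b - a) * (e / 2 / (b - a + 1)) <= e / 2.
  rewrite mulrA ler_pdivrMr //; lra.
have bs tg : (forall i, (i < size p)%N -> a <= tg i <= b) -> bounded_op (riemann_sum G a p tg).
  move=> h1; rewrite /riemann_sum; apply: (@past_bop _ _ _ B b).
  apply: (gns_sum (filt_vn B (itv_oc b))) => i _; apply: (gns_scale (filt_vn B (itv_oc b))).
  by have /andP[t1 t2] := h1 i (ltn_ord i); apply: (past_le t2); exact: hG.
rewrite dsnE; first last.
- apply: bop_sub (gns_bop zg); apply: bs => i hi1.
  by have /andP[t1 t2] := ht i hi1; have [p1 p2] := pt_in hp hi1; rewrite lp in p2; apply/andP; split; lra.
- exact: Hip.
have := hnorm_triB (riemann_sum G a p tag xi) (riemann_sum G a p (pt a p) xi) (z xi).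
by rewrite !fct_subE; lra.
Qed.
End Instances.

(** * Compactness on real intervals *)

Section Compactness.
Variable R : realType.
Implicit Types (a b s t : R).

Lemma within_cvgP (D : set R) (t : R) (f : R -> R) (l : R) :
  f @ within D (nbhs t) --> l <-> forall e, 0 < e -> exists2 d, 0 < d &
    forall s, D s -> `|t - s| < d -> `|l - f s| < e.
Proof.
split=> [/cvgrPdist_lt h e /h/nbhs_ballP[d d0 hd]|h].
  by exists d => // s Ds ts; exact: hd.
apply/cvgrPdist_lt => e /h[d d0 hd]; apply/nbhs_ballP; exists d => // s ts Ds.
exact: hd.
Qed.

(** A gauge on a compact interval has a finite subcover; all compactness used
   below is in this form. *)
Lemma gauge_cover (dl : R -> R) a b : (forall c, 0 < dl c) ->
  exists2 cs : seq R, (forall c, c \in cs -> a <= c <= b) &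
    forall s, a <= s <= b -> exists2 c, c \in cs & `|c - s| < dl c.
Proof.
move=> d0; have := @segment_compact R a b; rewrite compact_cover.
move=> /(_ R `[a, b]%classic (fun c => ball c (dl c))) [].
- by move=> c _; exact: ball_open.
- by move=> s hs; exists s => //; exact: ballxx.
move=> D' hD hc; exists (finmap.enum_fset D') => [c cD|s hs].
  by have := hD c cD; rewrite inE /= in_itv.
have [c cD hb] := hc s (ltac:(by rewrite /= in_itv)).
by exists c.
Qed.

Lemma seq_ub (T : eqType) (f : T -> R) (s : seq T) :
  exists2 M, 0 <= M & forall x, x \in s -> f x <= M.
Proof.
elim: s => [|x s [M M0 hM]]; first by exists 0.
exists (Num.max M (f x)) => [|y]; first by rewrite le_max M0.
by rewrite inE le_max => /predU1P[->|/hM ->]; rewrite ?lexx ?orbT.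
Qed.

Lemma seq_min_pos (T : eqType) (f : T -> R) (s : seq T) : (forall x, 0 < f x) ->
  exists2 d, 0 < d & forall x, x \in s -> d <= f x.
Proof.
move=> f0; elim: s => [|x s [d d0 hd]]; first by exists 1.
exists (Num.min d (f x)) => [|y]; first by rewrite lt_min d0 f0.
by rewrite inE ge_min => /predU1P[->|/hd ->]; rewrite ?lexx ?orbT.
Qed.

(** Uniform continuity on compact intervals; the gauge is half the local modulus,
   so that two close points share one centre. *)
Lemma heine (f : R -> R) a b : {within `[0, +oo[, continuous f} -> 0 <= a ->
  forall e : R, 0 < e -> exists2 d : R, 0 < d & forall s s',
    a <= s -> s <= b -> a <= s' -> s' <= b -> `|s - s'| < d -> `|f s - f s'| < e.
Proof.
move=> /subspace_continuousP fc a0 e e0; have e2 : 0 < e / 2 by lra.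
have ex c : exists d, 0 < d /\ (0 <= c -> forall s, 0 <= s -> `|c - s| < d -> `|f c - f s| < e / 2).
  have [c0|c0] := leP 0 c; last by exists 1; split.
  have c0' : `[0, +oo[%classic c by rewrite /= in_itv /= c0.
  have /within_cvgP/(_ _ e2)[d d0 hd] := fc c c0'.
  by exists d; split=> // _ s s0; apply: hd; rewrite /= in_itv /= s0.
have [dl hdl] := choice ex.
have dl2 c : 0 < dl c / 2 by have [] := hdl c; lra.
have [cs hcs hcov] := @gauge_cover (fun c => dl c / 2) a b dl2.
have [d d0 hd] := seq_min_pos cs dl2.
exists d => // s s' as_ sb as' s'b ss'.
have [c ccs cs1] := hcov s (ltac:(by rewrite as_ sb)).
have /andP[ac _] := hcs c ccs; have c0 : 0 <= c by lra.
have [_ /(_ c0) hc] := hdl c; have := hd c ccs.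
have h1 := hc s (le_trans a0 as_); have h2 := hc s' (le_trans a0 as').
have t1 := ler_distD s c s'; have t2 := ler_distD (f c) (f s) (f s').
rewrite (distrC (f s) (f c)) in t2 => hd'.
have {}h1 : `|f c - f s| < e / 2 by apply: h1; have := dl2 c; lra.
have {}h2 : `|f c - f s'| < e / 2 by apply: h2; lra.
by lra.
Qed.

Lemma path_cover t0 (p : seq R) s : path <%R t0 p -> t0 <= s -> s <= last t0 p ->
  s \in t0 :: p \/ exists2 i, (i < size p)%N & pt t0 p i < s < pt t0 p i.+1.
Proof.
elim: p t0 => [|m p IH] t0 /=.
  by move=> _ h1 h2; left; rewrite inE eq_le h1 h2.
move=> /andP[h1 hp] ts sl; have [ms|sm] := leP m s.
  have [h|[i hi h]] := IH m hp ms sl; last by right; exists i.+1.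
  by left; rewrite inE h orbT.
have [->|st] := eqVneq s t0; first by left; rewrite inE eqxx.
by right; exists 0%N => //; rewrite /pt /= sm andbT lt_neqAle eq_sym st.
Qed.

Lemma sqrt_small (D e : R) : 0 <= D -> 0 < e -> exists2 d : R, 0 < d &
  forall z, 0 <= z -> z < d -> Num.sqrt z * D < e.
Proof.
move=> D0 e0; have D1 : 0 < D + 1 by lra.
have q0 : 0 < e / (D + 1) by rewrite divr_gt0.
exists ((e / (D + 1)) ^+ 2) => [|z z0 zd]; first by rewrite exprn_gt0.
have : Num.sqrt z < e / (D + 1).
  by rewrite -[ltRHS]gtr0_norm // -sqrtr_sqr ltr_sqrt // exprn_gt0.
by rewrite ltr_pdivlMr //; have := sqrtr_ge0 z; move: (Num.sqrt z) => y; nra.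
Qed.

Lemma pow_small (A e : R) : 0 <= A -> 0 < e -> exists N, forall n, (N <= n)%N -> A / 2 ^+ n < e.
Proof.
move=> A0 e0; have A1 : 0 < A + 1 by lra.
have [N hN] := invS_small (divr_gt0 e0 A1); exists N => n /hN.
have pn : 0 < 2 ^+ n :> R by rewrite exprn_gt0.
have h : (n.+1%:R : R) <= 2 ^+ n by rewrite -natrX ler_nat ltn_expl.
rewrite ltr_pdivlMr // mulrC -[_ / _]/(_ * _) ltr_pdivrMr // => h1.
rewrite ltr_pdivrMr //.
by have := ler_wpM2l (ltW e0) h; lra.
Qed.
End Compactness.

(** * Boundedness of processes *)

Section Processes.
Variables (R : realType) (H : completeNormedModType R[i]).
Variable ip : {dot H for (@Num.conj R[i])}.
Variable B : bernoulli_shift ip.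
Local Notation Hip := (shift_hilbert B).
Implicit Types (s t a b T : R) (X Y : R -> H -> H).

Lemma stop_continuousP (D : set R) X : (forall s, D s -> gmod B (X s)) ->
  stop_continuous_on B D X <-> forall t, D t -> forall xi, space0 B xi ->
    forall e, 0 < e -> exists2 d, 0 < d & forall s, D s -> `|t - s| < d ->
      hnorm ((X s - X t) xi) < e.
Proof.
move=> gX; have eq s t xi : D s -> D t -> `|0 - dsn ip xi (X s - X t)| = hnorm ((X s - X t) xi).
  move=> Ds Dt; rewrite sub0r normrN dsnE; [by rewrite ger0_norm|exact: Hip|].
  by apply: bop_sub; [exact: gns_bop (gX s Ds) | exact: gns_bop (gX t Dt)].
split=> h t Dt xi hxi.
  move=> e e0; have /within_cvgP/(_ e e0)[d d0 hd] := h t Dt xi hxi.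
  by exists d => // s Ds ts; rewrite -eq //; exact: hd.
apply/within_cvgP => e e0; have [d d0 hd] := h t Dt xi hxi e e0.
by exists d => // s Ds ts; rewrite eq //; exact: hd.
Qed.

Lemma stop_bounded a b X xi : (forall s, `[a, b]%classic s -> gmod B (X s)) ->
  stop_continuous_on B `[a, b] X -> space0 B xi ->
  exists2 M : R, 0 <= M & forall s, a <= s <= b -> hnorm (X s xi) <= M.
Proof.
move=> gX /(stop_continuousP gX) h hxi.
have ex c : exists d : R, 0 < d /\ (a <= c <= b -> forall s, a <= s <= b ->
    `|c - s| < d -> hnorm (X s xi) <= hnorm (X c xi) + 1).
  have [hc|hc] := boolP (a <= c <= b); last by exists 1; split.
  have [d d0 hd] := h c (ltac:(by rewrite /= in_itv)) xi hxi 1 ltr01.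
  exists d; split=> // _ s hs cs; have := hd s (ltac:(by rewrite /= in_itv)) cs.
  by have := hnorm_le_diff (X s xi) (X c xi); rewrite fct_subE; lra.
have [dl hdl] := choice ex.
have [cs hcs hcov] := @gauge_cover R dl a b (fun c => (hdl c).1).
have [M M0 hM] := seq_ub (fun c => hnorm (X c xi) + 1) cs.
exists M => // s hs; have [c ccs cd] := hcov s hs.
by apply: le_trans (hM c ccs); apply: (hdl c).2 => //; exact: hcs.
Qed.

(** Each piece extends continuously to its closed interval and is bounded there;
   finitely many partition points remain. *)
Lemma procV_bounded X T xi : procV B X -> 0 <= T -> space0 B xi ->
  exists2 M : R, 0 <= M & forall s, 0 <= s -> s <= T -> hnorm (X s xi) <= M.
Proof.
move=> [_ pX] T0 hxi; have [p [pp pl] hp] := pX T T0.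
have ex i : exists M : R, (i < size p)%N -> forall s, pt 0 p i < s < pt 0 p i.+1 ->
    hnorm (X s xi) <= M.
  have [hi|hi] := boolP (i < size p)%N; last by exists 0.
  have [Y [gY cY XY]] := hp i hi; have [M _ hM] := stop_bounded gY cY hxi.
  exists M => _ s hs; rewrite XY //; apply: hM.
  by move: hs => /andP[/ltW -> /ltW ->].
have [f hf] := choice ex.
have [M1 M10 hM1] := seq_ub f (iota 0 (size p)).
have [M2 M20 hM2] := seq_ub (fun s => hnorm (X s xi)) (0 :: p).
exists (M1 + M2) => [|s s0 sT]; first exact: addr_ge0.
have [sp|[i hi hs]] := path_cover pp s0 (ltac:(by rewrite pl)).
  by have := hM2 s sp; lra.
have := hf i hi s hs; have := hM1 i; rewrite mem_iota /= => /(_ hi); lra.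
Qed.

(** Walk from a in steps of length d / 2, over which X changes by at most 1. *)
Lemma unif_bounded X a b xi : unif_cont X a b xi ->
  exists2 M : R, 0 <= M & forall s, a <= s -> s <= b -> hnorm (X s xi) <= M.
Proof.
move=> /(_ 1 ltr01)[d d0 hd].
have step n : forall s, a <= s -> s <= b -> s <= a + n%:R * (d / 2) ->
    hnorm (X s xi) <= hnorm (X a xi) + n%:R.
  elim: n => [|n IH] s as_ sb.
    rewrite mul0r addr0 => sa; have -> : s = a by apply/eqP; rewrite eq_le sa.
    by rewrite addr0.
  rewrite -natr1 mulrDl mul1r => sn.
  have [h|h] := leP s (a + n%:R * (d / 2)); first by have := IH s as_ sb h; lra.
  have n0 : 0 <= n%:R * (d / 2) by rewrite mulr_ge0 // ltW // divr_gt0.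
  have ds : `|s - (a + n%:R * (d / 2))| < d by rewrite ger0_norm; lra.
  have h1 := IH (a + n%:R * (d / 2)); have h2 := hd s (a + n%:R * (d / 2)) as_ sb.
  move: (n%:R * (d / 2)) sn h n0 ds h1 h2 => z sn h n0 ds h1 h2.
  have {}h1 : hnorm (X (a + z) xi) <= hnorm (X a xi) + n%:R by apply: h1; lra.
  have {}h2 : hnorm ((X s - X (a + z)) xi) < 1 by apply: h2; lra.
  by have := hnorm_le_diff (X s xi) (X (a + z) xi); rewrite fct_subE in h2; lra.
have [n hn] : exists n, b <= a + n%:R * (d / 2).
  have d2 : 0 < d / 2 by lra.
  have := archi_boundP (_ : 0 <= `|b - a| / (d / 2)).
  rewrite divr_ge0 ?(ltW d2) // => /(_ isT); rewrite ltr_pdivrMr // => h.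
  exists (Num.bound (`|b - a| / (d / 2))); move: h; move: (Num.bound _) => n.
  by have := ler_norm (b - a); lra.
exists (hnorm (X a xi) + n%:R) => [|s as_ sb]; first exact: addr_ge0.
by apply: step => //; lra.
Qed.
End Processes.

(** * Lipschitz coefficients along adapted processes *)

Section Coefficients.
Variables (R : realType) (H : completeNormedModType R[i]).
Variable ip : {dot H for (@Num.conj R[i])}.
Variable B : bernoulli_shift ip.
Local Notation Hip := (shift_hilbert B).
Local Notation past := (past B).
Implicit Types (s t T : R) (X Y : R -> H -> H).

(** The hypothesis on a coefficient in terms of norms of values, with the constants
   for [0, T]. *)
Definition lip_coef (ga : R -> (H -> H) -> (H -> H)) := forall xi, space0 B xi ->
  exists2 f : R -> R, {within `[0, +oo[, continuous f} &
    forall T, 0 <= T -> exists2 C : R, 0 <= C & forall x y t s,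
      gmod B x -> gmod B y -> 0 <= t <= T -> 0 <= s <= T ->
      hnorm ((ga t x - ga s x) xi) <= C * (hnorm xi ^+ 2 + hnorm (x xi)) * `|f t - f s| /\
      hnorm ((ga t x - ga t y) xi) <= C * hnorm ((x - y) xi).

Lemma coef_lip_dsn ga : (forall xi, space0 B xi ->
    exists2 f : R -> R, {within `[0, +oo[, continuous f} &
    forall T, 0 <= T -> exists2 C : R, 0 <= C & forall x y t s, gmod B x -> gmod B y ->
      0 <= t <= T -> 0 <= s <= T ->
      dsn ip xi (ga t x - ga s x) <= C * (hnorm xi ^+ 2 + dsn ip xi x) * `|f t - f s| /\
      dsn ip xi (ga t x - ga t y) <= C * dsn ip xi (x - y)) ->
  coefficient B ga -> lip_coef ga.
Proof.
move=> h Hga xi hxi; have [f fc hf] := h xi hxi; exists f => // T T0.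
have [C C0 hC] := hf T T0; exists C => // x y t s gx gy ht hs.
have b z : gmod B z -> bounded_op z := fun gz => gns_bop gz.
have gt z r : gmod B z -> 0 <= r <= T -> bounded_op (ga r z).
  by move=> gz /andP[r0 _]; apply: b; exact: (co_gmod Hga).
have := hC x y t s gx gy ht hs.
by rewrite !(dsnE Hip) //; do ?[exact: b|exact: gt|apply: bop_sub].
Qed.

(** Adaptedness from t0 on; earlier times do not enter the equation. *)
Definition past_on (t0 : R) X := forall t, t0 <= t -> past t (X t).

Variables (t0 : R) (Ht0 : 0 <= t0).

Lemma past_onP X T : past_on t0 X -> forall s, t0 <= s -> s <= T -> past s (X s).
Proof. by move=> pX s ts _; exact: pX. Qed.

Section OneCoefficient.
Variables (ga : R -> (H -> H) -> (H -> H)) (Hga : coefficient B ga) (Lga : lip_coef ga).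

Lemma coef_past X : past_on t0 X -> past_on t0 (fun s => ga s (X s)).
Proof. by move=> pX t tt; apply: (co_adapted Hga) (pX t tt); exact: le_trans tt. Qed.

Lemma coef_lip xi T : space0 B xi -> exists2 C : R, 0 <= C & forall X Y, past_on t0 X -> past_on t0 Y ->
  forall s, t0 <= s -> s <= T ->
    hnorm ((ga s (X s) - ga s (Y s)) xi) <= C * hnorm ((X s - Y s) xi).
Proof.
move=> hxi; have [f _ hf] := Lga hxi.
have [t0T|Tt0] := leP t0 T; last by exists 0 => // X Y _ _ s ts sT; exfalso; have := lt_le_trans Tt0 ts; lra.
have [C C0 hC] := hf T (le_trans Ht0 t0T); exists C => // X Y pX pY s ts sT.
have hs : 0 <= s <= T by rewrite sT andbT (le_trans Ht0 ts).
by have [_ ->] := hC (X s) (Y s) s s (past_gns (pX s ts)) (past_gns (pY s ts)) hs hs.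
Qed.

(** Split the increment into a change of time, controlled by f and the bound of X,
   and a change of the argument, controlled by the Lipschitz constant. *)
Lemma coef_unif X xi T : past_on t0 X -> space0 B xi -> unif_cont X t0 T xi ->
  unif_cont (fun s => ga s (X s)) t0 T xi.
Proof.
move=> pX hxi uX e e0.
have [Tt0|t0T] := ltP T t0.
  by exists 1 => // s s' h1 h2; exfalso; have := le_lt_trans h2 Tt0; lra.
have [f fc hf] := Lga hxi; have [C C0 hC] := hf T (le_trans Ht0 t0T).
have [M M0 hM] := unif_bounded uX.
pose D := C * (hnorm xi ^+ 2 + M) + 1.
have CM : 0 <= C * (hnorm xi ^+ 2 + M) by rewrite mulr_ge0 // addr_ge0 // sqr_ge0.
have D0 : 0 < D by rewrite /D; lra.
have e2 : 0 < e / 2 / D by rewrite divr_gt0 // divr_gt0.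
have e3 : 0 < e / 2 / (C + 1) by rewrite !divr_gt0 //; lra.
have [d1 d10 hd1] := heine T fc Ht0 e2.
have [d2 d20 hd2] := uX _ e3.
exists (Num.min d1 d2) => [|s s' ts sT ts' s'T]; first by rewrite lt_min d10.
rewrite lt_min => /andP[ss1 ss2].
have hs : 0 <= s <= T by rewrite sT andbT (le_trans Ht0 ts).
have hs' : 0 <= s' <= T by rewrite s'T andbT (le_trans Ht0 ts').
have [h1 _] := hC (X s) (X s') s s' (past_gns (pX s ts)) (past_gns (pX s' ts')) hs hs'.
have [_ h2] := hC (X s) (X s') s' s (past_gns (pX s ts)) (past_gns (pX s' ts')) hs' hs.
have f1 := hd1 s s' ts sT ts' s'T ss1; have f2 := hd2 s s' ts sT ts' s'T ss2.
have g1 : hnorm ((ga s (X s) - ga s' (X s)) xi) < e / 2.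
  apply: le_lt_trans h1 _; apply: (@le_lt_trans _ _ (C * (hnorm xi ^+ 2 + M) * `|f s - f s'|)).
    apply: ler_wpM2r => //; apply: ler_wpM2l => //; rewrite lerD2l; exact: hM.
  move: f1; rewrite ltr_pdivlMr // /D; move: (C * _) (`|f s - f s'|) CM (normr_ge0 (f s - f s')) => x y; nra.
have g2 : hnorm ((ga s' (X s) - ga s' (X s')) xi) < e / 2.
  apply: le_lt_trans h2 _; move: f2; rewrite ltr_pdivlMr; last lra.
  move: (hnorm _) (hnorm_ge0 ((X s - X s') xi)) => x; nra.
have := hnorm_triB (ga s (X s) xi) (ga s' (X s) xi) (ga s' (X s') xi).
by move: g1 g2; rewrite !fct_subE; lra.
Qed.

(** One half of the contraction estimate: the difference of two integrals is the
   integral of the difference, and the weight exp (k t) beats the Lipschitz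
   constant once k exceeds 8 L C^2. *)
Lemma int_contraction (mu : R -> R -> (H -> H) -> H -> H) (L C k M T t : R)
    X Y xi (a b : H -> H) :
  increments B mu -> 0 <= L -> estimate B mu T L -> 0 < k -> 0 <= C -> 8 * L * C ^+ 2 <= k ->
  0 <= M -> t0 <= t -> t <= T -> past_on t0 X -> past_on t0 Y ->
  (forall s, t0 <= s -> s <= T -> hnorm ((ga s (X s) - ga s (Y s)) xi) <= C * hnorm ((X s - Y s) xi)) ->
  (forall s, t0 <= s -> s <= t -> hnorm ((X s - Y s) xi) <= M * expR (k * (s - t0))) ->
  is_int B mu (fun s => ga s (X s)) t0 t a -> is_int B mu (fun s => ga s (Y s)) t0 t b ->
  hnorm ((a - b) xi) <= M / 4 * expR (k * (t - t0)).
Proof.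
move=> hmu L0 est k0 C0 hk M0 tt tT pX pY hC hM ia ib.
have hX := past_onP (T := t) (coef_past pX); have hY := past_onP (T := t) (coef_past pY).
have iab := int_sub hmu Ht0 tt hX hY ia ib.
have hXY s : t0 <= s -> s <= t -> past s (ga s (X s) - ga s (Y s)).
  by move=> h1 h2; apply: pastB; [exact: hX | exact: hY].
have k2 : 0 < 2 * k by lra.
have := @int_le_exp _ _ _ B mu hmu T L t0 t _ L0 est Ht0 tt tT hXY _ iab
  (2 * k) ((C * M) ^+ 2) xi k2 (sqr_ge0 _).
move=> h; rewrite -(ler_pXn2r (n := 2)) ?nnegrE //; last first.
  by rewrite mulr_ge0 ?expR_ge0 // divr_ge0.
apply: le_trans (h _) _ => [s ts st|].
  have -> : 2 * k * (s - t0) = k * (s - t0) + k * (s - t0) by ring.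
  rewrite expRD -expr2 -exprMn ler_pXn2r ?nnegrE //; last by rewrite !mulr_ge0 ?expR_ge0.
  apply: le_trans (hC s ts (le_trans (ltW st) tT)) _; rewrite -mulrA.
  by apply: ler_wpM2l => //; apply: hM => //; exact: ltW.
have -> : 2 * k * (t - t0) = k * (t - t0) + k * (t - t0) by ring.
rewrite expRD -expr2 [leRHS]exprMn.
set W := expR _ ^+ 2; have W0 : 0 <= W by exact: sqr_ge0.
have -> : L * ((C * M) ^+ 2 * W / (2 * k)) = (8 * L * C ^+ 2) * (M ^+ 2 * W) / (16 * k).
  by field; rewrite gt_eqF.
rewrite ler_pdivrMr; last lra.
apply: le_trans (ler_wpM2r (mulr_ge0 (sqr_ge0 M) W0) hk) _.
by rewrite le_eqVlt; apply/orP; left; apply/eqP; field.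
Qed.
End OneCoefficient.
End Coefficients.

(** * Picard iteration *)

Section Picard.
Variables (R : realType) (H : completeNormedModType R[i]).
Variable ip : {dot H for (@Num.conj R[i])}.
Variable B : bernoulli_shift ip.
Local Notation Hip := (shift_hilbert B).
Local Notation past := (past B).
Local Notation past_on := (past_on B).
Implicit Types (s t T : R) (X Y : R -> H -> H).

Variables (c : R -> H -> H) (Hc : additive_cocycle B c) (Hcentred : centred B c).
Variables (al be : R -> (H -> H) -> (H -> H)).
Hypotheses (Hal : coefficient B al) (Hbe : coefficient B be).
Hypotheses (Lal : lip_coef B al) (Lbe : lip_coef B be).
Variables (t0 : R) (Ht0 : 0 <= t0) (x0 : H -> H) (Hx0 : past t0 x0).

Local Notation mu := (dc B c).
Local Notation Imu := (dc_increments Hc).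
Local Notation Iriem := (riem_increments B).

(** The processes to which the integrals apply: adapted with uniformly continuous
   trajectories on compact intervals. *)
Definition good X := past_on t0 X /\
  forall xi, space0 B xi -> forall T, unif_cont X t0 T xi.

(** Y is the right-hand side of the integral equation evaluated at X; solutions
   are the X with picard X X. *)
Definition picard X Y := forall t, t0 <= t -> exists a b : H -> H,
  [/\ is_int B (riem (H := H)) (fun s => al s (X s)) t0 t a,
      is_int B mu (fun s => be s (X s)) t0 t b & Y t = x0 + a + b].

(** The weight exp (k t) makes the iteration a contraction on [t0, T]. *)
Definition close X Y xi T k M := forall t, t0 <= t -> t <= T ->
  hnorm ((X t - Y t) xi) <= M * expR (k * (t - t0)).

(** Each of the two integrals contributes a factor 1 / 4. *)
Lemma contraction xi T : space0 B xi -> t0 <= T -> exists2 k : R, 0 < k &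
  forall X Y X' Y' M, 0 <= M -> past_on t0 X -> past_on t0 Y -> picard X X' -> picard Y Y' ->
    close X Y xi T k M -> close X' Y' xi T k (M / 2).
Proof.
move=> hxi t0T; have T0 : 0 <= T by exact: le_trans t0T.
have [L L0 est] := dc_estimate Hc Hcentred.
have [C1 C10 h1] := coef_lip Ht0 Lal T hxi.
have [C2 C20 h2] := coef_lip Ht0 Lbe T hxi.
have P1 : 0 <= 8 * T * C1 ^+ 2 by rewrite !mulr_ge0 // sqr_ge0.
have P2 : 0 <= 8 * L * C2 ^+ 2 by rewrite !mulr_ge0 // sqr_ge0.
have k0 : 0 < 8 * T * C1 ^+ 2 + 8 * L * C2 ^+ 2 + 1 by lra.
have k1 : 8 * T * C1 ^+ 2 <= 8 * T * C1 ^+ 2 + 8 * L * C2 ^+ 2 + 1 by lra.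
have k2 : 8 * L * C2 ^+ 2 <= 8 * T * C1 ^+ 2 + 8 * L * C2 ^+ 2 + 1 by lra.
exists (8 * T * C1 ^+ 2 + 8 * L * C2 ^+ 2 + 1) => // X Y X' Y' M M0 pX pY XX' YY' hM t tt tT.
have [a [b [ia ib ->]]] := XX' t tt; have [a' [b' [ia' ib' ->]]] := YY' t tt.
have hM' s : t0 <= s -> s <= t -> hnorm ((X s - Y s) xi) <=
    M * expR ((8 * T * C1 ^+ 2 + 8 * L * C2 ^+ 2 + 1) * (s - t0)).
  by move=> ts st; apply: hM => //; exact: le_trans tT.
have g1 := int_contraction Ht0 Hal Iriem T0 (riem_estimate (T := T)) k0 C10 k1 M0 tt tT pX pY
  (h1 X Y pX pY) hM' ia ia'.
have g2 := int_contraction Ht0 Hbe Imu L0 (est T) k0 C20 k2 M0 tt tT pX pY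
  (h2 X Y pX pY) hM' ib ib'.
have -> : x0 + a + b - (x0 + a' + b') = (a - a') + (b - b').
  by rewrite opprD addrACA; congr (_ + _); rewrite opprD addrACA subrr add0r.
by rewrite fct_addE; have := hnormD ((a - a') xi) ((b - b') xi); lra.
Qed.

Lemma good_past X : good X -> past_on t0 X. Proof. by case. Qed.

Lemma good_ints X s t : good X -> t0 <= s -> s <= t -> exists a b : H -> H,
  [/\ past t a, past t b, is_int B (riem (H := H)) (fun r => al r (X r)) s t a &
      is_int B mu (fun r => be r (X r)) s t b].
Proof.
move=> [pX uX] ts st; have s0 : 0 <= s by exact: le_trans ts.
have [L L0 est] := dc_estimate Hc Hcentred.
have sub ga : coefficient B ga -> lip_coef B ga ->
    (forall r, s <= r -> r <= t -> past r (ga r (X r))) /\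
    (forall xi, space0 B xi -> unif_cont (fun r => ga r (X r)) s t xi).
  move=> Hga Lga; split=> [r sr _|xi hxi e e0].
    by apply: (coef_past Ht0 Hga pX); exact: le_trans sr.
  have [d d0 hd] := coef_unif Ht0 Lga (T := t) pX hxi (uX xi hxi t) e0.
  by exists d => // r r' sr rt sr' r't; apply: hd => //; exact: le_trans ts _.
have [p1 u1] := sub al Hal Lal; have [p2 u2] := sub be Hbe Lbe.
have t00 : 0 <= t by exact: le_trans st.
have [a pa ia] := int_exists Iriem t00 (riem_estimate (T := t)) s0 st (lexx t) p1 u1.
have [b pb ib] := int_exists Imu L0 (est t) s0 st (lexx t) p2 u2.
by exists a, b.
Qed.

Lemma picard_ex X : good X -> exists Y, picard X Y /\ forall t, t < t0 -> Y t = 0.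
Proof.
move=> gX; have ex t : exists y : H -> H, (t0 <= t -> exists a b : H -> H,
  [/\ is_int B (riem (H := H)) (fun s => al s (X s)) t0 t a,
      is_int B mu (fun s => be s (X s)) t0 t b & y = x0 + a + b]) /\ (t < t0 -> y = 0).
  have [tt|tt] := leP t0 t; last by exists 0.
  have [a [b [_ _ ia ib]]] := good_ints gX (lexx t0) tt.
  by exists (x0 + a + b); split=> // _; exists a, b.
have [Y hY] := choice ex; exists Y; split=> t h; exact: (hY t).1 || exact: (hY t).2.
Qed.

Lemma coef_past_on X s t : past_on t0 X -> t0 <= s ->
  (forall r, s <= r -> r <= t -> past r (al r (X r))) /\
  (forall r, s <= r -> r <= t -> past r (be r (X r))).
Proof.
move=> pX ts; split=> r sr _.
  by apply: (coef_past Ht0 Hal pX); exact: le_trans sr.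
by apply: (coef_past Ht0 Hbe pX); exact: le_trans sr.
Qed.

(** Additivity of the integrals in the interval. *)
Lemma picard_incr X Y s t : good X -> picard X Y -> t0 <= s -> s <= t ->
  exists a b : H -> H, [/\ is_int B (riem (H := H)) (fun r => al r (X r)) s t a,
      is_int B mu (fun r => be r (X r)) s t b & Y t = Y s + a + b].
Proof.
move=> gX XY ts st; have tt := le_trans ts st.
have [a1 [b1 [ia1 ib1 ->]]] := XY t tt; have [a2 [b2 [ia2 ib2 ->]]] := XY s ts.
have [a [b [_ _ ia ib]]] := good_ints gX ts st.
have [h1 h2] := coef_past_on t (good_past gX) (lexx t0).
exists a, b; split=> //.
rewrite (int_add Iriem Ht0 ts st h1 ia2 ia ia1) (int_add Imu Ht0 ts st h2 ib2 ib ib1).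
by rewrite !addrA; congr (_ + _); rewrite -!addrA; congr (_ + (_ + _)); rewrite addrC.
Qed.

(** The image of the iteration is Hoelder continuous with exponent 1 / 2, with a
   constant proportional to a bound of the coefficients at u. *)
Lemma picard_holder T : t0 <= T -> exists2 D : R, 0 < D & forall X Y u M, good X -> picard X Y ->
  0 <= M ->
  (forall r, t0 <= r -> r <= T -> hnorm (al r (X r) u) <= M /\ hnorm (be r (X r) u) <= M) ->
  forall s t, t0 <= s -> s <= t -> t <= T ->
    hnorm ((Y t - Y s) u) <= Num.sqrt (t - s) * (D * M).
Proof.
move=> t0T; have T0 := le_trans Ht0 t0T.
have [L L0 est] := dc_estimate Hc Hcentred.
exists (Num.sqrt T + Num.sqrt L + 1) => [|X Y u M gX XY M0 hM s t ts st tT].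
  by have := sqrtr_ge0 T; have := sqrtr_ge0 L; lra.
have s0 := le_trans Ht0 ts.
have [a [b [ia ib ->]]] := picard_incr gX XY ts st.
have [h1 h2] := coef_past_on t (good_past gX) ts.
have key (L' : R) z : 0 <= L' -> hnorm (z u) ^+ 2 <= L' * ((t - s) * M ^+ 2) ->
    hnorm ((z : H -> H) u) <= Num.sqrt (t - s) * (Num.sqrt L' * M).
  move=> L0' h; rewrite -(ler_pXn2r (n := 2)) ?nnegrE ?mulr_ge0 ?sqrtr_ge0 //.
  rewrite !exprMn !sqr_sqrtr // ?subr_ge0 //.
  by apply: le_trans h _; rewrite le_eqVlt; apply/orP; left; apply/eqP; ring.
have M2 z : hnorm (z : H) <= M -> hnorm z ^+ 2 <= M ^+ 2 by move=> h; rewrite ler_pXn2r ?nnegrE.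
have e1 : hnorm (a u) <= Num.sqrt (t - s) * (Num.sqrt T * M).
  apply: key => //; apply: (int_le_cst Iriem T0 (riem_estimate (T := T)) s0 st tT h1 ia).
  by move=> r sr rt; apply: M2; have [] := hM r (le_trans ts sr) (le_trans (ltW rt) tT).
have e2 : hnorm (b u) <= Num.sqrt (t - s) * (Num.sqrt L * M).
  apply: key => //; apply: (int_le_cst Imu L0 (est T) s0 st tT h2 ib).
  by move=> r sr rt; apply: M2; have [] := hM r (le_trans ts sr) (le_trans (ltW rt) tT).
have -> : Y s + a + b - Y s = a + b by rewrite -(addrA (Y s)) [LHS]addrAC subrr add0r.
rewrite fct_addE; apply: le_trans (hnormD _ _) _; apply: le_trans (lerD e1 e2) _.
rewrite -mulrDr; apply: ler_wpM2l; first exact: sqrtr_ge0.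
by rewrite -mulrDl; apply: ler_wpM2r => //; lra.
Qed.

Lemma coef_bounded X T xi : good X -> space0 B xi -> exists2 M : R, 0 <= M &
  forall r, t0 <= r -> r <= T -> hnorm (al r (X r) xi) <= M /\ hnorm (be r (X r) xi) <= M.
Proof.
move=> [pX uX] hxi.
have [M1 M10 h1] := unif_bounded (coef_unif Ht0 Lal pX hxi (uX xi hxi T)).
have [M2 M20 h2] := unif_bounded (coef_unif Ht0 Lbe pX hxi (uX xi hxi T)).
exists (M1 + M2) => [|r tr rT]; first exact: addr_ge0.
by have := h1 r tr rT; have := h2 r tr rT; lra.
Qed.

Lemma picard_good X Y : good X -> picard X Y -> good Y.
Proof.
move=> gX XY; split=> [t tt|xi hxi T e e0].
  have [a [b [ia ib ->]]] := XY t tt; have [h1 h2] := coef_past_on t (good_past gX) (lexx t0).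
  apply: pastD; first apply: pastD.
  - exact: past_le tt Hx0.
  - exact: (int_past Iriem Ht0 tt h1 ia).
  - exact: (int_past Imu Ht0 tt h2 ib).
have [Tt0|t0T] := ltP T t0.
  by exists 1 => // s s' h1 h2; exfalso; have := le_lt_trans h2 Tt0; lra.
have [D D0 hD] := picard_holder t0T; have [M M0 hM] := coef_bounded T gX hxi.
have [d d0 hd] := sqrt_small (mulr_ge0 (ltW D0) M0) e0.
have h s s' : t0 <= s -> s <= s' -> s' <= T -> s' - s < d -> hnorm ((Y s' - Y s) xi) < e.
  move=> ts ss' s'T h; apply: le_lt_trans (hD X Y xi M gX XY M0 hM s s' ts ss' s'T) _.
  by apply: hd => //; rewrite subr_ge0.
exists d => // s s' ts sT ts' s'T; have [ss'|ss'] := leP s s'.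
  rewrite fct_subE hnormB -fct_subE distrC ger0_norm ?subr_ge0 // => ?; exact: h.
by rewrite gtr0_norm ?subr_gt0 // => ?; apply: h => //; exact: ltW.
Qed.

Lemma good0 : good (fun t => if t0 <= t then x0 else 0).
Proof.
split=> [t tt|xi hxi T e e0]; first by rewrite tt; exact: past_le tt Hx0.
exists 1 => // s s' ts _ ts' _ _; rewrite ts ts' subrr.
by rewrite -[X in hnorm X]/(0 : H) hnorm0.
Qed.

Lemma close_iter X Y xi T k A n (F : nat -> R -> H -> H) : F 0%N = X -> F 1%N = Y ->
  (forall m M, 0 <= M -> close (F m.+1) (F m) xi T k M -> close (F m.+2) (F m.+1) xi T k (M / 2)) ->
  0 <= A -> close Y X xi T k A -> close (F n.+1) (F n) xi T k (A / 2 ^+ n).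
Proof.
move=> <- <- h A0 h0; elim: n => [|n IH]; first by rewrite expr0 divr1.
rewrite exprSr invfM mulrA; apply: (h) => //.
by rewrite divr_ge0 // exprn_ge0.
Qed.

(** The geometric series of the distances between consecutive iterates. *)
Lemma close_tail xi T k A (F : nat -> R -> H -> H) : 0 <= A ->
  (forall n, close (F n.+1) (F n) xi T k (A / 2 ^+ n)) ->
  forall n m, close (F (n + m)%N) (F n) xi T k (2 * A / 2 ^+ n).
Proof.
move=> A0 h n m.
have p0 j : 0 <= A / 2 ^+ j by rewrite divr_ge0 // exprn_ge0.
suff : forall t, t0 <= t -> t <= T -> hnorm ((F (n + m)%N t - F n t) xi) <=
    (2 * A / 2 ^+ n - 2 * A / 2 ^+ (n + m)) * expR (k * (t - t0)).
  move=> hh t tt tT; apply: le_trans (hh t tt tT) _; apply: ler_wpM2r; first exact: expR_ge0.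
  by have := p0 (n + m)%N; lra.
move=> t tt tT; elim: m => [|m IH].
  by rewrite addn0 !subrr mul0r -[X in hnorm X]/(0 : H) hnorm0.
have := h (n + m)%N t tt tT; rewrite addnS.
have := hnorm_triB (F (n + m).+1 t xi) (F (n + m)%N t xi) (F n t xi).
have -> : 2 * A / 2 ^+ (n + m).+1 = A / 2 ^+ (n + m).
  by rewrite exprSr; field; rewrite expf_neq0 // pnatr_eq0.
move: IH; rewrite !fct_subE; move: (expR _) => w.
have -> : 2 * A / 2 ^+ (n + m) = 2 * (A / 2 ^+ (n + m)) by ring.
by move: (A / 2 ^+ (n + m)) (2 * A / 2 ^+ n) => y z; lra.
Qed.

Lemma close_bounded X Y xi T k : good X -> good Y -> space0 B xi -> 0 < k ->
  exists2 A : R, 0 <= A & close X Y xi T k A.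
Proof.
move=> [_ uX] [_ uY] hxi k0.
have [M1 M10 h1] := unif_bounded (uX xi hxi T); have [M2 M20 h2] := unif_bounded (uY xi hxi T).
exists (M1 + M2) => [|t tt tT]; first exact: addr_ge0.
have e1 : 1 <= expR (k * (t - t0)) by rewrite -expR0 ler_expR mulr_ge0 ?subr_ge0 // ltW.
apply: le_trans (_ : M1 + M2 <= _); last by apply: ler_peMr => //; exact: addr_ge0.
have := hnormD (X t xi) (- Y t xi); rewrite fct_subE hnormN.
by have := h1 t tt tT; have := h2 t tt tT; lra.
Qed.

Lemma close_eq X Y xi T k A : 0 <= A -> (forall n, close X Y xi T k (A / 2 ^+ n)) ->
  forall t, t0 <= t -> t <= T -> X t xi = Y t xi.
Proof.
move=> A0 h t tt tT; apply/eqP; rewrite -subr_eq0; apply/eqP.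
apply: hnorm_le_eps => e e0.
have w0 := expR_gt0 (k * (t - t0)).
have [N /(_ N (leqnn N)) hN] := pow_small A0 (divr_gt0 e0 w0).
by apply: le_trans (h N t tt tT) _; apply/ltW; rewrite -ltr_pdivlMr.
Qed.

(** The iterates converge vector by vector, with geometric speed in the weighted
   norm, to a good process X; its image under the iteration has the same limit.
   The iterates F are part of the statement, because local adaptedness passes
   from them to X. *)
Lemma picard_fixpoint : exists X, [/\ good X, picard X X, forall t, t < t0 -> X t = 0 &
  exists F : nat -> R -> H -> H, [/\ F 0%N = (fun t => if t0 <= t then x0 else 0),
    forall n, good (F n), forall n, picard (F n) (F n.+1) &
    forall t, t0 <= t -> forall u, hcvg (fun n => F n t u) (X t u)]].
Proof.
have ex X : exists Y, good X -> picard X Y.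
  have [gX|ngX] := pselect (good X); last by exists X.
  by have [Y [hY _]] := picard_ex gX; exists Y.
have [Phi hPhi] := choice ex.
pose F n := iter n Phi (fun t => if t0 <= t then x0 else 0).
have gF n : good (F n).
  by elim: n => [|n IH]; [exact: good0 | exact: picard_good IH (hPhi _ IH)].
have pF n : picard (F n) (F n.+1) by exact: hPhi.
have pastF n := good_past (gF n).
have cl xi T : space0 B xi -> t0 <= T -> exists k A : R, [/\ 0 < k, 0 <= A,
    (forall X Y X' Y' M, 0 <= M -> past_on t0 X -> past_on t0 Y -> picard X X' -> picard Y Y' ->
      close X Y xi T k M -> close X' Y' xi T k (M / 2)) &
    forall n m, close (F (n + m)%N) (F n) xi T k (A / 2 ^+ n)].
  move=> hxi t0T; have [k k0 hk] := contraction hxi t0T.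
  have [A A0 hA] := close_bounded T (gF 1%N) (gF 0%N) hxi k0.
  exists k, (2 * A); split=> //; first exact: mulr_ge0.
  apply: close_tail => // n.
  apply: (close_iter (F := F) n erefl erefl _ A0 hA) => m M M0; exact: hk.
have lim t : exists x : H -> H, (t0 <= t -> past t x /\ forall u, hcvg (fun n => F n t u) (x u)) /\
    (t < t0 -> x = 0).
  have [tt|tt] := leP t0 t; last by exists 0.
  suff [x px hx] : exists2 x, past t x & forall u, hcvg (fun n => F n t u) (x u) by exists x.
  apply: gns_complete => [n|xi hxi e e0]; first exact: pastF.
  have [k [A [k0 A0 _ h]]] := cl xi t hxi tt.
  have e2 : 0 < e / 2 by lra.
  have w0 := expR_gt0 (k * (t - t0)).
  have [N hN] := pow_small A0 (divr_gt0 e2 w0); exists N => m n hm hn.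
  have {}h j : (N <= j)%N -> hnorm (F j t xi - F N t xi) < e / 2.
    move=> Nj; have := h N (j - N)%N t tt (lexx t); rewrite subnKC // fct_subE => h1.
    by apply: le_lt_trans h1 _; rewrite -ltr_pdivlMr //; exact: hN.
  have := h m hm; have := h n hn; rewrite (hnormB (F n t xi)).
  by have := hnorm_triB (F m t xi) (F N t xi) (F n t xi); lra.
have [X hX] := choice lim.
have cX t : t0 <= t -> forall u, hcvg (fun n => F n t u) (X t u) by move=> tt; have [/(_ tt)[]] := hX t.
have pX : past_on t0 X by move=> t tt; have [/(_ tt)[]] := hX t.
(* The tail estimate passes to the limit. *)
have clX xi T k A : (forall n m, close (F (n + m)%N) (F n) xi T k (A / 2 ^+ n)) ->
    forall n, close X (F n) xi T k (A / 2 ^+ n).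
  move=> h n t tt tT; rewrite fct_subE.
  apply: (@hcvg_le _ _ (fun m => F (n + m)%N t xi - F n t xi)) => [|m]; last exact: h.
  apply: hcvgB (hcvg_cst _) => e e0; have [N hN] := cX t tt xi e e0.
  by exists N => m Nm; apply: hN; exact: leq_trans Nm (leq_addl _ _).
have gX : good X.
  split=> // xi hxi T e e0.
  have [Tt0|t0T] := ltP T t0.
    by exists 1 => // s s' h1 h2; exfalso; have := le_lt_trans h2 Tt0; lra.
  have [k [A [k0 A0 _ h]]] := cl xi T hxi t0T; have {}h := clX xi T k A h.
  have w0 := expR_gt0 (k * (T - t0)); have e3 : 0 < e / 3 by lra.
  have [N /(_ N (leqnn N)) hN] := pow_small A0 (divr_gt0 e3 w0).
  have {}h s : t0 <= s -> s <= T -> hnorm (X s xi - F N s xi) < e / 3.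
    move=> ts sT; have := h N s ts sT; rewrite fct_subE => h1; apply: le_lt_trans h1 _.
    apply: (@le_lt_trans _ _ (A / 2 ^+ N * expR (k * (T - t0)))); last by rewrite -ltr_pdivlMr.
    apply: ler_wpM2l; first by rewrite divr_ge0 // exprn_ge0.
    by rewrite ler_expR ler_pM2l //; lra.
  have [d d0 hd] := (gF N).2 xi hxi T _ e3; exists d => // s s' ts sT ts' s'T ss'.
  have := hd s s' ts sT ts' s'T ss'; have := h s ts sT; have := h s' ts' s'T.
  have := hnorm_triB (X s xi) (F N s xi) (X s' xi).
  have := hnorm_triB (F N s xi) (F N s' xi) (X s' xi).
  by rewrite (hnormB (X s' xi)) !fct_subE; lra.
exists X; split=> //; last by exists F.
(* The image Y of X is within A / 2^n of X in the weighted norm for every n. *)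
- have [Y [XY _]] := picard_ex gX.
  suff eqY t : t0 <= t -> Y t = X t.
    by move=> t tt; have := XY t tt; rewrite eqY.
  move=> tt; apply: (gns_eq_on (past_gns ((picard_good gX XY).1 t tt)) (past_gns (pX t tt))) => xi hxi.
  have [k [A [k0 A0 hk h]]] := cl xi t hxi tt; have {}h := clX xi t k A h.
  apply: (close_eq (A := A) (k := k) A0 _ tt (lexx t)) => n r tr rt.
  have h1 := hk X (F n.+1) Y (F n.+2) _ (_ : 0 <= A / 2 ^+ n.+1) pX (pastF _) XY (pF _) (h _) r tr rt.
  have {}h1 := h1 (ltac:(by rewrite divr_ge0 // exprn_ge0)).
  have h2 := h n.+2 r tr rt.
  have e1 : A / 2 ^+ n.+1 / 2 = A / 2 ^+ n / 4 by rewrite exprSr; field; rewrite expf_neq0 // pnatr_eq0.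
  have e2 : A / 2 ^+ n.+2 = A / 2 ^+ n / 4 by rewrite !exprSr; field; rewrite expf_neq0 // pnatr_eq0.
  have A2 : 0 <= A / 2 ^+ n * expR (k * (r - t0)) by rewrite mulr_ge0 ?expR_ge0 // divr_ge0 // exprn_ge0.
  move: h1 h2; rewrite e1 e2 !fct_subE (hnormB (X r xi)) => h1 h2.
  have := hnorm_triB (Y r xi) (F n.+2 r xi) (X r xi).
  by move: h1 h2 A2; move: (A / 2 ^+ n) (expR _) => y w; lra.
- by move=> t tt; have [_ /(_ tt)] := hX t.
Qed.
End Picard.

(** * From the fixed point to the solution *)

Section Conclusion.
Variables (R : realType) (H : completeNormedModType R[i]).
Variable ip : {dot H for (@Num.conj R[i])}.
Variable B : bernoulli_shift ip.
Local Notation Hip := (shift_hilbert B).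
Local Notation past := (past B).
Local Notation past_on := (past_on B).
Implicit Types (s t T : R) (X Y : R -> H -> H).

Variables (c : R -> H -> H) (Hc : additive_cocycle B c) (Hcentred : centred B c).
Variables (al be : R -> (H -> H) -> (H -> H)).
Hypotheses (Hal : coefficient B al) (Hbe : coefficient B be).
Hypotheses (Lal : lip_coef B al) (Lbe : lip_coef B be).
Variables (t0 : R) (Ht0 : 0 <= t0) (x0 : H -> H) (Hx0 : past t0 x0).

Local Notation good := (good B t0).
Local Notation picard := (picard B c al be t0 x0).

(** Before t0 the process is set to 0, so t0 is the only possible discontinuity. *)
Lemma good_procV X : good X -> (forall t, t < t0 -> X t = 0) -> procV B X.
Proof.
move=> [pX uX] X0; split=> [t _|T T0].
  have [/pX//|/X0 ->] := leP t0 t; exact: past0.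
have zero a b : exists Y : R -> H -> H, [/\ forall s, `[a, b]%classic s -> gmod B (Y s),
    stop_continuous_on B `[a, b] Y & forall s, b <= t0 -> a < s < b -> X s = Y s].
  have gz : gmod B 0 by exact: (gns_zero B (shift_vn B)).
  exists (fun=> 0); split=> //; last first.
    by move=> s bt /andP[_ sb]; apply: X0; exact: lt_le_trans bt.
  apply/stop_continuousP => // t ht xi hxi e e0; exists 1 => // s _ _.
  by rewrite subrr -[X in hnorm X]/(0 : H) hnorm0.
have soln b : exists Y : R -> H -> H, [/\ forall s, `[t0, b]%classic s -> gmod B (Y s),
    stop_continuous_on B `[t0, b] Y & forall s, t0 < s < b -> X s = Y s].
  have gX s : `[t0, b]%classic s -> gmod B (X s).
    by rewrite /= in_itv /= => /andP[ts _]; exact: past_gns (pX s ts).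
  exists X; split=> //; apply/stop_continuousP => // t; rewrite /= in_itv /= => /andP[tt tb].
  move=> xi hxi e e0; have [d d0 hd] := uX xi hxi b e e0; exists d => // s.
  by rewrite /= in_itv /= => /andP[ts sb] st; apply: hd => //; rewrite distrC.
have [Tt|tT] := leP T t0.
  have [T00|Tn0] := eqVneq T 0; first by exists [::]; [rewrite T00|].
  exists [:: T] => [|i]; first by split=> //=; rewrite lt_neqAle eq_sym Tn0 T0.
  case: i => // _; have [Y [h1 h2 h3]] := zero 0 T; exists Y; split=> // s; exact: h3.
have [t00|tn0] := eqVneq t0 0.
  exists [:: T] => [|i]; first by split=> //=; rewrite -t00 tT.
  by case: i => // _; have [Y [h1 h2 h3]] := soln T; exists Y; rewrite /pt /= -t00.
exists [:: t0; T] => [|i].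
  by split=> //=; rewrite tT lt_neqAle eq_sym tn0 Ht0.
case: i => [|[|]] // _.
  by have [Y [h1 h2 h3]] := zero 0 t0; exists Y; split=> // s; exact: h3.
Qed.

(** Integrals over a degenerate interval vanish: the only partition is empty. *)
Lemma picard_start X : picard X X -> X t0 = x0.
Proof.
move=> XX; have [a [b [ia ib ->]]] := XX t0 (lexx t0).
have z (m : R -> R -> (H -> H) -> H -> H) G w : is_int B m G t0 t0 w -> w = 0.
  move=> iw; apply: (gns_eq_on iw.1 (gns_zero B (shift_vn B))) => xi hxi.
  apply: hnorm_le_eps => e e0; have [d d0 hd] := iw.2 xi hxi e e0.
  have := hd [::] (conj isT erefl) (fun i => _); rewrite /= => /(_ (ltac:(by []))).
  by rewrite fct_subE sub0r hnormN => /ltW.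
by rewrite (z _ _ _ ia) (z _ _ _ ib) !addr0.
Qed.

Lemma picard_solves X : good X -> picard X X -> solves_ito B al be c t0 X.
Proof.
move=> gX XX t tt; have [a [b [ia ib e]]] := XX t tt.
have [h1 h2] := coef_past_on Hal Hbe Ht0 t (good_past gX) (lexx t0).
exists a, b; split.
- apply: (riemann_int Ht0 tt h1) => // xi hxi.
  exact: (coef_unif Ht0 Lal (good_past gX) hxi (gX.2 xi hxi t)).
- exact/(ito_integralE Hc b Ht0 h2).
- by rewrite (picard_start XX).
Qed.

Lemma solves_picard Y : adapted B Y -> Y t0 = x0 -> solves_ito B al be c t0 Y -> picard Y Y.
Proof.
move=> aY Y0 sY t tt; have [a [b [ia ib e]]] := sY t tt.
have pY : past_on t0 Y by move=> s ts; apply: aY; exact: le_trans ts.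
have [h1 h2] := coef_past_on Hal Hbe Ht0 t pY (lexx t0).
exists a, b; split; last by rewrite e Y0.
- exact: (riemann_left Ht0 h1).
- exact/(ito_integralE Hc b Ht0 h2).
Qed.

(** Every solution in V is bounded on compact intervals, so its weighted distance
   from X is finite and is halved by the contraction any number of times. *)
Lemma picard_unique X Y : good X -> picard X X -> procV B Y -> picard Y Y ->
  forall t, t0 <= t -> Y t = X t.
Proof.
move=> gX XX vY YY t tt; have t00 := le_trans Ht0 tt.
have pY : past_on t0 Y by move=> s ts; apply: vY.1; exact: le_trans ts.
apply: (gns_eq_on (past_gns (pY t tt)) (past_gns (gX.1 t tt))) => xi hxi.
have [k k0 hk] := contraction Hc Hcentred Hal Hbe Lal Lbe Ht0 x0 hxi tt.
have [M1 M10 h1] := unif_bounded (gX.2 xi hxi t).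
have [M2 M20 h2] := procV_bounded vY t00 hxi.
have M0 : 0 <= M1 + M2 by exact: addr_ge0.
have b0 : close t0 Y X xi t k (M1 + M2).
  move=> r tr rt.
  have e1 : 1 <= expR (k * (r - t0)) by rewrite -expR0 ler_expR mulr_ge0 ?subr_ge0 // ltW.
  apply: le_trans (_ : M1 + M2 <= _); last by apply: ler_peMr.
  have := hnormD (Y r xi) (- X r xi); rewrite fct_subE hnormN.
  by have := h1 r tr rt; have := h2 r (le_trans Ht0 tr) rt; lra.
apply: (close_eq M0 (k := k) _ tt (lexx t)); elim=> [|n IH]; first by rewrite expr0 divr1.
rewrite exprSr invfM mulrA; apply: (hk Y X) => //; last exact: gX.1.
by rewrite divr_ge0 // exprn_ge0.
Qed.

(** Uniform boundedness turns the bounds of the coefficients on each vector into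
   one operator bound for times in [t0, t + 1]; then picard_holder estimates
   the increments of X in norm. *)
Lemma picard_norm0_continuous X : good X -> picard X X -> norm0_continuous_on ip `[t0, +oo[ X.
Proof.
move=> gX XX t; rewrite /= in_itv /= andbT => tt.
apply/within_cvgP => e e0; pose T := t + 1.
have t0T : t0 <= T by rewrite /T; lra.
have pX := good_past gX.
pose F (i : bool * {r : R | t0 <= r <= T}) : H -> H :=
  if i.1 then al (sval i.2) (X (sval i.2)) else be (sval i.2) (X (sval i.2)).
have gF i : gmod B (F i).
  case: i => b [r hr]; rewrite /F /=; have /andP[tr rT] := hr.
  have [h1 h2] := coef_past_on Hal Hbe Ht0 r pX (lexx t0).
  by case: b; [exact: past_gns (h1 r tr (lexx r)) | exact: past_gns (h2 r tr (lexx r))].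
have [M M0 hM] : exists2 M : R, 0 <= M & forall i u, hnorm (F i u) <= M * hnorm u.
  apply: uniform_boundedness => [i|u]; first exact: gns_bop (gF i).
  have [M M0 hM] := coef_bounded Lal Lbe Ht0 T gX (proj0_in B u).
  exists M => i; rewrite -(gns_proj0 u (gF i)); case: i => b [r hr]; rewrite /F /=.
  by have /andP[tr rT] := hr; have [] := hM r tr rT; case: b.
have [D D0 hD] := picard_holder Hc Hcentred Hal Hbe Lal Lbe Ht0 x0 t0T.
have e2 : 0 < e / 2 by lra.
have [d d0 hd] := sqrt_small (mulr_ge0 (ltW D0) M0) e2.
have key s s' : t0 <= s -> s <= s' -> s' <= T -> s' - s < d -> opnorm (X s' - X s) <= e / 2.
  move=> ts ss' s'T h; have ts' := le_trans ts ss'.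
  apply: opnorm_le; first by apply: bop_sub; apply: past_bop; exact: pX.
    exact: ltW.
  move=> u; have hu r : t0 <= r -> r <= T -> hnorm (al r (X r) u) <= M * hnorm u /\
      hnorm (be r (X r) u) <= M * hnorm u.
    move=> tr rT; have hr : t0 <= r <= T by rewrite tr.
    by split; [exact: (hM (true, exist _ r hr) u) | exact: (hM (false, exist _ r hr) u)].
  apply: le_trans (hD X X u _ gX XX (mulr_ge0 M0 (hnorm_ge0 u)) hu s s' ts ss' s'T) _.
  rewrite !mulrA; apply: ler_wpM2r => //; rewrite -mulrA; apply/ltW/hd => //.
  by rewrite subr_ge0.
exists (Num.min d 1) => [|s]; first by rewrite lt_min d0 ltr01.
rewrite /= in_itv /= andbT lt_min => ts /andP[h1 h2].
have bXs := past_bop (pX s ts); have bXt := past_bop (pX t tt).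
rewrite sub0r normrN norm0E; [|exact: Hip|exact: bop_sub].
rewrite ger0_norm; last by apply: opnorm_ge0; exact: bop_sub.
suff : opnorm (X s - X t) <= e / 2 by lra.
have [st|st] := leP t s.
  apply: key => //; move: h2 h1; rewrite /T distrC ger0_norm ?subr_ge0 //; lra.
have h3 : opnorm (X t - X s) <= e / 2.
  apply: key => //; [exact: ltW | rewrite /T; lra | by rewrite gtr0_norm ?subr_gt0 // in h1].
apply: opnorm_le; [exact: bop_sub | exact: ltW |] => u.
rewrite fct_subE hnormB -fct_subE.
apply: le_trans (opnormP u (bop_sub bXt bXs)) _; exact: ler_wpM2r.
Qed.

(** The sums, hence the integrals and the iterates, stay in the local modules, and
   so does their limit. *)
Lemma picard_local X (F : nat -> R -> H -> H) :
  gmodI B `[0, t0] x0 -> locally_adapted_fun B al -> locally_adapted_fun B be ->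
  F 0%N = (fun t => if t0 <= t then x0 else 0) -> (forall n, good (F n)) ->
  (forall n, picard (F n) (F n.+1)) ->
  (forall t, t0 <= t -> forall u, hcvg (fun n => F n t u) (X t u)) ->
  forall t, t0 <= t -> gmodI B `[0, t] (X t).
Proof.
move=> lx0 lal lbe F0 gF FF lim.
have lF n t : t0 <= t -> gmodI B `[0, t] (F n t).
  elim: n t => [|n IH] t tt; first by rewrite F0 tt; exact: local_mono tt lx0.
  have [a [b [ia ib ->]]] := FF n t tt.
  have [h1 h2] := coef_past_on Hal Hbe Ht0 t (good_past (gF n)) (lexx t0).
  have vN := filt_vn B (itv_cc 0 t).
  apply: (gns_add vN); first apply: (gns_add vN).
  - exact: local_mono tt lx0.
  - apply: (int_in (riem_increments B) Ht0 tt h1 ia) => p [hp lp].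
    rewrite -lp; apply: isum_riem_local => // s ts _; apply: lal; last exact: IH.
    exact: le_trans ts.
  - apply: (int_in (dc_increments Hc) Ht0 tt h2 ib) => p [hp lp].
    rewrite -lp; apply: isum_dc_local => // s ts _; apply: lbe; last exact: IH.
    exact: le_trans ts.
move=> t tt; have cv := lim t tt.
have [w wN hw] := gns_complete (fun n => lF n t tt) (fun xi _ => hcvg_cauchy (cv xi)).
suff -> : X t = w by [].
by apply/funext => u; exact: hcvg_unique (cv u) (hw u).
Qed.
End Conclusion.

(** * The solution of the Ito equation *)

Theorem theorem7p3p1 (R : realType) (H : completeNormedModType R[i])
    (ip : {dot H for (@Num.conj R[i])}) (B : bernoulli_shift ip)
    (c : R -> H -> H) (al be : R -> (H -> H) -> (H -> H))
    (Hc : additive_cocycle B c) (Hcentred : centred B c)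
    (Hal : coefficient B al) (Hbe : coefficient B be)
    (HLip : forall xi : H, space0 B xi ->
      exists f g : R -> R,
        [/\ {within `[0, +oo[, continuous f},
            {within `[0, +oo[, continuous g} &
            forall a b : R, 0 <= a -> a <= b ->
            exists2 C : R, 0 <= C &
              forall (x y : H -> H) (t s : R),
                gmod B x -> gmod B y -> a <= t <= b -> a <= s <= b ->
                [/\ dsn ip xi (al t x - al s x)
                      <= C * (hnorm xi ^+ 2 + dsn ip xi x) * `|f t - f s|,
                    dsn ip xi (be t x - be s x)
                      <= C * (hnorm xi ^+ 2 + dsn ip xi x) * `|g t - g s|,
                    dsn ip xi (al t x - al t y) <= C * dsn ip xi (x - y) &
                    dsn ip xi (be t x - be t y) <= C * dsn ip xi (x - y)]])
    (t0 : R) (Ht0 : 0 <= t0) (x0 : H -> H) (Hx0 : gmodI B `]-oo, t0] x0) :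
  exists x : R -> H -> H,
    [/\ [/\ procV B x, x t0 = x0 & solves_ito B al be c t0 x],
        (forall y : R -> H -> H,
           procV B y -> y t0 = x0 -> solves_ito B al be c t0 y ->
           forall t, t0 <= t -> y t = x t),
        norm0_continuous_on ip `[t0, +oo[ x &
        (gmodI B `[0, t0] x0 ->
         locally_adapted_fun B al -> locally_adapted_fun B be ->
         forall t, t0 <= t -> gmodI B `[0, t] (x t))].
Proof.
have Lal : lip_coef B al.
  apply: (coef_lip_dsn) Hal => xi hxi; have [f [g [fc _ hf]]] := HLip xi hxi; exists f => // T T0.
  have [C C0 hC] := hf 0 T (lexx 0) T0; exists C => // x y t s gx gy ht hs.
  by have [] := hC x y t s gx gy ht hs.
have Lbe : lip_coef B be.
  apply: (coef_lip_dsn) Hbe => xi hxi; have [f [g [_ gc hf]]] := HLip xi hxi; exists g => // T T0.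
  have [C C0 hC] := hf 0 T (lexx 0) T0; exists C => // x y t s gx gy ht hs.
  by have [] := hC x y t s gx gy ht hs.
have [X [gX XX X0 [F [F0 gF FF lim]]]] := picard_fixpoint Hc Hcentred Hal Hbe Lal Lbe Ht0 Hx0.
have vX := good_procV Ht0 gX X0.
exists X; split.
- split=> //; [exact: picard_start XX | exact: (picard_solves Hc Hal Hbe Lal Ht0 gX XX)].
- move=> Y vY Y0 sY; apply: (picard_unique Hc Hcentred Hal Hbe Lal Lbe Ht0 gX XX vY).
  exact: (solves_picard Hc Hal Hbe Ht0 vY.1 Y0 sY).
- exact: (picard_norm0_continuous Hc Hcentred Hal Hbe Lal Lbe Ht0 gX XX).
- move=> lx0 lal lbe.
  apply: (picard_local Hc Hal Hbe Ht0 lx0 lal lbe F0 gF FF lim).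
Qed.
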